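(* Let $(E,d)$ be a Polish space, $x_0\in E$, let $(X_i)_{1\le i\le n}$ be i.i.d. $E$-valued random variables with common law $\mu$, $X$ a random variable with law $\mu$, and $L_n=\frac1n\sum_{i=1}^n\delta_{X_i}$. Let $S\subset E$ with $\mu(S)=1$. Let $p\ge1$ and assume there exist $\alpha<2p$ (with $\alpha>0$) and $\beta>0$ such that for every $r>0$ and every $\delta\in(0,2r]$, $N(S\cap B(x_0,r),\delta)\le\beta(2r/\delta)^\alpha$. Then, with positive constants $C_{\cdot}$ depending only on the indicated parameters: (1) If $\|X\|_{rp,w}<\infty$ for some $r>2$, then for any $q>r$ and any $x>0$, $$\mathbb P(W_p^p(L_n,\mu)>x)\le e^2\exp\left(-nC_{p,\alpha,\beta}\left[\frac{x}{I_{2p,p}}\right]^2\right)\mathbf 1_{x\le C_p\|d(x_0,X)\|_p^p}+C_{p,q,r}\left\{\frac{I_{2p,p}^q}{x^qn^{q/2}}+\frac{\|X\|_{rp,w}^{rp}}{x^rn^{r-1}}\right\}.$$ (2) If $I_{2p,p}<\infty$, then for any $x>0$, $\mathbb P(W_p^p(\mu,L_n)>x)\le C_{p,\alpha,\beta}\frac{I_{2p,p}^2}{x^2n}$. (3) If $\|X\|_{rp,w}<\infty$ for some $r\in(1,2)$, then for any $x>0$, $\mathbb P(W_p^p(\mu,L_n)>x)\le C_{p,\alpha,\beta,r}\frac{\|X\|_{rp,w}^{rp}}{x^rn^{r-1}}$.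
   Context: For $p\ge1$ and probability measures $\mu,\nu$ on $E$ with finite $p$-th moments, $W_p^p(\mu,\nu)=\inf_{\pi}\int d^p(x,y)\,\pi(dx,dy)$ over couplings $\pi$ of $\mu$ and $\nu$. For a bounded set $Y\subset E$ and $\delta>0$, $N(Y,\delta)$ is the minimal $m\in\mathbb N$ such that there exist $y_1,\dots,y_m\in Y$ with $Y\subset\bigcup_{j}B(y_j,\delta)$, $B(y,\rho)$ being the closed ball. The tail function is $H(t)=\mu(B(x_0,t)^c)$, the weak moment of order $s\ge1$ is defined by $\|X\|_{s,w}^s=\sup_{t\ge0}t^sH(t)$, and $I_{2p,p}=\int_0^\infty\sqrt{H(t)}\,t^{p-1}dt$. Also $\|d(x_0,X)\|_p^p=\mathbb E[d(x_0,X)^p]$. *)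

(* Defs.v *)
From HB Require Import structures.
From mathcomp Require Import all_boot all_order all_algebra.
From mathcomp Require Import all_classical all_reals all_analysis.
Set Implicit Arguments. Unset Strict Implicit. Unset Printing Implicit Defensive.
Import Order.TTheory GRing.Theory Num.Theory.
Import numFieldNormedType.Exports.
Local Open Scope classical_set_scope.
Local Open Scope ring_scope.

Section Defs.
Variable R : realType.

Section Metric.
Context {E : Type} (d : E -> E -> R).

Definition is_metric : Prop :=
  (forall x y, 0 <= d x y) /\ (forall x y, d x y = 0 <-> x = y) /\
  (forall x y, d x y = d y x) /\ (forall x y z, d x z <= d x y + d y z).

Definition cball (x : E) (r : R) : set E := [set y | d x y <= r].
Definition oball (x : E) (r : R) : set E := [set y | d x y < r].

Definition d_open (A : set E) : Prop :=
  forall x, A x -> exists2 e : R, 0 < e & oball x e `<=` A.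

Definition d_complete : Prop :=
  forall u : nat -> E,
    (forall e : R, 0 < e -> exists N, forall m k, (N <= m)%N -> (N <= k)%N -> d (u m) (u k) < e) ->
    exists l, forall e : R, 0 < e -> exists N, forall m, (N <= m)%N -> d (u m) l < e.

Definition d_separable : Prop :=
  exists D : nat -> E, forall x (e : R), 0 < e -> exists k, d x (D k) < e.

(** N(Y, delta): minimal number of closed delta-balls centred in Y covering Y
    (+oo if there is no finite such cover) *)
Definition covering_number (Y : set E) (delta : R) : \bar R :=
  ereal_inf [set ((m%:R : R)%:E) | m in
    [set m : nat | exists y : 'I_m -> E,
        (forall j, Y (y j)) /\ Y `<=` [set z | exists j, cball (y j) delta z]]].
End Metric.

Definition polish {dE : measure_display} (E : measurableType dE) (d : E -> E -> R) : Prop :=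
  [/\ is_metric d, d_complete d, d_separable d &
      (@measurable _ E) = <<s [set A | d_open d A] >>].

Section Probabilistic.
Context {dE : measure_display} {E : measurableType dE} (d : E -> E -> R).

Definition tailH (x0 : E) (mu : probability E R) (t : R) : R :=
  fine (mu (~` cball d x0 t)).

Definition weak_moment (x0 : E) (mu : probability E R) (s : R) : \bar R :=
  ereal_sup [set ((t `^ s) * tailH x0 mu t)%:E | t in [set t : R | 0 <= t]].

Definition I2pp (x0 : E) (mu : probability E R) (p : R) : \bar R :=
  (\int[@lebesgue_measure R]_(t in `[0%R, +oo[%classic)
      ((Num.sqrt (tailH x0 mu t)) * t `^ (p - 1))%:E)%E.

Definition pmoment (x0 : E) (mu : probability E R) (p : R) : \bar R :=
  (\int[mu]_y ((d x0 y) `^ p)%:E)%E.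

Definition coupling (m1 m2 : set E -> \bar R) (pi : probability (E * E)%type R) : Prop :=
  (forall A, measurable A -> pi (A `*` setT) = m1 A) /\
  (forall B, measurable B -> pi (setT `*` B) = m2 B).

Definition Wpp (p : R) (m1 m2 : set E -> \bar R) : \bar R :=
  ereal_inf [set (\int[pi]_z ((d z.1 z.2) `^ p)%:E)%E
            | pi in [set pi : probability (E * E)%type R | coupling m1 m2 pi]].

Definition empirical (n : nat) (xs : 'I_n -> E) : set E -> \bar R :=
  fun A => (((n%:R : R)^-1)%:E * (\sum_(i < n) \d_(xs i) A))%E.
End Probabilistic.

Definition iid {dO : measure_display} {O : measurableType dO} (P : probability O R)
  {dE : measure_display} {E : measurableType dE} (mu : probability E R)
  (n : nat) (X : 'I_n -> O -> E) : Prop :=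
  [/\ (forall i, measurable_fun setT (X i)),
      (forall i B, measurable B -> P (X i @^-1` B) = mu B) &
      (forall B : 'I_n -> set E, (forall i, measurable (B i)) ->
         P (\bigcap_(i in [set: 'I_n]) (X i @^-1` B i)) =
         (\prod_(i < n) P (X i @^-1` B i))%E)].

End Defs.
Arguments empirical {R dE E n}.

(* Main.v *)
(* Restrict to a large ball [B(x0, rho)], cut it into dyadic shells around [x0] and
   refine each shell by nested partitions obtained from the covering numbers.
   Transporting mass level by level bounds [W_p^p (L_n, mu)] by a deterministic remainder
   plus [n^-1] times a weighted l^1 norm of a centred random walk whose coordinates are
   the fluctuations of the cell counts, so only finitely many labels are involved.
   With [kappa = \sum_F W_F sqrt (mu F)] the second moment of the norm of this walk is
   at most [n kappa ^ 2], and [alpha < 2 p] makes the sum over the levels geometric,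
   which leaves [kappa <= C I_{2p,p}].  Chebyshev's inequality gives (2), and also (3)
   once the radius is chosen with [rho ^ p = n x].  For (1), iterating the
   Hoffmann-Jorgensen inequality raises the quadratic tail to any power, at the price
   of the probability of one large jump, which the weak moment controls; when [x] is
   of the order of [I_{2p,p} / sqrt n] the exponential term exceeds [1], and when [x]
   exceeds a multiple of the p-th moment the shells alone suffice, so that the
   constants no longer involve the covering numbers. *)
Require Import Defs.
From HB Require Import structures.
From mathcomp Require Import all_boot all_order all_algebra.
From mathcomp Require Import all_classical all_reals all_analysis measurable_realfun.
From mathcomp Require Import ring lra.
Set Implicit Arguments. Unset Strict Implicit. Unset Printing Implicit Defensive.
Import Order.TTheory GRing.Theory Num.Theory.
Import numFieldNormedType.Exports.
Local Open Scope classical_set_scope.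
Local Open Scope ring_scope.

(** * Sums of independent finitely valued vectors *)

(** The obstacle in (1) is that the constant of the polynomial terms may depend on [p], [q], [r]
    only, while [kappa] is controlled by [K * I], with [I] for [I_{2p,p}] and a chaining constant K
    made of [alpha] and [beta]. As soon as [K ^ 2 * I <= x * sqrt n], one has [(K * I) ^ 2 / (n * x
    ^ 2) <= I / (x * sqrt n)]: half of the quadratic decay pays for K, and squaring the tail often
    enough restores any power. No exponential moment is ever estimated. Since the labels are
    finitely many, all laws are finite sums, and conditioning on the first step is an induction on
    [n]; no product space is built. The cutoffs (radius, number of shells, depth) leave errors that
    vanish only in the limit, so the deviation bounds are first proved up to an arbitrary [e > 0].
    Comparing the deviation event with an event on labels requires it to be measurable, although an
    infimum over all couplings defines it; this is why semicontinuity of the transport cost in the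
    sample is established. *)

Section Walk.
Variables (R : realType) (T J : finType) (b : T -> R) (W : J -> R) (Y : T -> J -> R).
Hypothesis b_ge0 : forall t, 0 <= b t.
Hypothesis b_sum1 : \sum_t b t = 1.
Hypothesis W_ge0 : forall F, 0 <= W F.

Definition wnorm (v : J -> R) : R := \sum_F W F * `|v F|.

Definition wstep (v : J -> R) (t : T) : J -> R := fun F => v F + Y t F.

(** Expectation of [f] at the endpoint of a walk from [v] with [n] independent steps of law [b].
    Recursion on the first step builds the Markov property into the definition. *)
Fixpoint walkE (n : nat) (f : (J -> R) -> R) (v : J -> R) : R :=
  if n is m.+1 then \sum_t b t * walkE m f (wstep v t) else f v.

(** Probability that the walk exceeds [h] in norm at one of the times 0, ..., n; the starting point
    counts. *)
Fixpoint maxprob (n : nat) (h : R) (v : J -> R) : R :=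
  if h < wnorm v then 1 else
  if n is m.+1 then \sum_t b t * maxprob m h (wstep v t) else 0.

Definition endprob (n : nat) (h : R) : (J -> R) -> R :=
  walkE n (fun v => (h < wnorm v)%R%:R).

Definition jumpprob (s : R) : R := \sum_(t | s < wnorm (Y t)) b t.

Lemma wnorm_ge0 v : 0 <= wnorm v.
Proof. by apply: sumr_ge0 => F _; rewrite mulr_ge0. Qed.

Lemma ler_wnormD v w u : (forall F, u F = v F + w F) -> wnorm u <= wnorm v + wnorm w.
Proof.
move=> uE; rewrite /wnorm -big_split /=; apply: ler_sum => F _.
by rewrite uE -mulrDr ler_wpM2l // ler_normD.
Qed.

Lemma eq_wnorm v w : v =1 w -> wnorm v = wnorm w.
Proof. by move=> vw; apply: eq_bigr => F _; rewrite vw. Qed.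

Lemma ler_sum_b (f g : T -> R) : (forall t, f t <= g t) ->
  \sum_t b t * f t <= \sum_t b t * g t.
Proof. by move=> fg; apply: ler_sum => t _; rewrite ler_wpM2l. Qed.

Lemma sum_b_cst (c : R) : \sum_t b t * c = c.
Proof. by rewrite -mulr_suml b_sum1 mul1r. Qed.

Lemma maxprob_ge0 n h v : 0 <= maxprob n h v.
Proof.
elim: n v => [|n IH] v /=; case: ifP => // _.
by apply: sumr_ge0 => t _; rewrite mulr_ge0.
Qed.

Lemma maxprob_le1 n h v : maxprob n h v <= 1.
Proof.
elim: n v => [|n IH] v /=; case: ifP => // _.
by rewrite -[leRHS]sum_b_cst; apply: ler_sum_b.
Qed.

Lemma walkE_le n f g v : (forall w, f w <= g w) -> walkE n f v <= walkE n g v.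
Proof. by move=> fg; elim: n v => [|n IH] v //=; apply: ler_sum_b. Qed.

Lemma walkE_scale n c f v : walkE n (fun w => c * f w) v = c * walkE n f v.
Proof.
elim: n v => [|n IH] v //=; rewrite mulr_sumr; apply: eq_bigr => t _.
by rewrite IH mulrCA.
Qed.

Lemma walkE_sum n (I : finType) (f : I -> (J -> R) -> R) v :
  walkE n (fun w => \sum_i f i w) v = \sum_i walkE n (f i) v.
Proof.
elim: n v => [|n IH] v //=; rewrite exchange_big /=; apply: eq_bigr => t _.
by rewrite IH mulr_sumr.
Qed.

Lemma endprob_ge0 n h v : 0 <= endprob n h v.
Proof.
rewrite /endprob; elim: n v => [|n IH] v /=; first exact: ler0n.
by apply: sumr_ge0 => t _; rewrite mulr_ge0.
Qed.

Lemma endprob_le_maxprob n h v : endprob n h v <= maxprob n h v.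
Proof.
rewrite /endprob; elim: n v => [|n IH] v /=; case: ifP => // _.
  rewrite -[leRHS]sum_b_cst; apply: ler_sum_b => t.
  by apply: le_trans (IH _) _; apply: maxprob_le1.
exact: ler_sum_b.
Qed.

(** Driven by the same steps, the walks from [v] and from [w] keep the constant difference [v - w],
    so their norms never differ by more than [h - h']. *)
Lemma maxprob_shift n h h' v w : wnorm (fun F => v F - w F) <= h - h' ->
  maxprob n h v <= maxprob n h' w.
Proof.
elim: n v w => [|n IH] v w vw /=.
  case: ifPn => [hv|_]; last by case: ifP.
  suff -> : h' < wnorm w by [].
  have : wnorm v <= wnorm w + wnorm (fun F => v F - w F).
    by apply: ler_wnormD => F; ring.
  lra.
case: ifPn => [hv|_].
  suff -> : h' < wnorm w by [].
  have : wnorm v <= wnorm w + wnorm (fun F => v F - w F).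
    by apply: ler_wnormD => F; ring.
  lra.
case: ifP => _.
  rewrite -[leRHS]sum_b_cst; apply: ler_sum_b => t; exact: maxprob_le1.
apply: ler_sum_b => t; apply: IH; apply: le_trans vw.
by rewrite le_eqVlt; apply/orP; left; apply/eqP/eq_wnorm => F; rewrite /wstep; ring.
Qed.

Lemma maxprob_incr_n n h v : maxprob n h v <= maxprob n.+1 h v.
Proof.
elim: n v => [|n IH] v; rewrite [leLHS]/= [leRHS]/=; case: ifP => // _.
  by apply: sumr_ge0 => t _; rewrite mulr_ge0 //; case: ifP.
apply: ler_sum_b => t; exact: IH.
Qed.

Lemma maxprobS n h v : wnorm v <= h ->
  maxprob n.+1 h v = \sum_t b t * maxprob n h (wstep v t).
Proof. by move=> vh /=; rewrite ltNge vh. Qed.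

Lemma jumpprob_ge0 s : 0 <= jumpprob s.
Proof. exact: sumr_ge0. Qed.

(* Conditionally on the first passage above [t], the walk starts afresh from a
   point of norm at most [t + s] unless a jump larger than [s] occurred. *)
Lemma hoffmann_jorgensen n t s v : 0 <= s -> wnorm v <= t ->
  maxprob n (3 * t + s) v <=
  maxprob n t v * maxprob n (2 * t) (fun=> 0) + n%:R * jumpprob s.
Proof.
move=> s0; elim: n v => [|n IH] v vt.
  have t0 : 0 <= t := le_trans (wnorm_ge0 v) vt.
  rewrite /= !ltNge vt /= !mul0r addr0.
  suff -> : wnorm v <= 3 * t + s by [].
  lra.
have t0 : 0 <= t := le_trans (wnorm_ge0 v) vt.
set M := maxprob n.+1 (2 * t) _.
have MM : maxprob n (2 * t) (fun=> 0) <= M by apply: maxprob_incr_n.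
have M0 : 0 <= M by apply: maxprob_ge0.
rewrite (maxprobS _ vt) (@maxprobS _ (3 * t + s)); last by lra.
have -> : n.+1%:R * jumpprob s = n%:R * jumpprob s + jumpprob s.
  by rewrite -natr1 mulrDl mul1r.
have jE : jumpprob s = \sum_i b i * (s < wnorm (Y i))%R%:R.
  rewrite /jumpprob big_mkcond /=; apply: eq_bigr => i _.
  by case: ifP => _; rewrite ?mulr1 ?mulr0.
(* The extra [jumpprob s] is an average of indicators, so the claim can be checked for each first
   label separately: a large first jump is paid by its own indicator. *)
rewrite {2}jE -[n%:R * _]sum_b_cst mulr_suml -!big_split /=.
apply: ler_sum => i _; rewrite -mulrA -!mulrDr ler_wpM2l //.
have J0 := jumpprob_ge0 s.
case: (ltP s (wnorm (Y i))) => hY.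
  apply: le_trans (maxprob_le1 _ _ _) _.
  have : 0 <= maxprob n t (wstep v i) * M by rewrite mulr_ge0 // maxprob_ge0.
  have : 0 <= n%:R * jumpprob s by rewrite mulr_ge0.
  by rewrite (_ : true%:R = 1 :> R) //; lra.
rewrite addr0; have [vi|vi] := lerP (wnorm (wstep v i)) t.
  apply: le_trans (IH _ vi) _; rewrite lerD2r ler_wpM2l //.
  exact: maxprob_ge0.
have -> : maxprob n t (wstep v i) = 1 by case: (n) => [|m] /=; rewrite vi.
rewrite mul1r; apply: le_trans (_ : maxprob n (2 * t) (fun=> 0) <= _); last first.
  by apply: le_trans MM _; rewrite lerDl mulr_ge0.
apply: maxprob_shift.
have -> : wnorm (fun F => wstep v i F - 0) = wnorm (wstep v i).
  by apply: eq_wnorm => F; rewrite subr0.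
have : wnorm (wstep v i) <= wnorm v + wnorm (Y i) by apply: ler_wnormD.
lra.
Qed.

(** Two walks with common steps and starting points more than [2 * t] apart cannot both end within
    [t]. From a first passage above [2 * t], compare with the walk from 0: it ends above [t] with
    probability at most 1/2, so the other one does so with probability at least 1/2. The passage
    time is random, hence the hypothesis for every [k <= n]. *)
Lemma ottaviani n t v :
  (forall k, (k <= n)%N -> endprob k t (fun=> 0) <= 2^-1) ->
  maxprob n (2 * t) v <= 2 * endprob n t v.
Proof.
move=> Hh.
have gen k w u : 2 * t < wnorm (fun F => w F - u F) ->
    1 <= endprob k t w + endprob k t u.
  rewrite /endprob; elim: k w u => [|k IH] w u hw /=.
    have : wnorm (fun F => w F - u F) <= wnorm w + wnorm (fun F => - u F).
      exact: ler_wnormD.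
    have -> : wnorm (fun F => - u F) = wnorm u.
      by apply: eq_bigr => F _; rewrite normrN.
    case: (ltP t (wnorm w)) => h1; first by rewrite lerDl ler0n.
    by case: (ltP t (wnorm u)) => h2; rewrite ?lerDr ?ler0n //; lra.
  rewrite -big_split /= -[leLHS]sum_b_cst; apply: ler_sum => i _.
  rewrite -mulrDr ler_wpM2l //; apply: IH.
  by rewrite (eq_wnorm (w := fun F => w F - u F)) // => F; rewrite /wstep; ring.
have key k w : (k <= n)%N -> 2 * t < wnorm w -> 1 <= 2 * endprob k t w.
  move=> kn hw; have {}Hh := Hh k kn.
  suff : 1 <= endprob k t w + endprob k t (fun=> 0) by lra.
  by apply: gen; rewrite (eq_wnorm (w := w)) // => F; rewrite subr0.
have : (n <= n)%N by [].
move: {1 3 4}n => k; elim: k v => [|k IH] v kn.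
  rewrite [leLHS]/=; case: ifPn => hv; first exact: key.
  by rewrite mulr_ge0 // endprob_ge0.
rewrite [leLHS]/=; case: ifPn => hv; first exact: key.
rewrite /endprob /= mulr_sumr; apply: ler_sum => i _.
by rewrite mulrCA ler_wpM2l // IH // ltnW.
Qed.

(** Constants of the recursion [M' <= M ^ 2 + J] applied to [M <= A * Q + B * J]: for [J <= 1] the
    square is at most [2 * A ^ 2 * Q ^ 2 + 2 * B ^ 2 * J], and one more [J] is added. *)
Fixpoint hj_cst (j : nat) : R * R :=
  if j is i.+1 then (2 * (hj_cst i).1 ^+ 2, 2 * (hj_cst i).2 ^+ 2 + 1) else (1, 1).

Lemma hj_cst_ge1 j : 1 <= (hj_cst j).1 /\ 1 <= (hj_cst j).2.
Proof. by elim: j => [|j [IH1 IH2]] //=; split; nra. Qed.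

Lemma maxprob_decr n h h' v : h' <= h -> maxprob n h v <= maxprob n h' v.
Proof.
move=> hh; apply: maxprob_shift; rewrite /wnorm big1 ?subr_ge0 // => F _.
by rewrite subrr normr0 mulr0.
Qed.

Lemma jumpprob_decr s s' : s' <= s -> jumpprob s <= jumpprob s'.
Proof.
move=> ss; rewrite /jumpprob [leLHS]big_mkcond [leRHS]big_mkcond /=.
apply: ler_sum => t _; case: ifPn => [h|_]; last by case: ifP.
by rewrite (le_lt_trans ss h).
Qed.

Lemma maxprob_iter n j t : 0 <= t ->
  maxprob n (4 ^+ j * t) (fun=> 0) <=
    (hj_cst j).1 * maxprob n t (fun=> 0) ^+ (2 ^ j) +
    (hj_cst j).2 * (n%:R * jumpprob t).
Proof.
move=> t0; set J0 := n%:R * jumpprob t; set q := maxprob n t _.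
have J00 : 0 <= J0 by rewrite mulr_ge0 // jumpprob_ge0.
have q0 : 0 <= q by apply: maxprob_ge0.
elim: j => [|j IH]; first by rewrite expr0 !mul1r expn0 expr1 lerDl.
have [A1 B1] := hj_cst_ge1 j.
have t'0 : 0 <= 4 ^+ j * t by rewrite mulr_ge0 // exprn_ge0.
have hj : maxprob n (4 ^+ j.+1 * t) (fun=> 0) <= maxprob n (4 ^+ j * t) (fun=> 0) ^+ 2 + J0.
  set t' := 4 ^+ j * t in t'0 IH *.
  have -> : 4 ^+ j.+1 * t = 3 * t' + t' by rewrite exprS /t'; ring.
  apply: le_trans (@hoffmann_jorgensen n t' t' (fun=> 0) t'0 _) _.
    by rewrite /wnorm big1 // => F _; rewrite normr0 mulr0.
  apply: lerD; last first.
    rewrite ler_wpM2l // jumpprob_decr // /t' ler_peMl //.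
    by rewrite exprn_ege1 // ler1n.
  by rewrite expr2 ler_wpM2l // ?maxprob_ge0 // maxprob_decr //; lra.
have Q0 := maxprob_ge0 n (4 ^+ j * t) (fun=> 0).
rewrite [(hj_cst j.+1).1]/= [(hj_cst j.+1).2]/=.
rewrite expnS mulnC exprM; set Q := q ^+ (2 ^ j) in IH *.
have Qp : 0 <= Q by rewrite exprn_ge0.
(* For [J0 >= 1] the right side already exceeds 1; otherwise [J0 ^ 2 <= J0] keeps the jump term
   linear through all iterations. *)
have [J1|J1] := lerP 1 J0.
  by apply: le_trans (maxprob_le1 _ _ _) _; nra.
apply: le_trans hj _.
set M := maxprob _ _ _ in IH Q0 *.
have : M ^+ 2 <= ((hj_cst j).1 * Q + (hj_cst j).2 * J0) ^+ 2.
  by rewrite lerXn2r // ?nnegrE // addr_ge0 // mulr_ge0 //; lra.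
have : ((hj_cst j).1 * Q + (hj_cst j).2 * J0) ^+ 2 <=
       2 * ((hj_cst j).1 * Q) ^+ 2 + 2 * ((hj_cst j).2 * J0) ^+ 2.
  rewrite -subr_ge0; have -> : forall x y : R, 2 * x ^+ 2 + 2 * y ^+ 2 - (x + y) ^+ 2 = (x - y) ^+ 2.
    by move=> x y; ring.
  exact: sqr_ge0.
have : (hj_cst j).2 ^+ 2 * J0 ^+ 2 <= (hj_cst j).2 ^+ 2 * J0.
  by rewrite ler_wpM2l ?exprn_ge0 //; nra.
rewrite !exprMn; lra.
Qed.

(** * Second moment of the norm of a centred walk *)

Section SecondMoment.
Variable s : J -> R.
Hypothesis Y_mean0 : forall F, \sum_t b t * Y t F = 0.
Hypothesis Y_var : forall F, \sum_t b t * Y t F ^+ 2 <= s F.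
Hypothesis s_ge0 : forall F, 0 <= s F.

Lemma walkE_sqr n F v : walkE n (fun w => w F ^+ 2) v <= v F ^+ 2 + n%:R * s F.
Proof.
elim: n v => [|n IH] v /=; first by rewrite mul0r addr0.
apply: le_trans (ler_sum_b (fun t => IH (wstep v t))) _.
have -> : \sum_t b t * (wstep v t F ^+ 2 + n%:R * s F) =
   \sum_t (b t * (v F ^+ 2 + n%:R * s F) + (2 * v F) * (b t * Y t F) + b t * Y t F ^+ 2).
  by apply: eq_bigr => t _; rewrite /wstep; ring.
rewrite !big_split /= -mulr_sumr Y_mean0 mulr0 addr0 sum_b_cst -natr1 mulrDl mul1r.
by rewrite addrA lerD2l.
Qed.

(** Cauchy-Schwarz with free positive weights [c], obtained by symmetrizing the double sum and using
    [2ab <= a^2 + b^2] on each pair. The freedom matters: the choice [c = sqrt s] is what produces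
    [kappa]. *)
Lemma sqr_weighted_cauchy (u c : J -> R) : (forall F, 0 < c F) ->
  (\sum_F W F * `|u F|) ^+ 2 <=
  (\sum_F W F * c F) * (\sum_F W F * (u F ^+ 2 / c F)).
Proof.
move=> c0; rewrite expr2 !mulr_suml.
under eq_bigr do rewrite mulr_sumr.
under [leRHS]eq_bigr do rewrite mulr_sumr.
have dbl (f : J -> J -> R) : 2 * (\sum_F \sum_G f F G) = \sum_F \sum_G (f F G + f G F).
  under [RHS]eq_bigr do rewrite big_split /=.
  rewrite big_split /= [X in _ + X]exchange_big /=; ring.
rewrite -(ler_pM2l (_ : 0 < 2)) // !dbl; apply: ler_sum => F _; apply: ler_sum => G _.
have -> : W F * `|u F| * (W G * `|u G|) + W G * `|u G| * (W F * `|u F|) =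
  W F * W G * (2 * (`|u F| * `|u G|)) by ring.
have -> : W F * c F * (W G * (u G ^+ 2 / c G)) + W G * c G * (W F * (u F ^+ 2 / c F)) =
  W F * W G * (c F * (u G ^+ 2 / c G) + c G * (u F ^+ 2 / c F)) by ring.
rewrite ler_wpM2l ?mulr_ge0 //.
have cF := c0 F; have cG := c0 G.
have -> : c F * (u G ^+ 2 / c G) + c G * (u F ^+ 2 / c F) =
  2 * (`|u F| * `|u G|) + (c F * `|u G| - c G * `|u F|) ^+ 2 / (c F * c G).
  rewrite -[u G ^+ 2]real_normK ?num_real // -[u F ^+ 2]real_normK ?num_real //.
  by field; rewrite !gt_eqF.
by rewrite lerDl divr_ge0 ?sqr_ge0 // mulr_ge0 // ltW.
Qed.

Lemma walkE_wnorm2 n :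
  walkE n (fun w => wnorm w ^+ 2) (fun=> 0) <= n%:R * (\sum_F W F * Num.sqrt (s F)) ^+ 2.
Proof.
set k := \sum_F _; pose M := \sum_F W F.
have k0 : 0 <= k by apply: sumr_ge0 => F _; rewrite mulr_ge0 // sqrtr_ge0.
have M0 : 0 <= M by apply: sumr_ge0.
(* The optimal weight [sqrt (s F)] may vanish, so it is shifted by [e], which tends to 0
   afterwards. *)
have key e : 0 < e -> walkE n (fun w => wnorm w ^+ 2) (fun=> 0) <= n%:R * (k + e * M) ^+ 2.
  move=> e0; pose c F := Num.sqrt (s F) + e.
  have c0 F : 0 < c F by rewrite /c ltr_wpDl // sqrtr_ge0.
  have cE : \sum_F W F * c F = k + e * M.
    by rewrite /c mulr_sumr -big_split; apply: eq_bigr => F _ /=; ring.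
  apply: le_trans (walkE_le n (fun=> 0) (fun w => sqr_weighted_cauchy w c0)) _.
  rewrite walkE_scale walkE_sum cE expr2 mulrCA ler_wpM2l //.
    by rewrite addr_ge0 // mulr_ge0 // ltW.
  rewrite -cE mulr_sumr; apply: ler_sum => F _.
  rewrite walkE_scale mulrCA ler_wpM2l //.
  have -> : walkE n (fun w => w F ^+ 2 / c F) (fun=> 0) =
            (c F)^-1 * walkE n (fun w => w F ^+ 2) (fun=> 0).
    by rewrite -walkE_scale; congr walkE; apply/funext => w; rewrite mulrC.
  rewrite ler_pdivrMl //; apply: le_trans (walkE_sqr _ _ _) _.
  rewrite expr0n add0r mulrCA ler_wpM2l // -expr2.
  rewrite -{1}(sqr_sqrtr (s_ge0 F)) lerXn2r ?nnegrE ?sqrtr_ge0 //; first exact: ltW.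
  by rewrite /c lerDl ltW.
apply/ler_addgt0Pr => d d0.
pose e := Num.min 1 (d / (n%:R * (2 * k * M + M ^+ 2) + 1)).
have D0 : 0 <= n%:R * (2 * k * M + M ^+ 2).
  by rewrite mulr_ge0 // addr_ge0 ?sqr_ge0 // !mulr_ge0.
have e0 : 0 < e by rewrite lt_min ltr01 divr_gt0 // ltr_wpDl.
have e1 : e <= 1 by rewrite ge_min lexx.
have ed : e * (n%:R * (2 * k * M + M ^+ 2) + 1) <= d.
  by rewrite -ler_pdivlMr ?ltr_wpDl // ge_min lexx orbT.
apply: le_trans (key e e0) _.
have -> : n%:R * (k + e * M) ^+ 2 = n%:R * k ^+ 2 + e * (n%:R * (2 * k * M + e * M ^+ 2)).
  ring.
rewrite lerD2l; apply: le_trans ed; rewrite ler_wpM2l ?(ltW e0) //.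
rewrite -[leLHS]addr0 lerD // ler_wpM2l // lerD2l ler_piMl ?sqr_ge0 //.
Qed.

Lemma endprob_le_second_moment n t : 0 < t ->
  endprob n t (fun=> 0) <= n%:R * (\sum_F W F * Num.sqrt (s F)) ^+ 2 / t ^+ 2.
Proof.
move=> t0; have t20 : 0 < t ^+ 2 by rewrite exprn_gt0.
rewrite ler_pdivlMr //; apply: le_trans (walkE_wnorm2 n).
rewrite mulrC -walkE_scale; apply: walkE_le => w.
case: ltP => h; last by rewrite mulr0 sqr_ge0.
by rewrite mulr1 lerXn2r ?nnegrE ?wnorm_ge0 // ltW.
Qed.

(** The 8 is the factor 2 of Ottaviani's inequality times the 4 from using Chebyshev at [t / 2].
    When the hypothesis of Ottaviani's inequality is not ensured, the right side exceeds 1. *)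
Lemma maxprob_le_second_moment n t : 0 < t ->
  maxprob n t (fun=> 0) <= 8 * (n%:R * (\sum_F W F * Num.sqrt (s F)) ^+ 2 / t ^+ 2).
Proof.
move=> t0; set k := \sum_F _.
have tE : t = 2 * (t / 2) by rewrite mulrC divfK.
have t20 : 0 < t / 2 by rewrite divr_gt0.
have E m : m%:R * k ^+ 2 / (t / 2) ^+ 2 = 4 * (m%:R * k ^+ 2 / t ^+ 2).
  by field; rewrite gt_eqF.
have [h|h] := lerP (4 * (n%:R * k ^+ 2 / t ^+ 2)) 2^-1.
  rewrite {1}tE; apply: le_trans (@ottaviani n (t / 2) (fun=> 0) _) _.
    move=> m mn; apply: le_trans (endprob_le_second_moment m t20) _.
    rewrite E; apply: le_trans h; rewrite ler_wpM2l //.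
    by rewrite ler_wpM2r ?invr_ge0 ?sqr_ge0 // ler_wpM2r ?sqr_ge0 // ler_nat.
  have := endprob_le_second_moment n t20; rewrite -/k E; lra.
apply: le_trans (maxprob_le1 _ _ _) _; lra.
Qed.

End SecondMoment.
End Walk.

(** * Transport along nested partitions *)

Section Transport.
Variables (R : realType) (I J T : finType).
Implicit Types (a : I -> R) (b : J -> R).

Definition fiber_sum (K : finType) (f : K -> T) (a : K -> R) (F : T) : R :=
  \sum_(k | f k == F) a k.

Lemma fiber_sum_ge0 (K : finType) (f : K -> T) (a : K -> R) F :
  (forall k, 0 <= a k) -> 0 <= fiber_sum f a F.
Proof. by move=> a0; apply: sumr_ge0. Qed.

Lemma le_fiber_sum (K : finType) (f : K -> T) (a : K -> R) k :
  (forall k, 0 <= a k) -> a k <= fiber_sum f a (f k).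
Proof.
by move=> a0; rewrite /fiber_sum (bigD1 k) //= lerDl sumr_ge0.
Qed.

Lemma sum_fiber (K : finType) (f : K -> T) (a : K -> R) (w : T -> R) :
  \sum_k w (f k) * a k = \sum_F w F * fiber_sum f a F.
Proof.
rewrite (partition_big f predT) //=; apply: eq_bigr => F _.
by rewrite /fiber_sum mulr_sumr; apply: eq_bigr => k /eqP ->.
Qed.

Lemma fiber_sum_coarsen (K : finType) (f g : K -> T) (h : T -> T) (a : K -> R) F :
  (forall k, g k = h (f k)) ->
  fiber_sum g a F = \sum_(G | h G == F) fiber_sum f a G.
Proof.
move=> gE; rewrite /fiber_sum (partition_big f (fun G => h G == F)) /=; last first.
  by move=> k; rewrite gE.
apply: eq_bigr => G /eqP hG; apply: eq_bigl => k; rewrite gE.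
by case: (f k =P G) => [->|]; rewrite ?andbF // hG eqxx.
Qed.

(** Inside a cell take the product plan [a i * b j / max (A, B)]. Dividing by the larger of the two
    cell masses exhausts the lighter side exactly and never overdraws the heavier one. *)
Lemma fiber_matching (u : I -> T) (v : J -> T) a b :
  (forall i, 0 <= a i) -> (forall j, 0 <= b j) ->
  exists m : I -> J -> R,
  [/\ forall i j, 0 <= m i j,
      forall i j, u i != v j \/ a i * b j = 0 -> m i j = 0,
      (forall i, \sum_j m i j <= a i) /\ (forall j, \sum_i m i j <= b j),
      forall F, fiber_sum u (fun i => a i - \sum_j m i j) F =
        fiber_sum u a F - Num.min (fiber_sum u a F) (fiber_sum v b F) &
      forall F, fiber_sum v (fun j => b j - \sum_i m i j) F =
        fiber_sum v b F - Num.min (fiber_sum u a F) (fiber_sum v b F)].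
Proof.
move=> a0 b0; pose A := fiber_sum u a; pose B := fiber_sum v b.
pose M F := Num.max (A F) (B F).
have A0 F : 0 <= A F by apply: fiber_sum_ge0.
have B0 F : 0 <= B F by apply: fiber_sum_ge0.
have M0 F : 0 <= M F by rewrite le_max A0.
pose m i j := if u i == v j then a i * b j / M (u i) else 0.
have rowE i : \sum_j m i j = a i * (B (u i) / M (u i)).
  rewrite /m -big_mkcond /= mulrA /B /fiber_sum mulr_sumr mulr_suml.
  by apply: eq_bigl => j; rewrite eq_sym.
have colE j : \sum_i m i j = b j * (A (v j) / M (v j)).
  rewrite /m -big_mkcond /= mulrA /A /fiber_sum mulr_sumr mulr_suml.
  by apply: eq_bigr => i /eqP ->; rewrite [a i * _]mulrC.
have ratio1 x y : 0 <= x -> 0 <= y -> x / Num.max x y <= 1 :> R.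
  move=> x0 y0; have [->|xy] := eqVneq (Num.max x y) 0; first by rewrite invr0 mulr0.
  rewrite ler_pdivrMr ?mul1r ?le_max ?lexx //.
  by rewrite lt_neqAle eq_sym xy le_max x0.
have minE (x y : R) : 0 <= x -> 0 <= y -> x * (y / Num.max x y) = Num.min x y.
  move=> x0 y0; have [z0|xy] := eqVneq (Num.max x y) 0.
    have x00 : x = 0 by apply/eqP; rewrite eq_le x0 -z0 le_max lexx.
    have y00 : y = 0 by apply/eqP; rewrite eq_le y0 -z0 le_max lexx orbT.
    by rewrite x00 y00 mul0r minxx.
  by move: xy; case: (lerP x y) => h xy; rewrite mulrA ?mulfK // [x * y]mulrC mulfK.
exists m; split.
- by move=> i j; rewrite /m; case: ifP => // _; rewrite divr_ge0 // mulr_ge0.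
- by move=> i j; rewrite /m => -[/negbTE ->|->] //; rewrite mul0r if_same.
- split => [i|j]; rewrite ?rowE ?colE ler_piMr // /M; last exact: ratio1.
  by rewrite maxC; exact: ratio1.
- move=> F; rewrite /fiber_sum sumrB; congr (_ - _).
  transitivity (A F * (B F / M F)); last exact: minE.
  rewrite {1}/A /fiber_sum mulr_suml.
  by apply: eq_bigr => i /eqP <-; rewrite rowE.
- move=> F; rewrite /fiber_sum sumrB; congr (_ - _).
  transitivity (B F * (A F / M F)); last by rewrite /M maxC minE // minC.
  rewrite {1}/B /fiber_sum mulr_suml.
  by apply: eq_bigr => j /eqP <-; rewrite colE.
Qed.

(** Both sides are the positive part of the common difference. *)
Lemma residual_min (x y x' y' : R) : x - y = x' - y' ->
  x - Num.min x y = x' - Num.min x' y'.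
Proof.
by move=> h; case: (lerP x y) => h1; case: (lerP x' y') => h2; lra.
Qed.

(* Mass is matched inside the cells of the finest partition, then what is left
   over inside the next coarser cells, and so on; the mass left over in a cell
   [F] before the next level is [(A F - B F)^+]. *)
Lemma tree_transport (L : nat) (phi : nat -> I -> T) (psi : nat -> J -> T)
    (h : nat -> T -> T) (W : nat -> T -> R) (wb : J -> R) (c : I -> J -> R) a b :
  (forall i, 0 <= a i) -> (forall j, 0 <= b j) -> \sum_i a i = \sum_j b j ->
  (forall l i, (l < L)%N -> phi l i = h l (phi l.+1 i)) ->
  (forall l j, (l < L)%N -> psi l j = h l (psi l.+1 j)) ->
  (forall l F, 0 <= W l F) -> (forall j, 0 <= wb j) ->
  (forall i j, phi L i = psi L j -> c i j <= wb j) ->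
  (forall l i j, (l < L)%N -> phi l i = psi l j -> phi l.+1 i != psi l.+1 j ->
     c i j <= W l.+1 (phi l.+1 i)) ->
  (forall i j, phi 0 i != psi 0 j -> c i j <= W 0 (phi 0 i) + W 0 (psi 0 j)) ->
  exists q : I -> J -> R,
  [/\ forall i j, 0 <= q i j, forall i, \sum_j q i j = a i, forall j, \sum_i q i j = b j &
      \sum_i \sum_j q i j * c i j <= \sum_j b j * wb j +
       \sum_(0 <= l < L.+1) \sum_F W l F * `|fiber_sum (phi l) a F - fiber_sum (psi l) b F|].
Proof.
move=> a0 b0 ab hphi hpsi W0 wb0 cb cl cr.
pose A l := fiber_sum (phi l) a; pose B l := fiber_sum (psi l) b.
pose cost l := \sum_F W l F * `|A l F - B l F|.
have AB0 (x y : R) : x - Num.min x y <= `|x - y|.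
  by case: (lerP x y) => h1; lra.
have AB1 (x y : R) : (x - Num.min x y) + (y - Num.min x y) = `|x - y|.
  by case: (lerP x y) => h1; lra.
have step m : (m <= L)%N -> exists q : I -> J -> R,
  [/\ forall i j, 0 <= q i j,
      (forall i, \sum_j q i j <= a i) /\ (forall j, \sum_i q i j <= b j),
      forall F, fiber_sum (phi (L - m)%N) (fun i => a i - \sum_j q i j) F =
        A (L - m)%N F - Num.min (A (L - m)%N F) (B (L - m)%N F),
      forall F, fiber_sum (psi (L - m)%N) (fun j => b j - \sum_i q i j) F =
        B (L - m)%N F - Num.min (A (L - m)%N F) (B (L - m)%N F) &
      \sum_i \sum_j q i j * c i j <= \sum_j b j * wb j +
        \sum_((L - m).+1 <= l < L.+1) cost l].
  elim: m => [_|m IH mL].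
    have [q [q0 qs [qa qb] rA rB]] := fiber_matching (phi L) (psi L) a0 b0.
    exists q; rewrite subn0; split => //.
    rewrite big_geq // addr0 exchange_big /=; apply: ler_sum => j _.
    apply: le_trans (_ : \sum_i q i j * wb j <= _); last first.
      by rewrite -mulr_suml ler_wpM2r.
    apply: ler_sum => i _; have [e|ne] := eqVneq (phi L i) (psi L j).
      by rewrite ler_wpM2l // cb.
    by rewrite qs ?mul0r //; left.
  have [q [q0 [qa qb] rA rB qc]] := IH (ltnW mL).
  set l := (L - m.+1)%N; have lE : (L - m)%N = l.+1 by rewrite /l subnSK.
  rewrite lE in rA rB qc.
  have lL : (l < L)%N by rewrite -lE leq_subr.
  pose ra i := a i - \sum_j q i j; pose rb j := b j - \sum_i q i j.
  have ra0 i : 0 <= ra i by rewrite subr_ge0.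
  have rb0 j : 0 <= rb j by rewrite subr_ge0.
  have [m' [m0 ms [ma mb] mA mB]] := fiber_matching (phi l) (psi l) ra0 rb0.
  (* Each matching removes the same mass from both sides of a cell, so the difference of the
     residual masses in a coarser cell is still that of the original masses. *)
  have RAB F : fiber_sum (phi l) ra F - fiber_sum (psi l) rb F = A l F - B l F.
    rewrite /A /B !(fiber_sum_coarsen _ _ (fun k => hphi l k lL)).
    rewrite !(fiber_sum_coarsen _ _ (fun k => hpsi l k lL)).
    rewrite -!sumrB; apply: eq_bigr => G _.
    by rewrite rA rB /A /B; ring.
  exists (fun i j => q i j + m' i j); split.
  - by move=> i j; rewrite addr_ge0.
  - split => [i|j]; rewrite big_split /= -lerBrDl; [exact: ma|exact: mb].
  - move=> F; have := mA F; rewrite (residual_min (RAB F)) => <-.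
    by apply: eq_bigr => i _; rewrite big_split /= opprD addrA.
  - move=> F.
    have RBA : fiber_sum (psi l) rb F - fiber_sum (phi l) ra F = B l F - A l F.
      by have := RAB F; lra.
    rewrite [in RHS]minC -(residual_min RBA) [in RHS]minC -mB.
    by apply: eq_bigr => j _; rewrite big_split /= opprD addrA.
  - under eq_bigr do under eq_bigr do rewrite mulrDl.
    under eq_bigr do rewrite big_split /=.
    rewrite big_split /= big_ltn // [cost _ + _]addrC addrA; apply: lerD => //.
    apply: le_trans (_ : \sum_i \sum_j m' i j * W l.+1 (phi l.+1 i) <= _).
      apply: ler_sum => i _; apply: ler_sum => j _.
      have [e|ne] := eqVneq (phi l i) (psi l j); last first.
        by rewrite ms ?mul0r //; left.
      have [e1|ne1] := eqVneq (phi l.+1 i) (psi l.+1 j); last by rewrite ler_wpM2l // cl.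
      (* The matching at level [l.+1] exhausted one side of every cell, so two residual masses in a
         common cell of that level cannot both be nonzero. Hence only pairs separated at level
         [l.+1] are charged. *)
      suff ab0 : ra i * rb j = 0 by rewrite ms ?mul0r //; right.
      have := le_fiber_sum (phi l.+1) i ra0; have := le_fiber_sum (psi l.+1) j rb0.
      rewrite -e1 rA rB; have := ra0 i; have := rb0 j.
      case: (lerP (A l.+1 (phi l.+1 i)) (B l.+1 (phi l.+1 i))) => _; rewrite subrr => h1 h2 h3 h4.
        by rewrite (_ : ra i = 0) ?mul0r //; lra.
      by rewrite (_ : rb j = 0) ?mulr0 //; lra.
    rewrite /cost; apply: le_trans (_ : \sum_i W l.+1 (phi l.+1 i) * ra i <= _).
      by apply: ler_sum => i _; rewrite -mulr_suml mulrC ler_wpM2l.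
    rewrite sum_fiber; apply: ler_sum => F _; rewrite ler_wpM2l // rA; exact: AB0.
have [q [q0 [qa qb] rA rB qc]] := step L (leqnn L).
rewrite subnn in rA rB qc.
pose ra i := a i - \sum_j q i j; pose rb j := b j - \sum_i q i j.
have ra0 i : 0 <= ra i by rewrite subr_ge0.
have rb0 j : 0 <= rb j by rewrite subr_ge0.
have rab : \sum_i ra i = \sum_j rb j.
  by rewrite !sumrB ab [X in _ - X = _]exchange_big.
pose S := \sum_i ra i; have S0 : 0 <= S by apply: sumr_ge0.
have raS i : ra i <= S by rewrite /S (bigD1 i) //= lerDl sumr_ge0.
have rbS j : rb j <= S by rewrite /S rab (bigD1 j) //= lerDl sumr_ge0.
(* What survives level 0 is matched independently. If [S = 0] all residuals vanish, so the
   conventional value of the division is harmless. *)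
pose m i j := ra i * rb j / S.
have mrow i : \sum_j m i j = ra i.
  rewrite /m -mulr_suml -mulr_sumr -rab -/S; have [z|nz] := eqVneq S 0.
    by rewrite z mulr0 mul0r; apply/eqP; rewrite eq_le ra0 -z raS.
  by rewrite mulfK.
have mcol j : \sum_i m i j = rb j.
  rewrite /m; under eq_bigr do rewrite -mulrA.
  rewrite -mulr_suml -/S; have [z|nz] := eqVneq S 0.
    by rewrite z mul0r; apply/eqP; rewrite eq_le rb0 -z rbS.
  by rewrite mulrCA divff // mulr1.
have m0 i j : 0 <= m i j by rewrite divr_ge0 // mulr_ge0.
exists (fun i j => q i j + m i j); split.
- by move=> i j; rewrite addr_ge0.
- by move=> i; rewrite big_split /= mrow /ra addrC subrK.
- by move=> j; rewrite big_split /= mcol /rb addrC subrK.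
under eq_bigr do under eq_bigr do rewrite mulrDl.
under eq_bigr do rewrite big_split /=.
rewrite big_split /= (@big_ltn _ _ _ 0 L.+1) // [X in _ <= _ + X]addrC addrA; apply: lerD => //.
apply: le_trans (_ : \sum_i \sum_j m i j * (W 0 (phi 0 i) + W 0 (psi 0 j)) <= _).
  apply: ler_sum => i _; apply: ler_sum => j _.
  have [e|ne] := eqVneq (phi 0 i) (psi 0 j); last by rewrite ler_wpM2l // cr.
  suff -> : m i j = 0 by rewrite !mul0r.
  have := le_fiber_sum (phi 0) i ra0; have := le_fiber_sum (psi 0) j rb0.
  rewrite -e rA rB; have := ra0 i; have := rb0 j.
  case: (lerP (A 0 (phi 0 i)) (B 0 (phi 0 i))) => _; rewrite subrr => h1 h2 h3 h4.
    by rewrite /m (_ : ra i = 0) ?mul0r //; lra.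
  by rewrite /m (_ : rb j = 0) ?mulr0 ?mul0r //; lra.
have -> : \sum_i \sum_j m i j * (W 0%N (phi 0%N i) + W 0%N (psi 0%N j)) =
    \sum_i W 0%N (phi 0%N i) * ra i + \sum_j W 0%N (psi 0%N j) * rb j.
  transitivity (\sum_i (W 0%N (phi 0%N i) * ra i + \sum_j m i j * W 0%N (psi 0%N j))).
    apply: eq_bigr => i _; under eq_bigr do rewrite mulrDr.
    by rewrite big_split /= -mulr_suml mrow mulrC.
  rewrite big_split /= [X in _ + X]exchange_big /=; congr (_ + _).
  by apply: eq_bigr => j _; rewrite -mulr_suml mcol mulrC.
rewrite (sum_fiber (phi 0%N)) (sum_fiber (psi 0%N)) -big_split /=; apply: ler_sum => F _.
by rewrite -mulrDr ler_wpM2l // rA rB AB1.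
Qed.
End Transport.

(** * Couplings on a Polish space *)

Section MeasureTools.
Local Open Scope ereal_scope.
Context d (T : measurableType d) (R : realType).

Lemma ge0_integral_mrestr (mu : {measure set T -> \bar R}) (C : set T)
    (mC : measurable C) (f : T -> \bar R) :
  measurable_fun setT f -> (forall x, 0 <= f x) ->
  \int[mrestr mu mC]_x f x = \int[mu]_(x in C) f x.
Proof.
move=> mf f0.
rewrite -(setUv C) ge0_integral_setU //=; last 3 first.
- exact: measurableC.
- by rewrite setUv.
- by rewrite disj_set2E setICr.
rewrite [X in _ + X](_ : _ = 0); last first.
  rewrite -(integral_measure_zero (~` C) f); apply: eq_measure_integral => A mA AC.
  rewrite /= /mrestr /mzero (_ : A `&` C = set0) ?measure0 //.
  by rewrite -subset0 => x [/AC].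
rewrite adde0; apply: eq_measure_integral => A mA AC.
by rewrite /= /mrestr setIidl.
Qed.

Lemma finite_measure_sum (J : finType) (m : J -> {measure set T -> \bar R}) :
  exists M : {measure set T -> \bar R},
    (forall A, M A = \sum_j m j A) /\
    (forall f : T -> \bar R, measurable_fun setT f -> (forall x, 0 <= f x) ->
       \int[M]_x f x = \sum_j \int[m j]_x f x).
Proof.
pose m' k : {measure set T -> \bar R} :=
  if insub k is Some i then m (enum_val (i : 'I_#|J|)) else mzero.
have m'E (i : 'I_#|J|) : m' i = m (enum_val i) by rewrite /m' valK.
exists (msum m' #|J|); split => [A|f mf f0].
  rewrite /= /msum; transitivity (\sum_(i < #|J|) m (enum_val i) A).
    by apply: eq_bigr => i _; rewrite m'E.
  by rewrite -(big_enum_val (A := J) (fun j => m j A)).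
rewrite ge0_integral_measure_sum //.
transitivity (\sum_(i < #|J|) \int[m (enum_val i)]_x f x).
  by apply: eq_bigr => i _; rewrite m'E.
by rewrite -(big_enum_val (A := J) (fun j => \int[m j]_x f x)).
Qed.

Lemma measure_probability (M : {measure set T -> \bar R}) : M setT = 1 ->
  exists P : probability T R, forall A, P A = M A.
Proof.
move=> M1.
have M1' : (M setT == 0) || (M setT == +oo) = false.
  by rewrite M1 onee_eq0.
exists (mnormalize M (dirac point)) => A /=.
by rewrite /mnormalize M1' M1 /= invr1 mule1.
Qed.
End MeasureTools.

Lemma measure_fintype_partition d (E : measurableType d) (R : realType)
    (m : {measure set E -> \bar R}) (T : finType) (lab : E -> T) (B : set E) :
  (forall t, measurable (lab @^-1` [set t])) -> measurable B ->
  (m B = \sum_t m (B `&` lab @^-1` [set t]))%E.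
Proof.
move=> mC mB.
have ET : [set` enum T] = [set: T] by apply/seteqP; split => t //= _; rewrite mem_enum.
transitivity (\sum_(t <- enum T) m (B `&` lab @^-1` [set t]))%E; last by rewrite big_enum.
rewrite fsbig_seq ?enum_uniq // ET.
rewrite -measure_fin_bigcup //.
- congr (m _); apply/seteqP; split => [x Bx|x [t _ []]] //.
  by exists (lab x).
- by rewrite -ET; exact: finite_seq.
- apply/trivIsetP => t u _ _ tu; apply/seteqP; split => // x [[_ /= xt] [_ /= xu]].
  by move: tu; rewrite -xt xu eqxx.
- by move=> t _; exact: measurableI.
Qed.

Lemma ge0_image_measure d1 d2 (T1 : measurableType d1) (T2 : measurableType d2)
    (R : realType) (m : {measure set T1 -> \bar R}) (f : T1 -> T2) :
  measurable_fun setT f ->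
  exists M : {measure set T2 -> \bar R}, (forall A, M A = m (f @^-1` A)) /\
    (forall h : T2 -> \bar R, measurable_fun setT h -> (forall y, 0 <= h y)%E ->
       (\int[M]_y h y = \int[m]_x h (f x))%E).
Proof.
move=> mf.
pose mf_mixin := isMeasurableFun.Build _ _ _ _ _ mf.
pose F : {mfun T1 >-> T2} := HB.pack f mf_mixin.
exists (pushforward m F); split; first by [].
move=> h mh h0.
by rewrite ge0_integral_pushforward.
Unshelve. exact: mf.
Qed.

(** Restrict, push forward, rescale, add: both couplings constructed below, from a plan over cells
    and from a displaced sample, have this form. *)
Lemma image_measure_sum d1 d2 (T1 : measurableType d1) (T2 : measurableType d2)
    (R : realType) (m : {measure set T1 -> \bar R}) (J : finType) (c : J -> R)
    (C : J -> set T1) (f : J -> T1 -> T2) :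
  (forall j, 0 <= c j) -> (forall j, measurable (C j)) ->
  (forall j, measurable_fun setT (f j)) ->
  exists M : {measure set T2 -> \bar R},
    (forall A, M A = \sum_j (c j)%:E * m (f j @^-1` A `&` C j))%E /\
    (forall h : T2 -> \bar R, measurable_fun setT h -> (forall y, 0 <= h y)%E ->
       (\int[M]_y h y = \sum_j (c j)%:E * \int[m]_(x in C j) h (f j x))%E).
Proof.
move=> c0 mC mf.
have /choice[N NP] (j : J) : exists N : {measure set T2 -> \bar R},
    (forall A, N A = (c j)%:E * m (f j @^-1` A `&` C j))%E /\
    (forall h : T2 -> \bar R, measurable_fun setT h -> (forall y, 0 <= h y)%E ->
       (\int[N]_y h y = (c j)%:E * \int[m]_(x in C j) h (f j x))%E).
  have [M [ME MI]] := ge0_image_measure (mrestr m (mC j)) (mf j).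
  exists (mscale (NngNum (c0 j)) M); split => [A|h mh h0].
    by rewrite /= /mscale /= ME.
  rewrite ge0_integral_mscale //= MI // ge0_integral_mrestr //.
  exact: measurableT_comp.
have [M [ME MI]] := finite_measure_sum N.
exists M; split => [A|h mh h0].
  by rewrite ME; apply: eq_bigr => j _; exact: (NP j).1.
by rewrite MI //; apply: eq_bigr => j _; exact: (NP j).2.
Qed.

Lemma measurable_fun_lt d (T : measurableType d) (R : realType) (f : T -> R) :
  (forall r, measurable [set x | f x < r]) -> measurable_fun setT f.
Proof.
move=> mf; apply: (measurability _ (RGenInftyO.measurableE R)) => _ [_ [r ->] <-].
rewrite setTI [X in measurable X](_ : _ = [set x | f x < r]) //.
Qed.

Section Metric.
Context {R : realType} {dE : measure_display} {E : measurableType dE} (d : E -> E -> R).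
Hypothesis polish_d : polish d.

Lemma polish_ge0 x y : 0 <= d x y.
Proof. by case: polish_d => -[+ _] _ _ _; exact. Qed.

Lemma polish_sym x y : d x y = d y x.
Proof. by case: polish_d => -[_ [_ [+ _]]] _ _ _; exact. Qed.

Lemma polish_triangle x y z : d x z <= d x y + d y z.
Proof. by case: polish_d => -[_ [_ [_ +]]] _ _ _; exact. Qed.

Lemma polish_refl x : d x x = 0.
Proof. by case: polish_d => -[_ [+ _]] _ _ _ => /(_ x x) [_]; exact. Qed.

Lemma polish_eq0 x y : d x y = 0 -> x = y.
Proof. by case: polish_d => -[_ [+ _]] _ _ _ => /(_ x y) []. Qed.

Lemma measurable_d_open A : d_open d A -> measurable A.
Proof.
by case: polish_d => _ _ _ mE oA; rewrite mE; exact: sub_sigma_algebra.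
Qed.

Lemma measurable_oball x r : measurable (oball d x r).
Proof.
apply: measurable_d_open => y; rewrite /oball /= => xy.
exists (r - d x y); first by rewrite subr_gt0.
by move=> z /=; have := polish_triangle x y z; lra.
Qed.

Lemma measurable_dist x : measurable_fun setT (d x).
Proof. by apply: measurable_fun_lt => r; exact: measurable_oball. Qed.

Lemma measurable_cball x r : measurable (cball d x r).
Proof.
rewrite (_ : cball d x r = ~` (d x @^-1` `]r, +oo[%classic)).
  by apply: measurableC; rewrite -[X in measurable X]setTI; exact: measurable_dist.
by apply/seteqP; split => y /=; rewrite /cball /= in_itv /= andbT leNgt => /negP.
Qed.

Lemma measurable_point x : measurable [set x : E].
Proof.
rewrite (_ : [set x] = cball d x 0); first exact: measurable_cball.
apply/seteqP; split => y /=; rewrite /cball /=; first by move=> ->; rewrite polish_refl.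
by move=> h; apply/esym/polish_eq0/eqP; rewrite eq_le h polish_ge0.
Qed.

Lemma inv_natS_lt (e : R) : 0 < e -> exists k : nat, k.+1%:R^-1 < e.
Proof.
move=> e0; have [k _ /(_ k (leqnn k))] := near_infty_natSinv_lt (PosNum e0).
by move=> h; exists k.
Qed.

(** [E * E] carries the product sigma-algebra, so the open set [d < r] must be written as a
    countable union of products of balls; separability supplies their centres. *)
Lemma measurable_dist2 : measurable_fun setT (fun z : E * E => d z.1 z.2).
Proof.
apply: measurable_fun_lt => r; have [D sepD] : d_separable d by case: polish_d.
rewrite (_ : [set _ | _] = \bigcup_j \bigcup_k
   (oball d (D k) j.+1%:R^-1 `*` oball d (D k) (r - j.+1%:R^-1))).
  apply: bigcupT_measurable => j; apply: bigcupT_measurable => k.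
  by apply: measurableX; exact: measurable_oball.
apply/seteqP; split => [[x y] /= xy|[x y] [j _ [k _]] []]; rewrite /oball /=; last first.
  move: (j.+1%:R^-1) => e h1 h2.
  by have := polish_triangle x (D k) y; rewrite (polish_sym x (D k)); lra.
have [j jr] : exists j : nat, j.+1%:R^-1 < (r - d x y) / 2.
  by apply: inv_natS_lt; rewrite divr_gt0 // subr_gt0.
have [|k xk] := sepD x j.+1%:R^-1; first by rewrite invr_gt0.
exists j => //; exists k => //; split; rewrite /oball /= 1?(polish_sym (D k) x) //.
move: jr xk; move: (j.+1%:R^-1) => e jr xk.
by have := polish_triangle (D k) x y; rewrite (polish_sym (D k) x); lra.
Qed.

Lemma measurable_cost (p : R) : measurable_fun setT (fun z : E * E => (d z.1 z.2 `^ p)%:E).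
Proof.
apply/measurable_EFinP.
exact: (measurableT_comp (@measurable_powR R p) measurable_dist2).
Qed.

Lemma measurable_cost1 (p : R) x : measurable_fun setT (fun y => (d x y `^ p)%:E).
Proof.
apply/measurable_EFinP.
exact: (measurableT_comp (@measurable_powR R p) (measurable_dist x)).
Qed.

Local Open Scope ereal_scope.

Lemma Wpp_sym (p : R) (m1 m2 : set E -> \bar R) : Wpp d p m1 m2 = Wpp d p m2 m1.
Proof.
suff le m m' : Wpp d p m m' <= Wpp d p m' m by apply/eqP; rewrite eq_le !le.
rewrite /Wpp; apply: le_ereal_inf_tmp => _ [pi [pi1 pi2] <-].
have [M [ME MI]] := ge0_image_measure pi (@measurable_swap _ _ E E).
have M1 : M setT = 1 by rewrite ME; exact: (probability_setT pi).
have [pi' pi'E] := measure_probability M1.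
apply: ereal_inf_lbound; exists pi'.
  split => A mA; rewrite pi'E ME.
    rewrite -pi2 //; congr (pi _).
    by apply/seteqP; split => -[x y] /=; tauto.
  rewrite -pi1 //; congr (pi _).
  by apply/seteqP; split => -[x y] /=; tauto.
rewrite (eq_measure_integral M) => [|A mA _]; last exact: pi'E.
rewrite MI.
- by apply: eq_integral => -[x y] _ /=; rewrite polish_sym.
- exact: measurable_cost.
- by move=> z; rewrite lee_fin powR_ge0.
Qed.

End Metric.

Section Lift.
Context {R : realType} {dE : measure_display} {E : measurableType dE} (d : E -> E -> R).
Hypothesis polish_d : polish d.
Local Open Scope ereal_scope.

(** The mass [q i t] sent from [xs i] to the cell [t] is spread there proportionally to [mu]. The
    column condition then restores [mu] on every cell. *)
Lemma Wpp_le_cells (p : R) (mu : probability E R) (n : nat) (xs : 'I_n -> E)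
    (T : finType) (lab : E -> T) (q : 'I_n -> T -> R) :
  (forall t, measurable (lab @^-1` [set t])) ->
  (0 < n)%N -> (forall i t, 0 <= q i t)%R ->
  (forall i, \sum_t q i t = n%:R^-1)%R ->
  (forall t, \sum_i q i t = fine (mu (lab @^-1` [set t])))%R ->
  Wpp d p (empirical xs) mu <=
  \sum_i \sum_t (q i t / fine (mu (lab @^-1` [set t])))%:E *
     \int[mu]_(y in lab @^-1` [set t]) (d (xs i) y `^ p)%:E.
Proof.
move=> mC n0 q0 qrow qcol.
pose C t := lab @^-1` [set t]; pose b t := fine (mu (C t)).
have mC' t : measurable (C t) by exact: mC.
have bE t : mu (C t) = (b t)%:E by rewrite fineK // fin_num_measure.
have b0 t : (0 <= b t)%R by apply: fine_ge0.
(* A null cell receives no mass, which makes [q i t / b t * b t = q i t] hold although division by 0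
   yields 0. *)
have qb0 i t : b t = 0%R -> q i t = 0%R.
  move=> bt; apply/eqP; rewrite eq_le q0 andbT -bt /b /C -qcol (bigD1 i) //= lerDl.
  exact: sumr_ge0.
have [M [ME MI]] := @image_measure_sum _ _ E (E * E)%type R mu ('I_n * T)%type
  (fun it => q it.1 it.2 / b it.2)%R (fun it => C it.2) (fun it => pair (xs it.1))
  (fun it => divr_ge0 (q0 it.1 it.2) (b0 it.2)) (fun it => mC it.2)
  (fun it => pair1_measurable (xs it.1)).
have M_fst A : measurable A -> M (A `*` setT) = empirical xs A.
  move=> mA; rewrite ME /empirical -(pair_bigA _ (fun i t => (q i t / b t)%:E *
    mu ((fun y => (xs i, y)) @^-1` (A `*` setT) `&` C t))) /= ge0_sume_distrr //.
  apply: eq_bigr => i _; rewrite diracE.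
  have -> : ((fun y : E => (xs i, y)) @^-1` (A `*` setT)) = if xs i \in A then setT else set0.
    apply/seteqP; split => y /=; case: (boolP (xs i \in A)).
    - by [].
    - by rewrite notin_setE => ? [].
    - by rewrite inE.
    - by [].
  case: (boolP (xs i \in A)) => _ /=; last first.
    by rewrite mule0 big1 // => t _; rewrite set0I measure0 mule0.
  rewrite mule1 -(qrow i) -sumEFin; apply: eq_bigr => t _.
  rewrite setTI bE -EFinM; congr (_%:E).
  by have [bt|bt] := eqVneq (b t) 0%R; [rewrite qb0 // bt mulr0|rewrite divfK].
have M_snd B : measurable B -> M (setT `*` B) = mu B.
  move=> mB; rewrite ME -(pair_bigA _ (fun i t => (q i t / b t)%:E *
    mu ((fun y => (xs i, y)) @^-1` (setT `*` B) `&` C t))) /= exchange_big /=.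
  rewrite (measure_fintype_partition mu mC mB); apply: eq_bigr => t _.
  transitivity (\sum_(i < n) (q i t / b t)%:E * mu (B `&` C t)).
    apply: eq_bigr => i _; congr (_ * mu (_ `&` _)).
    by apply/seteqP; split => [y []|y] //=.
  rewrite -ge0_sume_distrl; last by move=> i _; rewrite lee_fin divr_ge0.
  rewrite sumEFin -mulr_suml qcol -/(C t) -/(b t).
  have [bt|bt] := eqVneq (b t) 0%R; last by rewrite divff // mul1e.
  rewrite bt invr0 mulr0 mul0e; apply/esym/(subset_measure0 _ _ (@subIsetr _ B (C t))) => //.
  - exact: measurableI.
  - by have := bE t; rewrite bt.
have M1 : M setT = 1.
  by rewrite -setXTT M_snd // probability_setT.
have [pi piE] := measure_probability M1.
apply: le_trans (_ : \int[pi]_z (d z.1 z.2 `^ p)%:E <= _).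
  apply: ereal_inf_lbound; exists pi => //.
  by split => A mA; rewrite piE ?M_fst ?M_snd.
rewrite (eq_measure_integral M) => [|A mA _]; last exact: piE.
rewrite MI; last 2 first.
- exact: measurable_cost.
- by move=> z; rewrite lee_fin powR_ge0.
by rewrite -(pair_bigA _ (fun i t => (q i t / b t)%:E *
  \int[mu]_(y in C t) (d (xs i) y `^ p)%:E)).
Qed.
End Lift.

(** * Measurability of the Wasserstein distance *)

(** Distinguish [b <= th * a] and [b > th * a]. The gain over a convexity bound is that the factor
    of [a ^ p] tends to 1 with [th], as semicontinuity requires. *)
Lemma powR_add_le (R : realType) (p a b th : R) : 0 <= p -> 0 <= a -> 0 <= b -> 0 < th ->
  (a + b) `^ p <= (1 + th) `^ p * a `^ p + (1 + th^-1) `^ p * b `^ p.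
Proof.
move=> p0 a0 b0 t0; have ti0 : 0 < th^-1 by rewrite invr_gt0.
have [h|h] := lerP b (th * a).
  apply: (@le_trans _ _ (((1 + th) * a) `^ p)).
    apply: ge0_ler_powR; rewrite ?nnegrE ?addr_ge0 ?mulr_ge0 ?addr_ge0 ?(ltW t0) //.
    by rewrite mulrDl mul1r lerD2l.
  by rewrite powRM ?addr_ge0 ?(ltW t0) // lerDl mulr_ge0 // powR_ge0.
apply: (@le_trans _ _ (((1 + th^-1) * b) `^ p)).
  apply: ge0_ler_powR; rewrite ?nnegrE ?addr_ge0 ?mulr_ge0 ?addr_ge0 ?(ltW ti0) //.
  rewrite mulrDl mul1r addrC lerD2l ler_pdivlMl //; exact: ltW.
by rewrite powRM ?addr_ge0 ?(ltW ti0) // lerDr mulr_ge0 // powR_ge0.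
Qed.

Section Usc.
Context {R : realType} {dE : measure_display} {E : measurableType dE} (d : E -> E -> R).
Hypothesis polish_d : polish d.
Variables (p : R) (mu : probability E R) (n : nat).
Hypotheses (p_gt0 : 0 < p) (n_gt0 : (0 < n)%N).
Local Open Scope ereal_scope.

(** Sample points may coincide; dividing by this multiplicity shares the mass of an atom equally
    among its indices. *)
Definition mult (xs : 'I_n -> E) (i : 'I_n) : nat := #|[pred j | xs j == xs i]|.

Lemma mult_gt0 xs i : (0 < mult xs i)%N.
Proof. by apply/card_gt0P; exists i; rewrite inE. Qed.

(** At a point whose first coordinate is an atom, exactly [mult] terms are active and each equals
    [g / mult]; elsewhere the sum is 0. *)
Lemma sum_inv_mult_le (xs : 'I_n -> E) (pi : {measure set (E * E) -> \bar R})
    (g : E * E -> \bar R) :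
  measurable_fun setT g -> (forall z, 0 <= g z) ->
  \sum_i ((mult xs i)%:R^-1%R)%:E * \int[pi]_(z in [set xs i] `*` setT) g z <=
  \int[pi]_z g z.
Proof.
move=> mg g0.
have mC i : measurable ([set xs i] `*` [set: E]).
  by apply: measurableX => //; exact: (measurable_point polish_d).
have gC i z : 0 <= (g \_ ([set xs i] `*` setT)) z by apply: erestrict_ge0.
have mgC i : measurable_fun setT (g \_ ([set xs i] `*` setT)).
  by apply/(measurable_restrictT _ _).1 => //; exact: measurable_funTS.
have i0 i : (0 <= (mult xs i)%:R^-1 :> R)%R by rewrite invr_ge0.
under eq_bigr do rewrite integral_mkcond -ge0_integralZl_EFin //.
rewrite -ge0_integral_sum //; last 2 first.
- by move=> i; exact: measurable_funeM.
- by move=> i z _; rewrite mule_ge0 // lee_fin.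
apply: ge0_le_integral => //.
- by move=> z _; apply: sume_ge0 => i _; rewrite mule_ge0 // lee_fin.
- by apply: emeasurable_sum => i; exact: measurable_funeM.
move=> z _.
have [[i0' zi]|nz] := pselect (exists i, z.1 = xs i); last first.
  rewrite big1 // => i _; rewrite patchE ifF ?mule0 //.
  by apply/negP; rewrite inE /= => -[zi _]; apply: nz; exists i.
rewrite (eq_bigr (fun i => if xs i == xs i0' then ((mult xs i0')%:R^-1%R)%:E * g z else 0)).
  rewrite -big_mkcond /= -ge0_sume_distrl; last by move=> i _; rewrite lee_fin.
  rewrite sumEFin big_const iter_addr_0 -[(_ *+ _)%R]mulr_natl.
  rewrite (_ : #|_| = mult xs i0'); last by apply: eq_card => j; rewrite !inE.
  by rewrite divff ?mul1e // pnatr_eq0 -lt0n mult_gt0.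
move=> i _; case: eqP => [e|ne].
  rewrite patchE ifT /mult ?e //; by rewrite inE /=; split => //; rewrite zi e.
rewrite patchE ifF ?mule0 //; apply/negP; rewrite inE /= => -[ze _].
by apply: ne; rewrite -zi.
Qed.

Lemma empirical_set1 (xs : 'I_n -> E) i :
  empirical xs [set xs i] = ((mult xs i)%:R / n%:R : R)%:E.
Proof.
rewrite /empirical /mult -sum1_card natr_sum big_mkcond /= [in RHS]mulrC EFinM -sumEFin.
congr (_ * _); rewrite [RHS]big_mkcond /=; apply: eq_bigr => j _.
rewrite diracE [in RHS]inE; case: eqP => [e|ne]; first by rewrite mem_set.
by rewrite memNset.
Qed.

(** The first coordinate is moved from [xs i] to [ys i] and the second one is kept. Splitting atoms
    by [mult] lets coinciding sample points be displaced to different places. *)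
Lemma perturb_coupling (xs ys : 'I_n -> E) (pi : probability (E * E)%type R) (th de : R) :
  coupling (empirical xs) mu pi -> (0 < th)%R ->
  (forall i, d (xs i) (ys i) <= de)%R ->
  Wpp d p (empirical ys) mu <=
  ((1 + th) `^ p)%:E * (\int[pi]_z (d z.1 z.2 `^ p)%:E) + ((1 + th^-1) `^ p * de `^ p)%:E.
Proof.
move=> [pi1 pi2] th0 xyde.
have mC i : measurable ([set xs i] `*` [set: E]).
  by apply: measurableX => //; exact: (measurable_point polish_d).
have i0 i : (0 <= (mult xs i)%:R^-1 :> R)%R by rewrite invr_ge0.
have mf i : measurable_fun setT (fun z : E * E => (ys i, z.2)).
  by apply: measurable_fun_pair => //; exact: measurable_snd.
have [M [ME MI]] := image_measure_sum pi i0 mC mf.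
have M_fst A : measurable A -> M (A `*` setT) = empirical ys A.
  move=> mA; rewrite ME /empirical ge0_sume_distrr //; apply: eq_bigr => i _.
  rewrite diracE; case: (boolP (ys i \in A)) => yA; last first.
    rewrite mule0 (_ : _ `&` _ = set0) ?measure0 ?mule0 //.
    by apply/seteqP; split => // z [/= [zA _] _]; move: yA; rewrite notin_setE.
  rewrite (_ : _ `&` _ = [set xs i] `*` setT); last first.
    apply/seteqP; split => [z []//|z [zx _]]; split => //=; split => //.
    by move: yA; rewrite inE.
  transitivity (((mult xs i)%:R^-1 : R)%:E * empirical xs [set xs i]).
    by congr (_ * _); apply: pi1; exact: (measurable_point polish_d).
  rewrite empirical_set1 -EFinM mule1 mulrA mulVf ?mul1r //.
  by rewrite pnatr_eq0 -lt0n mult_gt0.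
have M1 : M setT = 1.
  rewrite -setXTT M_fst // /empirical.
  under eq_bigr do rewrite diracT.
  rewrite sumEFin big_const iter_addr_0 card_ord -EFinM mulVf //.
  by rewrite pnatr_eq0 -lt0n.
have M_snd_le B : measurable B -> M (setT `*` B) <= mu B.
  move=> mB; have mTB : measurable ([set: E] `*` B) by exact: measurableX.
  rewrite -pi2 // ME.
  have := @sum_inv_mult_le xs pi (fun z => (\1_([set: E] `*` B) z)%:E).
  rewrite integral_indic // setIT => h.
  apply: le_trans (h _ _); last 2 first.
  - by apply/measurable_EFinP; exact: measurable_indic.
  - by move=> z; rewrite lee_fin.
  rewrite le_eqVlt; apply/orP; left; apply/eqP; apply: eq_bigr => i _.
  by rewrite integral_indic.
(* Both sides have total mass 1, so the inequality for [B] and for its complement forces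
   equality. *)
have M_snd B : measurable B -> M (setT `*` B) = mu B.
  move=> mB; apply/eqP; rewrite eq_le M_snd_le //=.
  have mTB : measurable ([set: E] `*` B) by exact: measurableX.
  have mTBC : measurable ([set: E] `*` ~` B) by apply: measurableX => //; exact: measurableC.
  have MU : M (setT `*` B) + M (setT `*` ~` B) = 1.
    rewrite -measureU //.
      rewrite -M1; congr (M _); apply/seteqP; split => // z _ /=.
      by have [Bz|nBz] := pselect (B z.2); [left|right].
    by apply/seteqP; split => // z [[_ Bz] [_ nBz]].
  have muU : mu (~` B) = 1 - mu B by exact: probability_setC.
  have Mf : M (setT `*` ~` B) <= 1 - mu B by rewrite -muU M_snd_le //; exact: measurableC.
  have muf : mu B \is a fin_num by exact: fin_num_measure.
  rewrite -(@leeD2rE _ (M (setT `*` ~` B))); last first.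
    rewrite ge0_fin_numE //; apply: le_lt_trans Mf _.
    by rewrite -(fineK muf) -EFinB ltry.
  rewrite MU; apply: le_trans (leeD2l (mu B) Mf) _.
  by rewrite addeC subeK.
have [pi' pi'E] := measure_probability M1.
apply: le_trans (_ : \int[pi']_z (d z.1 z.2 `^ p)%:E <= _).
  apply: ereal_inf_lbound; exists pi' => //.
  by split => A mA; rewrite pi'E ?M_fst ?M_snd.
rewrite (eq_measure_integral M) => [|A mA _]; last exact: pi'E.
rewrite MI; last 2 first.
- exact: (measurable_cost polish_d).
- by move=> z; rewrite lee_fin powR_ge0.
pose g (z : E * E) := ((1 + th) `^ p)%:E * (d z.1 z.2 `^ p)%:E + ((1 + th^-1) `^ p * de `^ p)%:E.
have g0 z : 0 <= g z.
  by rewrite /g -EFinM -EFinD lee_fin addr_ge0 // mulr_ge0 // powR_ge0.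
have mg1 : measurable_fun setT (fun z : E * E => ((1 + th) `^ p)%:E * (d z.1 z.2 `^ p)%:E).
  by apply: measurable_funeM; exact: (measurable_cost polish_d).
have mg : measurable_fun setT g by apply: emeasurable_funD.
have gE : \int[pi]_z g z = ((1 + th) `^ p)%:E * (\int[pi]_z (d z.1 z.2 `^ p)%:E) +
    ((1 + th^-1) `^ p * de `^ p)%:E.
  rewrite /g ge0_integralD //; last 2 first.
  - by move=> z _; rewrite -EFinM lee_fin mulr_ge0 // powR_ge0.
  - by move=> z _; rewrite lee_fin mulr_ge0 // powR_ge0.
  rewrite ge0_integralZl_EFin //; last 3 first.
  - by move=> z _; rewrite lee_fin powR_ge0.
  - exact: (measurable_cost polish_d).
  - exact: powR_ge0.
  by rewrite integral_cst //= probability_setT mule1.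
rewrite -gE; apply: le_trans (sum_inv_mult_le xs pi mg g0).
apply: lee_sum => i _; apply: lee_wpmul2l; first by rewrite lee_fin.
apply: ge0_le_integral => //.
- by move=> z _; rewrite lee_fin powR_ge0.
- apply: measurable_funTS.
  exact: (measurableT_comp (measurable_cost1 polish_d p (ys i)) measurable_snd).
- exact: measurable_funTS.
move=> [z1 z2] [/= -> _]; rewrite /g -EFinM -EFinD lee_fin /=.
have de0 : (0 <= de)%R := le_trans (polish_ge0 polish_d _ _) (xyde i).
apply: le_trans (_ : (d (xs i) z2 + de) `^ p <= _)%R; last first.
  by apply: powR_add_le => //; [exact: ltW|exact: polish_ge0].
apply: ge0_ler_powR; rewrite ?nnegrE ?addr_ge0 ?(polish_ge0 polish_d) //; first exact: ltW.
have := polish_triangle polish_d (ys i) (xs i) z2; have := xyde i.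
rewrite (polish_sym polish_d (ys i) (xs i)); lra.
Qed.

(** A coupling of cost [k < c] is perturbed: [th] is so small that [(1 + th) ^ p * k] stays below
    the midpoint of [k] and [c], then [de] so small that the displacement uses only half of the
    remaining gap. *)
Lemma Wpp_usc (xs : 'I_n -> E) (c : R) : Wpp d p (empirical xs) mu < c%:E ->
  exists2 de : R, (0 < de)%R & forall ys : 'I_n -> E, (forall i, d (xs i) (ys i) < de)%R ->
    Wpp d p (empirical ys) mu < c%:E.
Proof.
move=> /ereal_inf_lt[_ [pi cpi <-] kc].
set I := \int[pi]_z _ in kc.
have I0 : 0 <= I by apply: integral_ge0 => z _; rewrite lee_fin powR_ge0.
have If : I \is a fin_num by rewrite ge0_fin_numE //; apply: lt_trans kc (ltry _).
move: kc I0; rewrite -(fineK If); set k := fine I; rewrite lte_fin lee_fin => kc k0.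
pose c' := ((k + c) / 2)%R.
have [th th0 hth] : exists2 th, (0 < th)%R & ((1 + th) `^ p * k <= c')%R.
  have [->|kn0] := eqVneq k 0%R.
    by exists 1%R => //; rewrite mulr0 /c'; lra.
  have kp : (0 < k)%R by rewrite lt_neqAle eq_sym kn0.
  exists ((c' / k) `^ p^-1 - 1)%R.
    have : (1 `^ p^-1 < (c' / k) `^ p^-1)%R.
      rewrite gt0_ltr_powR ?invr_gt0 ?nnegrE ?ler01 //.
        by rewrite divr_ge0 // /c'; lra.
      by rewrite ltr_pdivlMr // mul1r /c'; lra.
    by rewrite powR1 subr_gt0.
  rewrite addrC subrK -powRrM mulVf ?gt_eqF // powRr1 ?divfK //.
  by rewrite divr_ge0 // /c'; lra.
pose A := ((1 + th^-1) `^ p)%R.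
have A0 : (0 < A)%R by rewrite powR_gt0 // addr_gt0 // invr_gt0.
have e0 : (0 < (c - c') / (2 * A))%R by rewrite divr_gt0 ?mulr_gt0 // /c'; lra.
exists (((c - c') / (2 * A)) `^ p^-1)%R; first exact: powR_gt0.
move=> ys xy.
apply: le_lt_trans (perturb_coupling cpi th0 (fun i => ltW (xy i))) _.
rewrite -/I -(fineK If) -/k -EFinM -EFinD lte_fin -/A -powRrM mulVf ?gt_eqF //.
rewrite powRr1 ?(ltW e0) //.
have -> : (A * ((c - c') / (2 * A)) = (c - c') / 2)%R by field; rewrite gt_eqF.
by move: hth; rewrite /c'; lra.
Qed.

(** By semicontinuity the set of good samples is open, hence a countable union of boxes with centres
    in the dense sequence and radii [1 / (j + 1)]. [pickle] enumerates the boxes, and [good] keeps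
    those contained in the set. *)
Lemma measurable_Wpp_lt {dO : measure_display} {O : measurableType dO}
    (X : 'I_n -> O -> E) (c : R) : (forall i, measurable_fun setT (X i)) ->
  measurable [set w | Wpp d p (empirical (fun i => X i w)) mu < c%:E].
Proof.
move=> mX; have [D sepD] : d_separable d by case: polish_d.
pose good (fj : {ffun 'I_n -> nat} * nat) := forall ys : 'I_n -> E,
  (forall i, d (D (fj.1 i)) (ys i) < fj.2.+1%:R^-1)%R -> Wpp d p (empirical ys) mu < c%:E.
pose B (k : nat) : set O := if unpickle k is Some fj then
   if pselect (good fj) then
     \bigcap_(i in [set: 'I_n]) (X i @^-1` oball d (D (fj.1 i)) fj.2.+1%:R^-1)
   else set0 else set0.
rewrite (_ : [set w | _] = \bigcup_k B k).
  apply: bigcupT_measurable => k; rewrite /B; case: unpickle => // fj.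
  case: (pselect (good fj)) => [a|a] //=; apply: fin_bigcap_measurable => // i _.
  by rewrite -[X in measurable X]setTI; apply: mX => //; exact: (measurable_oball polish_d).
apply/seteqP; split => [w /= /Wpp_usc[de de0 hde]|w [k _]]; last first.
  rewrite /B; case: unpickle => // fj; case: (pselect (good fj)) => [gfj|gfj] //= h.
  by apply: gfj => i; exact: h.
have [j jde] := inv_natS_lt (divr_gt0 de0 (ltr0n _ 2)).
have j0 : (0 < j.+1%:R^-1 :> R)%R by rewrite invr_gt0.
have [f hf] := choice (fun i => sepD (X i w) j.+1%:R^-1%R j0).
exists (pickle ([ffun i => f i] : {ffun 'I_n -> nat}, j)) => //.
rewrite /B pickleK; case: (pselect (good _)) => [a|[]] /=; last first.
  move=> ys hys; apply: hde => i; have := hys i; have := hf i; rewrite /= ffunE.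
  have := polish_triangle polish_d (X i w) (D (f i)) (ys i).
  by move: jde; move: (j.+1%:R^-1)%R => e; lra.
by move=> i _; rewrite /oball /= ffunE (polish_sym polish_d); exact: hf.
Qed.

Lemma measurable_Wpp_gt {dO : measure_display} {O : measurableType dO}
    (X : 'I_n -> O -> E) (x : R) : (forall i, measurable_fun setT (X i)) ->
  measurable [set w | x%:E < Wpp d p (empirical (fun i => X i w)) mu].
Proof.
move=> mX.
rewrite (_ : [set w | _] = \bigcup_k
   ~` [set w | Wpp d p (empirical (fun i => X i w)) mu < (x + k.+1%:R^-1)%:E]).
  by apply: bigcupT_measurable => k; apply: measurableC; exact: measurable_Wpp_lt.
apply/seteqP; split => [w /= xW|w [k _] /= /negP]; last first.
  by rewrite -leNgt; apply: lt_le_trans; rewrite lte_fin ltrDl invr_gt0.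
move: xW; case WE : (Wpp _ _ _ _) => [y| |] //=.
  rewrite lte_fin -subr_gt0 => /inv_natS_lt[k hk]; exists k => //=; rewrite WE.
  by apply/negP; rewrite -leNgt lee_fin -lerBrDl; exact: ltW.
by move=> _; exists 0%N => //=; rewrite WE.
Qed.

End Usc.

(** * Laws of the labels *)

Section IidLabels.
Variables (R : realType) (T : finType) (b : T -> R).

Definition tuple_prob (n : nat) (Q : pred (seq T)) : R :=
  \sum_(s : n.-tuple T | Q s) \prod_(t <- s) b t.

Lemma tuple_prob0 Q : tuple_prob 0 Q = (Q [::])%:R.
Proof.
rewrite /tuple_prob; case: (boolP (Q [::])) => h; last first.
  by rewrite big1 // => s; rewrite tuple0 /= (negbTE h).
rewrite (big_pred1 [tuple]) ?big_nil // => s; rewrite (tuple0 s) /= h.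
by apply/esym/eqP/val_inj.
Qed.

Lemma tuple_probS n Q :
  tuple_prob n.+1 Q = \sum_t b t * tuple_prob n (fun s => Q (t :: s)).
Proof.
rewrite /tuple_prob.
rewrite (reindex (fun ts : T * n.-tuple T => [tuple of ts.1 :: ts.2])) /=; last first.
  exists (fun s : n.+1.-tuple T => (thead s, [tuple of behead s])).
    by move=> [t s] _ /=; rewrite theadE; congr (_, _); apply: val_inj.
  by move=> s _ /=; rewrite [RHS]tuple_eta; apply: val_inj.
under [RHS]eq_bigr do rewrite mulr_sumr.
rewrite pair_big_dep /=; apply: eq_bigr => -[t s] _ /=.
by rewrite big_cons.
Qed.

Lemma endprob_tuple (J : finType) (W : J -> R) (Y : T -> J -> R) n h v :
  endprob b W Y n h v = tuple_prob n (fun s => h < wnorm W (foldl (wstep Y) v s)).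
Proof.
rewrite /endprob; elim: n v => [|n IH] v /=; first by rewrite tuple_prob0.
by rewrite tuple_probS; apply: eq_bigr => t _; rewrite IH.
Qed.

Lemma foldl_wstep (J : finType) (Y : T -> J -> R) v s F :
  foldl (wstep Y) v s F = v F + \sum_(t <- s) Y t F.
Proof.
elim: s v => [|t s IH] v /=; first by rewrite big_nil addr0.
by rewrite IH big_cons /wstep addrA.
Qed.

End IidLabels.

(** Independence is given for product events, which is the probability of each single tuple of
    labels; any event on labels is a finite disjoint union of those. *)
Lemma iid_labels (R : realType) (dO : measure_display) (O : measurableType dO)
    (P : probability O R) (dE : measure_display) (E : measurableType dE)
    (mu : probability E R) (n : nat) (X : 'I_n -> O -> E)
    (T : finType) (lab : E -> T) (Q : pred (seq T)) :
  iid P mu X -> (forall t, measurable (lab @^-1` [set t])) ->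
  measurable [set w | Q [seq lab (X i w) | i <- enum 'I_n]] /\
  P [set w | Q [seq lab (X i w) | i <- enum 'I_n]] =
  (tuple_prob (fun t => fine (mu (lab @^-1` [set t]))) n Q)%:E.
Proof.
move=> [mX lawX indX] mC.
pose L w := [tuple lab (X i w) | i < n].
have LE s : L @^-1` [set s] =
    \bigcap_(i in [set: 'I_n]) (X i @^-1` (lab @^-1` [set tnth s i])).
  apply/seteqP; split => w /=.
    by move=> <- i _ /=; rewrite tnth_mktuple.
  by move=> h; apply: eq_from_tnth => i; rewrite tnth_mktuple; exact: h.
have mXC i t : measurable (X i @^-1` (lab @^-1` [set t])).
  by rewrite -[X in measurable X]setTI; exact: mX.
have mL s : measurable (L @^-1` [set s]).
  rewrite LE; apply: fin_bigcap_measurable => // i _; exact: mXC.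
have QE : [set w | Q [seq lab (X i w) | i <- enum 'I_n]] =
    \bigcup_(s in [set` [seq s : n.-tuple T <- enum {: n.-tuple T} | Q s]]) (L @^-1` [set s]).
  apply/seteqP; split => w /=.
    by move=> Qw; exists (L w) => //=; rewrite mem_filter mem_enum andbT.
  by move=> [s /=]; rewrite mem_filter => /andP[Qs _] Ls; rewrite -[[seq _ | _ <- _]]/(val (L w)) Ls.
have mQ : measurable [set w | Q [seq lab (X i w) | i <- enum 'I_n]].
  by rewrite QE; apply: fin_bigcup_measurable => // i _; exact: mL.
split => //.
rewrite (measure_fintype_partition P mL mQ) /tuple_prob -sumEFin [RHS]big_mkcond /=.
apply: eq_bigr => s _; case: ifPn => Qs; last first.
  rewrite (_ : _ `&` _ = set0) ?measure0 //; apply/seteqP; split => // w [/= Qw Lw].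
  by move: Qs; rewrite -Lw /= Qw.
rewrite (_ : _ `&` _ = L @^-1` [set s]); last first.
  apply/seteqP; split => [w []//|w Lw]; split => //=.
  by rewrite -[[seq _ | _ <- _]]/(val (L w)) Lw.
rewrite LE indX //.
rewrite (eq_bigr (fun i => (fine (mu (lab @^-1` [set tnth s i])))%:E)); last first.
  by move=> i _; rewrite lawX // fineK // fin_num_measure.
rewrite big_tuple; apply: (big_ind2 (fun x (y : R) => x = y%:E)) => //.
by move=> x1 x2 y1 y2 -> ->; rewrite EFinM.
Qed.

(** * Tail estimates *)

Lemma powR_exprn (R : realType) (a s : R) (j : nat) : 0 <= a ->
  (a ^+ j) `^ s = (a `^ s) ^+ j.
Proof.
move=> a0; elim: j => [|j IH]; first by rewrite !expr0 powR1.
by rewrite !exprS powRM ?exprn_ge0 // IH.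
Qed.

Lemma powR_le1 (R : realType) (a s : R) : 0 <= s -> 0 <= a -> a <= 1 -> a `^ s <= 1.
Proof.
move=> s0 a0 a1; have : a `^ s <= 1 `^ s by apply: ge0_ler_powR; rewrite ?nnegrE.
by rewrite powR1.
Qed.

Lemma geometric_sum_le (R : realType) (z : R) (N : nat) : 0 <= z -> z < 1 ->
  \sum_(j < N) z ^+ j <= (1 - z)^-1.
Proof.
move=> z0 z1; have z1' : 0 < 1 - z by rewrite subr_gt0.
rewrite -div1r ler_pdivlMr // mulrC.
have -> : (1 - z) * (\sum_(j < N) z ^+ j) = 1 - z ^+ N.
  by rewrite -{2}(expr1n R N) subrXX; congr (_ * _); apply: eq_bigr => i _; rewrite expr1n mul1r.
by rewrite gerBl exprn_ge0.
Qed.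

Lemma dyadic_above (R : realType) (t : R) : 1 < t ->
  exists j : nat, 2 ^+ j < t /\ t <= 2 ^+ j.+1.
Proof.
move=> t1; have ex : exists m : nat, t <= 2 ^+ m.
  by exists (Num.bound t); apply/ltW/upper_nthrootP.
case: (ex_minnP ex) => -[|m] tm hm; first by move: tm; rewrite expr0 leNgt t1.
exists m; split => //; rewrite ltNge; apply/negP => h.
by have := hm m h; rewrite ltnn.
Qed.

(** By nonnegativity [f] is dominated by the sum of the [c j] on the [A j] as soon as each point has
    one suitable index; overlaps do no harm and only partial sums need a bound. *)
Lemma integral_le_series d (T : measurableType d) (R : realType)
    (m : {measure set T -> \bar R}) (D : set T) (f : T -> \bar R)
    (A : nat -> set T) (c : nat -> R) (B : \bar R) :
  measurable D -> measurable_fun D f -> (forall x, D x -> 0 <= f x)%E ->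
  (forall j, measurable (A j)) -> (forall j, 0 <= c j) ->
  (forall x, D x -> exists2 j, A j x & (f x <= (c j)%:E)%E) ->
  (forall N, \sum_(j < N) (c j)%:E * m (A j `&` D) <= B)%E ->
  (\int[m]_(x in D) f x <= B)%E.
Proof.
move=> mD mf f0 mA c0 dom bnd.
pose g j x := ((c j)%:E * (\1_(A j) x)%:E)%E.
have g0 j x : (0 <= g j x)%E by rewrite /g -EFinM lee_fin mulr_ge0.
have mI j : measurable_fun D (fun x => (\1_(A j) x : R)%:E).
  by apply/measurable_EFinP; exact: measurable_indic.
have mg j : measurable_fun D (g j) by apply: measurable_funeM.
apply: le_trans (_ : (\int[m]_(x in D) (\sum_(j <oo) g j x) <= _)%E).
  apply: ge0_le_integral => //.
    by apply: ge0_emeasurable_sum => // j x Dx _.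
  move=> x Dx; have [j Ajx fx] := dom x Dx.
  apply: le_trans fx _.
  apply: le_trans (nneseries_lim_ge j.+1 (fun k _ _ => g0 k x)).
  rewrite big_nat_recr //= {2}/g indicE mem_set // mule1 leeDr //.
  by apply: sume_ge0.
rewrite integral_nneseries //; apply: lime_le.
  by apply: is_cvg_nneseries => j _ _; apply: integral_ge0.
apply: nearW => N; rewrite big_mkord; apply: le_trans (bnd N).
rewrite le_eqVlt; apply/orP; left; apply/eqP/eq_bigr => j _.
by rewrite /g ge0_integralZl_EFin //= integral_indic.
Qed.

Section Tail.
Context {R : realType} {dE : measure_display} {E : measurableType dE} (d : E -> E -> R).
Hypothesis polish_d : polish d.
Variables (x0 : E) (mu : probability E R) (p : R).
Hypothesis p_ge1 : 1 <= p.

Let p_gt0 : 0 < p. Proof. exact: lt_le_trans p_ge1. Qed.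

Local Notation H := (tailH d x0 mu).

Lemma tailHE t : mu (~` cball d x0 t) = (H t)%:E.
Proof.
by rewrite fineK // fin_num_measure //; apply: measurableC; exact: measurable_cball.
Qed.

Lemma tailH_ge0 t : 0 <= H t.
Proof. exact: fine_ge0. Qed.

Lemma tailH_le1 t : H t <= 1.
Proof.
rewrite -lee_fin -tailHE; apply: probability_le1.
by apply: measurableC; exact: measurable_cball.
Qed.

Lemma le_tailH (A : set E) t : measurable A -> (forall y, A y -> t < d x0 y) ->
  fine (mu A) <= H t.
Proof.
move=> mA h; rewrite -lee_fin -tailHE fineK ?fin_num_measure //.
apply: le_measure; rewrite ?inE //.
  by apply: measurableC; exact: measurable_cball.
by move=> y /h ty; rewrite /cball /=; apply/negP; rewrite -ltNge.
Qed.

Lemma tailH_anti t u : t <= u -> H u <= H t.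
Proof.
move=> tu; apply: le_tailH; first by apply: measurableC; exact: measurable_cball.
by move=> y; rewrite /cball /= => /negP; rewrite -ltNge; exact: le_lt_trans.
Qed.

Let f (t : R) : \bar R := (Num.sqrt (H t) * t `^ (p - 1))%:E.

Lemma measurable_I2pp_integrand D : measurable D -> measurable_fun D f.
Proof.
move=> mD; apply/measurable_EFinP; apply: measurable_funM.
  apply: nonincreasing_measurable => // t u tu; apply: ler_wsqrtr; exact: tailH_anti.
by apply: measurable_funTS; exact: measurable_powR.
Qed.

Lemma I2pp_integrand_ge0 t : (0 <= f t)%E.
Proof. by rewrite lee_fin mulr_ge0 // ?sqrtr_ge0 // powR_ge0. Qed.

(** On an interval of length [a], bound the decreasing factor from below at the right end and the
    power at the left end. *)
Lemma I2pp_piece a : 0 < a ->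
  ((Num.sqrt (H (2 * a)) * a `^ p)%:E <=
   \int[lebesgue_measure]_(t in `]a, (2 * a)%R]%classic) f t)%E.
Proof.
move=> a0.
have -> : (Num.sqrt (H (2 * a)) * a `^ p)%:E =
  (\int[lebesgue_measure]_(t in `]a, (2 * a)%R]%classic) (Num.sqrt (H (2 * a)) * a `^ (p - 1))%:E)%E.
  rewrite integral_cst //= lebesgue_measure_itv /= lte_fin ifT; last lra.
  rewrite -EFinB -EFinM; congr (_%:E).
  rewrite -(mulr_powRB1 (ltW a0) p_gt0); ring.
apply: ge0_le_integral => //.
- by move=> t _; rewrite lee_fin mulr_ge0 // ?sqrtr_ge0 // powR_ge0.
- exact: measurable_I2pp_integrand.
move=> t /=; rewrite in_itv /= => /andP[at_ t2a]; rewrite lee_fin.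
apply: ler_pM; rewrite ?sqrtr_ge0 ?powR_ge0 //.
  by apply: ler_wsqrtr; exact: tailH_anti.
apply: ge0_ler_powR; rewrite ?nnegrE ?subr_ge0 //; last exact: ltW.
  exact: ltW.
by apply: ltW; exact: lt_trans at_.
Qed.

(** Term [k] is the piece with [a = rho / 2 ^ (k + 2)]: its right end is the argument of [H], and
    [rho / 2 ^ k = 4 * a] explains the factor [4 ^ p]. The pieces are disjoint. *)
Lemma I2pp_ge_dyadic (rho : R) (K : nat) : 0 < rho ->
  ((\sum_(k < K) (4 `^ p)^-1 * (rho / 2 ^+ k) `^ p * Num.sqrt (H (rho / 2 ^+ k.+1)))%:E
    <= I2pp d x0 mu p)%E.
Proof.
move=> r0.
have rk k : 0 < rho / 2 ^+ k by rewrite divr_gt0 // exprn_gt0.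
have rS k : rho / 2 ^+ k = 2 * (rho / 2 ^+ k.+1).
  by rewrite exprS; field; rewrite expf_neq0.
apply: le_trans (_ : _ <= \int[lebesgue_measure]_(t in `](rho / 2 ^+ K.+1)%R, (rho / 2)%R]%classic) f t)%E _; last first.
  rewrite /I2pp; apply: ge0_subset_integral => //.
  - exact: measurable_I2pp_integrand.
  - by move=> t _; exact: I2pp_integrand_ge0.
  move=> t /=; rewrite !in_itv /= => /andP[h _]; rewrite andbT.
  by apply: ltW; apply: lt_trans h.
elim: K => [|K IH]; first by rewrite big_ord0; apply: integral_ge0 => t _; exact: I2pp_integrand_ge0.
have mono k : rho / 2 ^+ k.+1 <= rho / 2.
  by rewrite ler_pM2l // lef_pV2 ?posrE ?exprn_gt0 // -{1}(expr1 2) ler_eXn2l ?ltr1n.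
have split_ : `](rho / 2 ^+ K.+2)%R, (rho / 2)%R]%classic =
   `](rho / 2 ^+ K.+1)%R, (rho / 2)%R]%classic `|` `](rho / 2 ^+ K.+2)%R, (rho / 2 ^+ K.+1)%R]%classic :> set R.
  have h1 := mono K; have h2 : rho / 2 ^+ K.+2 <= rho / 2 ^+ K.+1.
    by rewrite [leRHS]rS; have := rk K.+2; lra.
  apply/seteqP; split => t /=; rewrite !in_itv /=.
    move=> /andP[-> ->]; rewrite /= andbT.
    by case: (ltP (rho / 2 ^+ K.+1) t) => h; [left|right].
  by case=> /andP[u v]; apply/andP; split => //;
    [exact: le_lt_trans h2 u|exact: le_trans v h1].
rewrite split_ ge0_integral_setU //; last 3 first.
- exact: measurable_I2pp_integrand (measurableU _ _ _ _).
- by move=> t _; exact: I2pp_integrand_ge0.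
- apply/disj_setPS => t /=; rewrite !in_itv /= => -[/andP[u _] /andP[_ v]].
  by move: (lt_le_trans u v); rewrite ltxx.
rewrite big_ord_recr /= EFinD; apply: leeD => //.
have := I2pp_piece (rk K.+2); rewrite -rS; apply: le_trans.
rewrite lee_fin mulrC ler_wpM2l ?sqrtr_ge0 //.
have -> : rho / 2 ^+ K = 4 * (rho / 2 ^+ K.+2) by rewrite (rS K) (rS K.+1); ring.
by rewrite powRM ?(ltW (rk K.+2)) // mulrA mulVf ?mul1r.
Qed.

Section Weak.
Variable s : R.
Hypothesis weak_fin : (weak_moment d x0 mu s < +oo)%E.
Let wm : R := fine (weak_moment d x0 mu s).

Lemma weak_moment_ub t : 0 <= t -> t `^ s * H t <= wm.
Proof.
move=> t0.
have h : ((t `^ s * H t)%:E <= weak_moment d x0 mu s)%E.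
  by apply: ereal_sup_ubound; exists t.
rewrite -lee_fin fineK // ge0_fin_numE //; apply: le_trans h.
by rewrite lee_fin mulr_ge0 // ?powR_ge0 // tailH_ge0.
Qed.

Lemma weak_moment_ge0 : 0 <= wm.
Proof. by apply: le_trans (weak_moment_ub (lexx 0)); rewrite mulr_ge0 ?powR_ge0 ?tailH_ge0. Qed.

Lemma tailH_le_weak t : 0 < t -> H t <= wm * t `^ (- s).
Proof.
move=> t0; rewrite powRN ler_pdivlMr ?powR_gt0 // mulrC; apply: weak_moment_ub; exact: ltW.
Qed.

(** Cut at the radii [2 ^ j * rho]; the layer [j] contributes at most a multiple of
    [(2 ^ j * rho) ^ (p - s)], a geometric series of ratio below 1 because [p < s]. *)
Lemma integral_tail_le rho (C : set E) : p < s -> 0 < rho -> measurable C ->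
  (forall y, C y -> rho < d x0 y) ->
  (\int[mu]_(y in C) (d x0 y `^ p)%:E <=
   (2 `^ p / (1 - 2 `^ (p - s)) * wm * rho `^ (p - s))%:E)%E.
Proof.
move=> ps r0 mC hC.
have z0 : 0 <= 2 `^ (p - s) :> R by exact: powR_ge0.
have z1 : 2 `^ (p - s) < 1 :> R.
  have := @gt0_ltr_powR R (s - p) _ 1 2; rewrite powR1.
  rewrite subr_gt0 !nnegrE => /(_ ps ler01 (ler0n _ _) (ltr1n _ _)) h.
  by rewrite -opprB powRN invf_lt1 // powR_gt0.
apply: (@integral_le_series _ _ _ mu C _ (fun j => ~` cball d x0 (2 ^+ j * rho))
  (fun j => (2 ^+ j.+1 * rho) `^ p)) => //.
- by apply: measurable_funTS; exact: measurable_cost1.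
- by move=> y _; rewrite lee_fin powR_ge0.
- by move=> j; apply: measurableC; exact: measurable_cball.
- by move=> j; exact: powR_ge0.
- move=> y Cy; have : 1 < d x0 y / rho by rewrite ltr_pdivlMr // mul1r hC.
  move=> /dyadic_above[j [h1 h2]]; exists j.
    by rewrite /cball /=; apply/negP; rewrite -ltNge -ltr_pdivlMr.
  rewrite lee_fin; apply: ge0_ler_powR; rewrite ?nnegrE ?(polish_ge0 polish_d) //.
  - exact: ltW.
  - by rewrite mulr_ge0 ?exprn_ge0 // ltW.
  - by rewrite -ler_pdivrMr.
move=> N; apply: le_trans (_ : (\sum_(j < N) (2 `^ p * wm * rho `^ (p - s) * (2 `^ (p - s)) ^+ j)%:E <= _)%E).
  apply: lee_sum => j _.
  have jr : 0 < 2 ^+ j * rho by rewrite mulr_gt0 // exprn_gt0.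
  apply: le_trans (_ : (((2 ^+ j.+1 * rho) `^ p)%:E * (H (2 ^+ j * rho))%:E <= _)%E).
    rewrite lee_wpmul2l ?lee_fin ?powR_ge0 // -tailHE le_measure ?inE //.
    - by apply: measurableI => //; apply: measurableC; exact: measurable_cball.
    - by apply: measurableC; exact: measurable_cball.
  rewrite -EFinM lee_fin.
  apply: le_trans (_ : (2 ^+ j.+1 * rho) `^ p * (wm * (2 ^+ j * rho) `^ (- s)) <= _).
    by rewrite ler_wpM2l ?powR_ge0 // tailH_le_weak.
  rewrite exprS -mulrA powRM ?(ltW jr) // le_eqVlt; apply/orP; left; apply/eqP.
  have -> : 2 `^ p * (2 ^+ j * rho) `^ p * (wm * (2 ^+ j * rho) `^ (- s)) =
     2 `^ p * wm * ((2 ^+ j * rho) `^ p * (2 ^+ j * rho) `^ (- s)) by ring.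
  rewrite -powRD; last by rewrite (gt_eqF jr) implybT.
  rewrite powRM ?exprn_ge0 ?(ltW r0) // powR_exprn //; ring.
rewrite sumEFin lee_fin -mulr_sumr.
have := geometric_sum_le N z0 z1; set z := 2 `^ (p - s); set Sg := \sum_(j < N) _ => hg.
apply: le_trans (_ : 2 `^ p * wm * rho `^ (p - s) * (1 - z)^-1 <= _).
  by rewrite ler_wpM2l // !mulr_ge0 ?powR_ge0 ?weak_moment_ge0.
by rewrite le_eqVlt; apply/orP; left; apply/eqP; ring.
Qed.

Lemma pmoment_fin : p < s -> (pmoment d x0 mu p < +oo)%E.
Proof.
move=> ps; rewrite /pmoment.
have mc : measurable_fun setT (fun y => (d x0 y `^ p)%:E) by exact: measurable_cost1.
rewrite -(setvU (cball d x0 1)) ge0_integral_setU //; last 5 first.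
- by apply: measurableC; exact: measurable_cball.
- exact: measurable_cball.
- by rewrite setvU.
- by move=> y _; rewrite lee_fin powR_ge0.
- by rewrite disj_set2E setICl.
apply: lte_add_pinfty.
  apply: le_lt_trans (integral_tail_le ps ltr01 _ _) (ltry _).
  - by apply: measurableC; exact: measurable_cball.
  - by move=> y; rewrite /cball /= => /negP; rewrite -ltNge.
apply: le_lt_trans (_ : (\int[mu]_(y in cball d x0 1) 1%:E < _)%E).
  apply: ge0_le_integral => //.
  - exact: measurable_cball.
  - by move=> y _; rewrite lee_fin powR_ge0.
  - exact: measurable_funTS.
  move=> y; rewrite /cball /= => y1; rewrite lee_fin.
  by apply: powR_le1 => //; [exact: ltW|exact: (polish_ge0 polish_d)].
rewrite integral_cst ?mul1e; last exact: measurable_cball.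
by rewrite -ge0_fin_numE // fin_num_measure //; exact: measurable_cball.
Qed.

(** On [[0, 1]] the integrand is at most 1; on the dyadic interval from [2 ^ i] its integral is of
    order [2 ^ (i * (p - s / 2))], which is summable. *)
Lemma I2pp_fin : 2 * p < s -> (I2pp d x0 mu p < +oo)%E.
Proof.
move=> ps.
pose z : R := 2 `^ (p - s / 2).
have z0 : 0 <= z by exact: powR_ge0.
have z1 : z < 1.
  have := @gt0_ltr_powR R (s / 2 - p) _ 1 2; rewrite powR1.
  have sp : 0 < s / 2 - p by lra.
  rewrite !nnegrE => /(_ sp ler01 (ler0n _ _) (ltr1n _ _)) h.
  by rewrite /z -opprB powRN invf_lt1 // powR_gt0.
pose A (j : nat) : set R := if j is i.+1 then `]2 ^+ i, 2 ^+ i.+1]%classic else `[0, 1]%classic.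
pose c (j : nat) : R := if j is i.+1 then
   Num.sqrt (wm * (2 ^+ i) `^ (- s)) * (2 ^+ i.+1) `^ (p - 1) else 1.
apply: le_lt_trans (_ : (1 + Num.sqrt wm * 2 `^ (p - 1) * (1 - z)^-1)%:E < _)%E; last exact: ltry.
apply: (@integral_le_series _ _ _ lebesgue_measure _ f A c) => //.
- by apply: measurable_I2pp_integrand.
- by move=> t _; exact: I2pp_integrand_ge0.
- by case=> [|i]; exact: measurable_itv.
- by case=> [|i] //=; rewrite mulr_ge0 // ?sqrtr_ge0 // powR_ge0.
- move=> t /=; rewrite in_itv /= andbT => t0.
  have [t1|t1] := lerP t 1.
    exists 0%N => /=; first by rewrite in_itv /= t0.
    rewrite lee_fin mulr_ile1 ?sqrtr_ge0 ?powR_ge0 //.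
      by rewrite -sqrtr1 ler_wsqrtr // tailH_le1.
    by apply: powR_le1; rewrite ?subr_ge0.
  have [j [j1 j2]] := dyadic_above t1; exists j.+1; first by rewrite /= in_itv /= j1.
  have jp : 0 < 2 ^+ j :> R by rewrite exprn_gt0.
  rewrite lee_fin; apply: ler_pM; rewrite ?sqrtr_ge0 ?powR_ge0 //.
    apply: ler_wsqrtr; apply: le_trans (tailH_anti (ltW j1)) _; exact: tailH_le_weak.
  by apply: ge0_ler_powR; rewrite ?nnegrE ?subr_ge0 // exprn_ge0.
move=> N; apply: le_trans (_ : (\sum_(j < N.+1) (c j)%:E * lebesgue_measure (A j) <= _)%E).
  rewrite [leRHS]big_ord_recr /=; apply: le_trans (leeDl _ _); last first.
    by rewrite mule_ge0 // lee_fin; case: (N) => [|i] //=; rewrite mulr_ge0 // ?sqrtr_ge0 // powR_ge0.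
  apply: lee_sum => j _; rewrite lee_wpmul2l //.
    by rewrite lee_fin; case: (nat_of_ord j) => [|i] //=; rewrite mulr_ge0 // ?sqrtr_ge0 // powR_ge0.
  have mA : measurable (A j) by case: (nat_of_ord j) => [|i]; exact: measurable_itv.
  by rewrite le_measure ?inE //; apply: measurableI.
rewrite big_ord_recl /= lebesgue_measure_itv /= lte_fin ltr01 oppr0 adde0 mule1 EFinD leeD2l //.
apply: le_trans (_ : (\sum_(j < N) (Num.sqrt wm * 2 `^ (p - 1) * z ^+ j)%:E <= _)%E); last first.
  have h := geometric_sum_le N z0 z1.
  by rewrite sumEFin lee_fin -mulr_sumr ler_wpM2l // mulr_ge0 // ?sqrtr_ge0 // powR_ge0.
apply: lee_sum => j _; rewrite add0n lebesgue_measure_itv /= lte_fin.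
have jp : 0 < 2 ^+ j :> R by rewrite exprn_gt0.
rewrite ltr_eXn2l ?ltr1n // ltnSn -EFinB -EFinM lee_fin.
rewrite sqrtrM ?weak_moment_ge0 // exprS powRM // ?(ltW jp) //.
have -> : Num.sqrt ((2 ^+ j) `^ (- s)) = (2 ^+ j) `^ (- s / 2).
  by rewrite -powR12_sqrt ?powR_ge0 // -powRrM.
have -> : 2 * 2 ^+ j - 2 ^+ j = 2 ^+ j :> R by ring.
rewrite /z -powR_exprn // le_eqVlt; apply/orP; left; apply/eqP.
have -> : p - s / 2 = (- s / 2) + p by ring.
rewrite (@powRD _ (2 ^+ j) (- s / 2) p); last by rewrite (gt_eqF jp) implybT.
rewrite -(mulr_powRB1 (ltW jp) p_gt0); ring.
Qed.

End Weak.

(** One piece of the integral, at [a = t / 2], already bounds [sqrt (H t) * t ^ p]. This supplies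
    part (2) with a weak moment of order above [p], which makes the error terms of the truncation
    vanish. *)
Lemma weak_moment_le_I2pp : (I2pp d x0 mu p < +oo)%E ->
  (weak_moment d x0 mu (2 * p) < +oo)%E.
Proof.
move=> If; have I0 : (0 <= I2pp d x0 mu p)%E by apply: integral_ge0 => t _; exact: I2pp_integrand_ge0.
have IE : I2pp d x0 mu p = (fine (I2pp d x0 mu p))%:E by rewrite fineK // ge0_fin_numE.
set I := fine _ in IE.
apply: le_lt_trans (ltry ((2 `^ p * I) ^+ 2)).
apply: ge_ereal_sup => _ [t /= t0 <-]; rewrite lee_fin.
have [->|tn0] := eqVneq t 0.
  by rewrite powR0 ?mul0r ?sqr_ge0 // gt_eqF // mulr_gt0.
have tp : 0 < t by rewrite lt_neqAle eq_sym tn0.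
have h : Num.sqrt (H t) * (t / 2) `^ p <= I.
  rewrite -lee_fin -IE.
  have := @I2pp_piece (t / 2) (divr_gt0 tp (ltr0n _ 2)).
  have -> : 2 * (t / 2) = t by rewrite mulrC divfK.
  move=> /le_trans; apply; rewrite /I2pp; apply: ge0_subset_integral => //.
  - exact: measurable_I2pp_integrand.
  - by move=> u _; exact: I2pp_integrand_ge0.
  move=> u /=; rewrite !in_itv /= => /andP[hu _]; rewrite andbT.
  by apply: ltW; apply: lt_trans hu; rewrite divr_gt0.
have -> : t `^ (2 * p) * H t = (t `^ p * Num.sqrt (H t)) ^+ 2.
  rewrite exprMn sqr_sqrtr ?tailH_ge0 //; congr (_ * _).
  by rewrite mulrC powRrM powR_mulrn ?powR_ge0.
rewrite lerXn2r ?nnegrE //.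
- by rewrite mulr_ge0 // ?sqrtr_ge0 // powR_ge0.
- by rewrite mulr_ge0 // ?powR_ge0 // fine_ge0.
have -> : t `^ p = 2 `^ p * (t / 2) `^ p.
  by rewrite -powRM ?divr_ge0 ?(ltW tp) // mulrC divfK.
by rewrite -mulrA ler_wpM2l ?powR_ge0 // mulrC.
Qed.

End Tail.

(** * Shells and nested cells *)

Section CountableLabels.
Context {R : realType} {dE : measure_display} {E : measurableType dE}.

Lemma measurable_find (A : Type) (s : seq A) (Q : A -> E -> bool) (k : nat) :
  (forall a, measurable [set y | Q a y]) ->
  measurable [set y | find (Q^~ y) s = k].
Proof.
move=> mQ; elim: s k => [|a s IH] k /=.
  have [->|k0] := eqVneq k 0%N.
    by rewrite (_ : [set _ | _] = setT) //; apply/seteqP; split.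
  rewrite (_ : [set _ | _] = set0) //; apply/seteqP; split => // y /= h.
  by move: k0; rewrite -h eqxx.
case: k => [|k].
  rewrite (_ : [set _ | _] = [set y | Q a y]) //.
  by apply/seteqP; split => y /=; case: (Q a y).
rewrite (_ : [set _ | _] = ~` [set y | Q a y] `&` [set y | find (Q^~ y) s = k]).
  by apply: measurableI => //; exact: measurableC.
apply/seteqP; split => y /=; case: (Q a y) => //=; last by move=> [_ ->].
  by move=> [].
by move=> [].
Qed.

Lemma measurable_comp_nat (T : eqType) (u : E -> nat) (g : nat -> E -> T) (t : T) :
  (forall k, measurable [set y | u y = k]) ->
  (forall k, measurable [set y | g k y = t]) ->
  measurable [set y | g (u y) y = t].
Proof.
move=> mu mg.
rewrite (_ : [set _ | _] = \bigcup_k ([set y | u y = k] `&` [set y | g k y = t])).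
  by apply: bigcupT_measurable => k; exact: measurableI.
by apply/seteqP; split => [y /= h|y [k _ [/= -> ]]] //; exists (u y).
Qed.

Lemma measurable_if_bool (T : eqType) (c : E -> bool) (g h : E -> T) (t : T) :
  measurable [set y | c y] -> measurable [set y | g y = t] -> measurable [set y | h y = t] ->
  measurable [set y | (if c y then g y else h y) = t].
Proof.
move=> mc mg mh; rewrite (_ : [set _ | _] =
  ([set y | c y] `&` [set y | g y = t]) `|` (~` [set y | c y] `&` [set y | h y = t])).
  apply: measurableU; apply: measurableI => //; exact: measurableC.
apply/seteqP; split => y /=.
  by case: ifPn => cy h1; [left|right; split => //; exact/negP].
by case: ifPn => cy [] [] // /negP.
Qed.

Lemma measurable_cst_eq (T : eqType) (t u : T) : measurable [set y : E | u = t].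
Proof.
have [->|ut] := eqVneq u t.
  by rewrite (_ : [set _ | _] = setT) //; apply/seteqP; split.
rewrite (_ : [set _ | _] = set0) //; apply/seteqP; split => // y /= e.
by move: ut; rewrite e eqxx.
Qed.

End CountableLabels.

Lemma sum_option (V : nmodType) (A : finType) (G : option A -> V) :
  \sum_F G F = G None + \sum_a G (Some a).
Proof.
rewrite (bigD1 None) //=; congr (_ + _).
rewrite (reindex_omap Some id) /=; last by case.
by apply: eq_bigl => a; rewrite eqxx.
Qed.

Lemma tuple_prob_or (R : realType) (T : finType) (b : T -> R) n (P Q : pred (seq T)) :
  (forall t, 0 <= b t) ->
  tuple_prob b n (fun s => P s || Q s) <= tuple_prob b n P + tuple_prob b n Q.
Proof.
move=> b0; rewrite /tuple_prob big_mkcond [X in _ <= X + _]big_mkcond.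
rewrite [X in _ <= _ + X]big_mkcond /= -big_split /=; apply: ler_sum => s _.
have h : 0 <= \prod_(t <- s) b t by apply: prodr_ge0.
by case: (P s); case: (Q s) => /=; rewrite ?addr0 ?add0r // lerDl.
Qed.

Lemma tuple_prob_le1 (R : realType) (T : finType) (b : T -> R) n (P : pred (seq T)) :
  (forall t, 0 <= b t) -> \sum_t b t = 1 -> tuple_prob b n P <= 1.
Proof.
move=> b0 b1; elim: n P => [|n IH] P; first by rewrite tuple_prob0; case: (P _).
rewrite tuple_probS -b1; apply: ler_sum => t _.
by rewrite ler_piMr.
Qed.

Lemma tuple_prob_has (R : realType) (T : finType) (b : T -> R) n (a : T) :
  (forall t, 0 <= b t) -> \sum_t b t = 1 ->
  tuple_prob b n (has (pred1 a)) <= n%:R * b a.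
Proof.
move=> b0 b1; elim: n => [|n IH]; first by rewrite tuple_prob0 mul0r.
rewrite tuple_probS (bigD1 a) //= -natr1 mulrDl mul1r addrC; apply: lerD; last first.
  by rewrite ler_piMr // tuple_prob_le1.
apply: le_trans (_ : \sum_(t | t != a) b t * (n%:R * b a) <= _).
  apply: ler_sum => t ta; rewrite ler_wpM2l //; apply: le_trans IH.
  rewrite le_eqVlt; apply/orP; left; apply/eqP; congr tuple_prob.
  by apply/funext => s; rewrite /= (negbTE ta).
rewrite -mulr_suml ler_piMl ?mulr_ge0 // -b1 [leRHS](bigD1 a) //= lerDr //.
Qed.

Section Labels.
Context {R : realType} {dE : measure_display} {E : measurableType dE} (d : E -> E -> R).
Hypothesis polish_d : polish d.
Variables (x0 : E) (S : set E) (rho : R) (K L N : nat) (ctr : nat -> nat -> seq E).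
Hypothesis mS : measurable S.
Hypothesis rho_gt0 : 0 < rho.

Definition rad (k : nat) : R := rho / 2 ^+ k.
(** Scaled so that [2 * rad k / mesh k l = 2 ^ l]: the covering hypothesis then bounds the number of
    centres by [beta * 2 ^ (l * alpha)] in every shell. *)
Definition mesh (k l : nat) : R := rad k * 2 / 2 ^+ l.

Hypothesis ctr_in : forall k l z, z \in ctr k l -> S z /\ d x0 z <= rad k.
Hypothesis ctr_cover : forall k l y, S y -> d x0 y <= rad k ->
  has (fun z => d z y <= mesh k l) (ctr k l).
Hypothesis ctr_size : forall k l, (k < K)%N -> (l <= L)%N -> (size (ctr k l) <= N)%N.

Definition inside (y : E) : bool := `[< S y >] && (d x0 y <= rho).
(** [find] returns [K] when no index qualifies, so the core ball of radius [rad K] becomes the last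
    shell. *)
Definition shell (y : E) : nat := find (fun k => rad k.+1 < d x0 y) (iota 0 K).
Definition leafidx (y : E) : nat :=
  if (shell y < K)%N then find (fun z => d z y <= mesh (shell y) L) (ctr (shell y) L)
  else 0%N.

Definition label : finType := option ('I_K.+1 * 'I_N.+1).

Definition lab (y : E) : label :=
  if inside y then Some (inord (shell y), inord (leafidx y)) else None.

(** Balls of different levels are not nested, so centres are linked instead: each one is attached to
    the first centre of the coarser level within one mesh, and a cell consists of the descendants of
    a centre. Level 0 is forced to index 0, one cell per shell. *)
Definition parent (k l j : nat) : nat :=
  if l == 0%N then 0%N
  else find (fun z => d z (nth x0 (ctr k l.+1) j) <= mesh k l) (ctr k l).

Definition coarsen (l : nat) (t : label) : label :=
  if t is Some (k, j) then Some (k, inord (if (k < K)%N then parent k l j else 0%N))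
  else None.

(** For [L = 0] no climb takes place, so the leaf index is erased by one explicit coarsening; level
    0 then has one cell per shell in all cases. *)
Fixpoint up (m : nat) (t : label) : label :=
  if m is m'.+1 then coarsen (L - m'.+1) (up m' t)
  else if L == 0%N then coarsen 0 t else t.

Definition cell (l : nat) (t : label) : label := up (L - l) t.

Lemma cellS l t : (l < L)%N -> cell l t = coarsen l (cell l.+1 t).
Proof.
move=> lL; rewrite /cell -(subnSK lL) /=; congr coarsen.
by rewrite subnSK // subKn // ltnW.
Qed.

Lemma rad_gt0 k : 0 < rad k.
Proof. by rewrite /rad divr_gt0 // exprn_gt0. Qed.

Lemma radS k : rad k = 2 * rad k.+1.
Proof. by rewrite /rad exprS; field; rewrite expf_neq0. Qed.

Lemma meshS k l : mesh k l = 2 * mesh k l.+1.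
Proof. by rewrite /mesh exprS; field; rewrite expf_neq0. Qed.

Lemma mesh_gt0 k l : 0 < mesh k l.
Proof. by rewrite /mesh divr_gt0 ?exprn_gt0 // mulr_gt0 // rad_gt0. Qed.

Lemma shell_le y : (shell y <= K)%N.
Proof. by rewrite /shell (leq_trans (find_size _ _)) // size_iota. Qed.

Lemma shell_gt y : (shell y < K)%N -> rad (shell y).+1 < d x0 y.
Proof.
move=> sK; have h : has (fun k => rad k.+1 < d x0 y) (iota 0 K).
  by rewrite has_find size_iota.
by have := nth_find 0%N h; rewrite -/(shell y) nth_iota.
Qed.

Lemma shell_rad y : inside y -> d x0 y <= rad (shell y).
Proof.
move=> /andP[_ yr]; case E0 : (shell y) => [|k]; first by rewrite /rad expr0 divr1.
have kK : (k < K)%N by have := shell_le y; rewrite E0.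
have : (k < shell y)%N by rewrite E0.
by move/(before_find 0%N) => /negbT; rewrite nth_iota // add0n -leNgt.
Qed.

Lemma leafidx_lt y : inside y -> (shell y < K)%N ->
  (leafidx y < size (ctr (shell y) L))%N /\
  d (nth x0 (ctr (shell y) L) (leafidx y)) y <= mesh (shell y) L.
Proof.
move=> yin sK; have /andP[/asboolP Sy _] := yin.
have h := ctr_cover L Sy (shell_rad yin).
rewrite /leafidx sK -has_find; split => //.
exact: (nth_find x0 h).
Qed.

Lemma parent_lt k l j : (0 < l)%N -> (j < size (ctr k l.+1))%N ->
  (parent k l j < size (ctr k l))%N /\
  d (nth x0 (ctr k l) (parent k l j)) (nth x0 (ctr k l.+1) j) <= mesh k l.
Proof.
move=> l0 js; have [Sz zr] := ctr_in (mem_nth x0 js).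
have h := ctr_cover l Sz zr.
by rewrite /parent eqn0Ngt l0 /= -has_find; split => //; exact: (nth_find x0 h).
Qed.

Lemma up_shell m (t : label) : omap fst (up m t) = omap fst t.
Proof.
elim: m => [|m IH] /=; first by case: eqP => // _; case: t => [[k j]|].
by rewrite -IH; case: (up m t) => [[k j]|].
Qed.

Lemma cell_shell l (t : label) : omap fst (cell l t) = omap fst t.
Proof. exact: up_shell. Qed.

Lemma cell_None l : cell l None = None.
Proof. by have := cell_shell l None; case: (cell l None). Qed.

Lemma cell_eq_None l (t : label) : (cell l t == None) = (t == None).
Proof. by have := cell_shell l t; case: (cell l t) => [[? ?]|]; case: t => [[? ?]|]. Qed.

Lemma cell0 k j : cell 0 (Some (k, j)) = Some (k, ord0).
Proof.
have inord0 : inord 0 = ord0 :> 'I_N.+1 by apply/val_inj; rewrite /= inordK.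
have c0 i : coarsen 0 (Some (k, i)) = Some (k, ord0).
  by rewrite /= /parent /=; case: ifP; rewrite inord0.
have [L0|L0] := posnP L.
  by rewrite /cell subn0 {1}L0 [LHS]/= L0 eqxx; exact: c0.
rewrite cellS //; have := cell_shell 1 (Some (k, j)).
by case: (cell 1 _) => [[k' i] [->]|//]; exact: c0.
Qed.

(** Climbing from the leaf adds one mesh per level, and [mesh l + ... + mesh L = 2 * mesh l - mesh
    L]. *)
Lemma cell_center l y : (0 < l)%N -> (l <= L)%N -> inside y -> (shell y < K)%N ->
  exists2 j : nat, cell l (lab y) = Some (inord (shell y), inord j) &
    (j < size (ctr (shell y) l))%N /\
    d (nth x0 (ctr (shell y) l) j) y <= 2 * mesh (shell y) l - mesh (shell y) L.
Proof.
move=> l0 lL yin sK; set k := shell y.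
suff main m : (m < L)%N -> exists2 j : nat,
    cell (L - m) (lab y) = Some (inord k, inord j) & (j < size (ctr k (L - m)))%N /\
    d (nth x0 (ctr k (L - m)) j) y <= 2 * mesh k (L - m) - mesh k L.
  have := main (L - l)%N; rewrite subKn //; apply.
  by rewrite ltn_subrL l0 (leq_trans l0).
elim: m => [|m IH] mL.
  rewrite subn0 /cell subnn /= eqn0Ngt mL /= /lab yin.
  have [h1 h2] := leafidx_lt yin sK.
  exists (leafidx y) => //; split => //; rewrite -/k; apply: le_trans h2 _.
  by rewrite -/k; lra.
have [j jE [js jd]] := IH (ltnW mL).
have l'0 : (0 < L - m.+1)%N by rewrite subn_gt0.
have l'S : (L - m = (L - m.+1).+1)%N by rewrite subnSK // ltnW.
have l'L : (L - m.+1 < L)%N by rewrite -l'S leq_subr.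
rewrite l'S in jE js jd.
have [p1 p2] := parent_lt l'0 js.
exists (parent k (L - m.+1) j).
  rewrite cellS // jE /= inordK ?ltnS ?shell_le // sK.
  congr (Some (_, inord _)); congr parent; rewrite inordK // ltnS.
  by apply: leq_trans (ltnW js) _; apply: ctr_size.
split => //.
have := polish_triangle polish_d (nth x0 (ctr k (L - m.+1)) (parent k (L - m.+1) j))
  (nth x0 (ctr k (L - m.+1).+1) j) y.
have := meshS k (L - m.+1); rewrite -/k in jd *; lra.
Qed.

Lemma cell_same_shell l x y : inside x -> inside y ->
  cell l (lab x) = cell l (lab y) -> shell x = shell y.
Proof.
move=> xin yin e; have := cell_shell l (lab x).
rewrite e cell_shell /lab xin yin /= => -[] /(congr1 val) /=.
by rewrite !inordK ?ltnS ?shell_le.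
Qed.

(** At positive levels both points lie within [2 * mesh] of a common centre and
    [4 * mesh = 8 * rad / 2 ^ l]; at level 0 the diameter of the ball suffices. *)
Lemma cell_diam l x y : (l <= L)%N -> inside x -> inside y ->
  (shell x < K)%N -> cell l (lab x) = cell l (lab y) ->
  d x y <= 8 * rad (shell x) / 2 ^+ l.
Proof.
move=> lL xin yin sx e; have sE := cell_same_shell xin yin e; have [l0|l0] := posnP l.
  rewrite l0 expr0 divr1; have := polish_triangle polish_d x x0 y.
  have := shell_rad xin; have := shell_rad yin; rewrite -sE (polish_sym polish_d x x0).
  have := rad_gt0 (shell x); lra.
have sy : (shell y < K)%N by rewrite -sE.
have [i ie [i_s id_]] := cell_center l0 lL xin sx.
have [j je [js jd]] := cell_center l0 lL yin sy.
move: e; rewrite ie je -sE => -[] /(congr1 val) /=.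
rewrite -sE in js jd.
have bd u : (u < size (ctr (shell x) l))%N -> (u < N.+1)%N.
  by move=> us; rewrite ltnS (leq_trans (ltnW us)) // ctr_size.
rewrite !inordK ?bd // => ij; rewrite ij in id_.
have := polish_triangle polish_d x (nth x0 (ctr (shell x) l) j) y.
rewrite (polish_sym polish_d x (nth _ _ _)).
have -> : 8 * rad (shell x) / 2 ^+ l = 4 * mesh (shell x) l.
  by rewrite /mesh; field; rewrite expf_neq0.
have := mesh_gt0 (shell x) L; lra.
Qed.

Lemma measurable_inside : measurable [set y | inside y].
Proof.
rewrite (_ : [set _ | _] = S `&` cball d x0 rho).
  by apply: measurableI => //; exact: (measurable_cball polish_d).
apply/seteqP; split => y /=; rewrite /inside.
  by move=> /andP[/asboolP].
by move=> [Sy yr]; apply/andP; split => //; exact/asboolP.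
Qed.

Lemma measurable_shell k : measurable [set y | shell y = k].
Proof.
apply: (measurable_find _ (Q := fun k y => rad k.+1 < d x0 y)) => j.
rewrite (_ : [set _ | _] = ~` cball d x0 (rad j.+1)).
  by apply: measurableC; exact: (measurable_cball polish_d).
by apply/seteqP; split => y; rewrite /cball /= ltNge => /negP.
Qed.

Lemma measurable_leafidx j : measurable [set y | leafidx y = j].
Proof.
apply: (measurable_comp_nat (g := fun k y => if (k < K)%N then
   find (fun z => d z y <= mesh k L) (ctr k L) else 0%N)); first exact: measurable_shell.
move=> k; case: (k < K)%N; last exact: measurable_cst_eq.
apply: (measurable_find _ (Q := fun z y => d z y <= mesh k L)) => z.
exact: (measurable_cball polish_d).
Qed.

Lemma measurable_lab t : measurable (lab @^-1` [set t]).
Proof.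
apply: (@measurable_if_bool _ _ label inside).
- exact: measurable_inside.
- apply: (@measurable_comp_nat _ _ label shell (fun k y => Some (inord k, inord (leafidx y)))).
    exact: measurable_shell.
  move=> k; apply: (@measurable_comp_nat _ _ label leafidx (fun j y => Some (inord k, inord j))).
    exact: measurable_leafidx.
  by move=> j; exact: measurable_cst_eq.
- exact: measurable_cst_eq.
Qed.

(** * Weights of the cells and the transport bound for a fixed sample *)

Section Deterministic.
Variables (mu : probability E R) (p : R).
Hypothesis p_ge1 : 1 <= p.
Hypothesis moment_fin : (pmoment d x0 mu p < +oo)%E.

Let p_gt0 : 0 < p. Proof. exact: lt_le_trans p_ge1. Qed.

Definition cmass (t : label) : R := fine (mu (lab @^-1` [set t])).

(** Mass left over in a cell of level [l'.+1] is moved inside its parent of level [l'], hence the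
    diameter bound of the parent. The core shell is never split and weighs nothing at positive
    levels. *)
Definition wt (l : nat) (F : label) : R :=
  if F is Some (k, _) then
    if l is l'.+1 then (if (k < K)%N then (8 * rad k / 2 ^+ l') `^ p else 0)
    else 2 `^ p * rad k `^ p
  else 0.

Definition wbot (F : label) : R :=
  if F is Some (k, _) then
    if (k < K)%N then (8 * rad k / 2 ^+ L) `^ p else (2 * rad K) `^ p
  else 0.

Definition outcost : R :=
  2 `^ p * fine (\int[mu]_(y in lab @^-1` [set None]) (d x0 y `^ p)%:E)%E.

Lemma cmassE t : mu (lab @^-1` [set t]) = (cmass t)%:E.
Proof. by rewrite fineK // fin_num_measure //; exact: measurable_lab. Qed.

Lemma cmass_ge0 t : 0 <= cmass t.
Proof. exact: fine_ge0. Qed.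

Lemma cmass_sum1 : \sum_t cmass t = 1.
Proof.
apply: EFin_inj; rewrite -sumEFin.
rewrite -(probability_setT mu).
apply: etrans (esym (measure_fintype_partition mu measurable_lab measurableT)).
by apply: eq_bigr => t _; rewrite setTI; exact/esym/cmassE.
Qed.

Lemma wt_ge0 l F : 0 <= wt l F.
Proof.
rewrite /wt; case: F => [[k j]|] //; case: l => [|l].
  by rewrite mulr_ge0 // powR_ge0.
by case: ifP => // _; exact: powR_ge0.
Qed.

Lemma wbot_ge0 F : 0 <= wbot F.
Proof. by rewrite /wbot; case: F => [[k j]|] //; case: ifP => // _; exact: powR_ge0. Qed.

Lemma le_powRl (a b : R) : 0 <= a -> a <= b -> a `^ p <= b `^ p.
Proof.
move=> a0 ab; apply: ge0_ler_powR => //; first exact: ltW.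
by rewrite nnegrE (le_trans a0).
Qed.

Lemma cost_le x y : d x y `^ p <= 2 `^ p * d x0 x `^ p + 2 `^ p * d x0 y `^ p.
Proof.
have g0 := polish_ge0 polish_d.
have h (a b : R) : 0 <= a -> 0 <= b -> (a + b) `^ p <= 2 `^ p * a `^ p + 2 `^ p * b `^ p.
  move=> a0 b0; wlog ab : a b a0 b0 / a <= b.
    by move=> hw; case: (leP a b) => [|/ltW] ab; [exact: hw|rewrite addrC [leRHS]addrC; exact: hw].
  apply: le_trans (_ : (2 * b) `^ p <= _); first by apply: le_powRl; lra.
  by rewrite powRM // lerDr mulr_ge0 // powR_ge0.
apply: le_trans (h _ _ (g0 x0 x) (g0 x0 y)).
apply: le_powRl => //; have := polish_triangle polish_d x x0 y.
by rewrite (polish_sym polish_d x x0).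
Qed.

Lemma integral_dist_fin x (C : set E) : measurable C ->
  (\int[mu]_(y in C) (d x y `^ p)%:E)%E \is a fin_num.
Proof.
move=> mC; rewrite ge0_fin_numE; last first.
  by apply: integral_ge0 => y _; rewrite lee_fin powR_ge0.
have mc z : measurable_fun setT (fun y => (d z y `^ p)%:E) by exact: measurable_cost1.
apply: le_lt_trans (_ : \int[mu]_y ((2 `^ p * d x0 x `^ p)%:E + (2 `^ p)%:E * (d x0 y `^ p)%:E) < _)%E.
  apply: (@le_trans _ _ (\int[mu]_y (d x y `^ p)%:E)%E).
    apply: ge0_subset_integral => //; by move=> y _; rewrite lee_fin powR_ge0.
  apply: ge0_le_integral => //.
  - by move=> y _; rewrite lee_fin powR_ge0.
  - by apply: emeasurable_funD => //; exact: measurable_funeM.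
  - by move=> y _; rewrite -EFinM -EFinD lee_fin; exact: cost_le.
rewrite ge0_integralD //; last 3 first.
- by move=> y _; rewrite lee_fin mulr_ge0 // powR_ge0.
- by move=> y _; rewrite -EFinM lee_fin mulr_ge0 // powR_ge0.
- exact: measurable_funeM.
rewrite integral_cst //= probability_setT mule1 ge0_integralZl_EFin ?powR_ge0 //; last first.
  by move=> y _; rewrite lee_fin powR_ge0.
apply: lte_add_pinfty; first exact: ltry.
by apply: lte_mul_pinfty => //; rewrite lee_fin powR_ge0.
Qed.

Lemma avg_dist_le x t (w : R) : 0 <= w ->
  (forall y, lab y = t -> d x y `^ p <= w) ->
  fine (\int[mu]_(y in lab @^-1` [set t]) (d x y `^ p)%:E)%E / cmass t <= w.
Proof.
move=> w0 h; have [->|b0] := eqVneq (cmass t) 0; first by rewrite invr0 mulr0.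
have mC := measurable_lab t.
have bp : 0 < cmass t by rewrite lt_neqAle eq_sym b0 cmass_ge0.
rewrite ler_pdivrMr // -lee_fin fineK; last exact: integral_dist_fin.
rewrite EFinM -cmassE -integral_cst //.
apply: ge0_le_integral => //.
- by move=> y _; rewrite lee_fin powR_ge0.
- by apply: measurable_funTS; exact: measurable_cost1.
Qed.

Lemma lab_inner y : inside y -> shell y = K -> lab y = Some (inord K, inord 0).
Proof. by move=> yin yK; rewrite /lab yin /leafidx yK ltnn. Qed.

Lemma labNone y : (lab y == None) = ~~ inside y.
Proof. by rewrite /lab; case: (inside y). Qed.

(** The tree transport runs between sample indices and labels: [c i t] is the mean cost from [xs i]
    to a [mu]-random point of cell [t], so pointwise bounds on a cell pass to it. *)
Lemma transport_bound n (xs : 'I_n -> E) : (0 < n)%N -> (forall i, inside (xs i)) ->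
  (Wpp d p (empirical xs) mu <= (\sum_t cmass t * wbot t +
    \sum_(0 <= l < L.+1) \sum_F wt l F *
      `|fiber_sum (fun i => cell l (lab (xs i))) (fun=> n%:R^-1) F
        - fiber_sum (cell l) cmass F| + outcost)%:E)%E.
Proof.
move=> n0 xin.
pose Int i t := (\int[mu]_(y in lab @^-1` [set t]) (d (xs i) y `^ p)%:E)%E.
have Intf i t : Int i t \is a fin_num by apply: integral_dist_fin; exact: measurable_lab.
pose c i t := fine (Int i t) / cmass t.
(* No sample point has label [None], so the discrepancy of that cell is [cmass None]; with weight
   [A] at level 0 it contributes the integral [outcost], although the cell is unbounded. *)
pose A := outcost / cmass None.
pose W l F := if (l == 0%N) && (F == None) then A else wt l F.
have out0 : 0 <= outcost.
  rewrite mulr_ge0 ?powR_ge0 // fine_ge0 // integral_ge0 // => y _.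
  by rewrite lee_fin powR_ge0.
have A0 : 0 <= A by rewrite divr_ge0 // cmass_ge0.
have W0 l F : 0 <= W l F by rewrite /W; case: ifP => // _; exact: wt_ge0.
have labS i : lab (xs i) = Some (inord (shell (xs i)), inord (leafidx (xs i))).
  by rewrite /lab xin.
have inK y : (inord (shell y) : 'I_K.+1) = shell y :> nat by rewrite inordK // ltnS shell_le.
have cin l i y : cell l (lab (xs i)) = cell l (lab y) -> inside y.
  move=> e; apply: contraT; rewrite -labNone => /eqP yN.
  by move: e => /eqP; rewrite yN cell_None cell_eq_None labS.
have dd i y : inside y -> shell (xs i) = shell y -> d (xs i) y <= 2 * rad (shell y).
  move=> yin e; have := polish_triangle polish_d (xs i) x0 y.
  have := shell_rad yin; have := shell_rad (xin i); rewrite e (polish_sym polish_d (xs i) x0).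
  lra.
have ninv : 0 <= n%:R^-1 :> R by rewrite invr_ge0.
have suma : \sum_(i < n) n%:R^-1 = \sum_t cmass t :> R.
  by rewrite cmass_sum1 sumr_const card_ord -[_^-1 *+ n]mulr_natl divff // pnatr_eq0 -lt0n.
have cb i t : cell L (lab (xs i)) = cell L t -> c i t <= wbot t.
  move=> e; apply: avg_dist_le; first exact: wbot_ge0.
  move=> y yt; rewrite -yt in e *; have yin := cin _ _ _ e.
  have sE := cell_same_shell (xin i) yin e.
  rewrite /wbot /lab yin inK; case: ifPn => sK.
    apply: le_powRl; first exact: (polish_ge0 polish_d).
    by rewrite -sE; apply: cell_diam => //; rewrite sE.
  apply: le_powRl; first exact: (polish_ge0 polish_d).
  have -> : K = shell y by apply/eqP; rewrite eqn_leq shell_le leqNgt sK.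
  exact: dd.
have cl l i t : (l < L)%N -> cell l (lab (xs i)) = cell l t ->
    cell l.+1 (lab (xs i)) != cell l.+1 t -> c i t <= W l.+1 (cell l.+1 (lab (xs i))).
  move=> lL e ne; apply: avg_dist_le; first exact: W0.
  move=> y yt; rewrite -yt in e ne *; have yin := cin _ _ _ e.
  have sE := cell_same_shell (xin i) yin e.
  rewrite /W /=; have := cell_shell l.+1 (lab (xs i)); rewrite {2}labS.
  case: (cell l.+1 _) => [[k j]|] //= [->]; rewrite inK.
  case: ifPn => sK.
    apply: le_powRl; first exact: (polish_ge0 polish_d).
    by apply: cell_diam => //; exact: ltnW.
  have sK' : shell y = K by apply/eqP; rewrite eqn_leq shell_le leqNgt -sE sK.
  by move: ne; rewrite (lab_inner yin sK') (lab_inner (xin i)) ?eqxx // sE.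
have cr i t : cell 0 (lab (xs i)) != cell 0 t ->
    c i t <= W 0%N (cell 0 (lab (xs i))) + W 0%N (cell 0 t).
  move=> ne; case: t ne => [[k j]|] ne.
    apply: avg_dist_le; first by rewrite addr_ge0.
    move=> y yt; have yin : inside y by apply: contraT; rewrite -labNone yt.
    apply: le_trans (cost_le _ _) _.
    have -> : W 0%N (cell 0 (lab (xs i))) = 2 `^ p * rad (shell (xs i)) `^ p.
      by rewrite labS cell0 /W /= inK.
    have -> : W 0%N (cell 0 (Some (k, j))) = 2 `^ p * rad (shell y) `^ p.
      by move: yt; rewrite /lab yin => -[<- _]; rewrite cell0 /W /= inK.
    apply: lerD; apply: ler_wpM2l; rewrite ?powR_ge0 //; apply: le_powRl;
      by [exact: (polish_ge0 polish_d)|exact: shell_rad].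
  rewrite /W cell_None /= /c /A.
  have [->|b0] := eqVneq (cmass None) 0.
    by rewrite !invr0 !mulr0 addr0 cell_eq_None labS /=; exact: wt_ge0.
  have bp : 0 < cmass None by rewrite lt_neqAle eq_sym b0 cmass_ge0.
  rewrite cell_eq_None labS /= -[X in _ <= X + _](mulfK b0) -mulrDl ler_pM2r ?invr_gt0 //.
  have outE : outcost%:E = ((2 `^ p)%:E *
      \int[mu]_(y in lab @^-1` [set None]) (d x0 y `^ p)%:E)%E.
    by rewrite EFinM fineK //; apply: integral_dist_fin; exact: measurable_lab.
  rewrite cell0 /= inK -lee_fin fineK // EFinD outE [X in (_ <= X + _)%E]EFinM -cmassE.
  have mC := measurable_lab None.
  have mc z : measurable_fun (lab @^-1` [set None]) (fun y => (d z y `^ p)%:E).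
    by apply: measurable_funTS; exact: measurable_cost1.
  rewrite -integral_cst // -ge0_integralZl_EFin ?powR_ge0 //; last first.
    by move=> y _; rewrite lee_fin powR_ge0.
  rewrite -ge0_integralD //; last 3 first.
  - by move=> y _; rewrite lee_fin mulr_ge0 // powR_ge0.
  - by move=> y _; rewrite -EFinM lee_fin mulr_ge0 // powR_ge0.
  - exact: measurable_funeM.
  apply: ge0_le_integral => //.
  - by move=> y _; rewrite lee_fin powR_ge0.
  - by apply: emeasurable_funD => //; exact: measurable_funeM.
  move=> y _; rewrite -EFinM -EFinD lee_fin; apply: le_trans (cost_le _ _) _.
  rewrite lerD2r; apply: ler_wpM2l; rewrite ?powR_ge0 //; apply: le_powRl.
    exact: (polish_ge0 polish_d).
  exact: shell_rad.
have [q [q0 qrow qcol qcost]] := @tree_transport R 'I_n label label L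
  (fun l i => cell l (lab (xs i))) cell coarsen W wbot c (fun=> n%:R^-1) cmass
  (fun=> ninv) cmass_ge0 suma
  (fun l i lL => cellS _ lL) (fun l t lL => cellS _ lL) W0 wbot_ge0
  cb cl cr.
apply: le_trans (Wpp_le_cells polish_d p xs measurable_lab n0 q0 qrow qcol) _.
rewrite (eq_bigr (fun i => (\sum_t q i t * c i t)%:E)); last first.
  move=> i _; rewrite -sumEFin; apply: eq_bigr => t _.
  by rewrite -/(Int i t) -(fineK (Intf i t)) -EFinM /c -/(cmass t); congr (_%:E); ring.
rewrite sumEFin lee_fin; apply: le_trans qcost _.
pose D l F := `|fiber_sum (fun i : 'I_n => cell l (lab (xs i))) (fun=> n%:R^-1) F
  - fiber_sum (cell l) cmass F|.
have h0 : \sum_F W 0%N F * D 0%N F <= \sum_F wt 0 F * D 0%N F + outcost.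
  rewrite (bigD1 None) //= addrC; apply: lerD.
    rewrite [leRHS](bigD1 None) //= mul0r add0r; apply: ler_sum => F FN.
    by rewrite /W /= (negbTE FN).
  rewrite /W /= /D {1}/fiber_sum big1 => [|i]; last by rewrite cell_eq_None labS.
  rewrite sub0r normrN /fiber_sum (big_pred1 None) => [|t]; last first.
    by rewrite /= cell_eq_None.
  rewrite ger0_norm ?cmass_ge0 // /A; have [->|b0] := eqVneq (cmass None) 0.
    by rewrite mulr0.
  by rewrite divfK.
have h1 : \sum_(1 <= l < L.+1) \sum_F W l F * D l F =
    \sum_(1 <= l < L.+1) \sum_F wt l F * D l F by apply: eq_big_nat => -[|l].
rewrite !(@big_ltn _ _ _ 0 L.+1) //.
by move: h0 h1; rewrite /D; lra.
Qed.

(** * The walk of centred cell counts *)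

Definition node : finType := ('I_L.+1 * label)%type.
Definition nweight (F : node) : R := wt F.1 F.2.
Definition nmass (F : node) : R := fiber_sum (cell F.1) cmass F.2.
Definition nstep (t : label) (F : node) : R := (cell F.1 t == F.2)%:R - nmass F.
Definition kappa : R := \sum_F nweight F * Num.sqrt (nmass F).

Lemma sum_node (G : node -> R) : \sum_F G F = \sum_(l < L.+1) \sum_(F : label) G (l, F).
Proof. by rewrite pair_bigA; apply: eq_bigr => -[]. Qed.

Lemma sum_label (G : label -> R) : \sum_F G F = G None + \sum_k \sum_j G (Some (k, j)).
Proof. by rewrite sum_option pair_bigA; congr (_ + _); apply: eq_bigr => -[]. Qed.

Lemma nweight_ge0 F : 0 <= nweight F. Proof. exact: wt_ge0. Qed.

Lemma nmass_ge0 F : 0 <= nmass F.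
Proof. by apply: fiber_sum_ge0; exact: cmass_ge0. Qed.

Lemma nmassE F : nmass F = \sum_t cmass t * (cell F.1 t == F.2)%:R.
Proof.
rewrite /nmass /fiber_sum big_mkcond /=; apply: eq_bigr => t _.
by case: eqP => _; rewrite ?mulr1 ?mulr0.
Qed.

Lemma nmass_le1 F : nmass F <= 1.
Proof.
rewrite nmassE -[leRHS]cmass_sum1; apply: ler_sum => t _.
by rewrite ler_piMr ?cmass_ge0 // lern1 leq_b1.
Qed.

Lemma nstep_mean0 F : \sum_t cmass t * nstep t F = 0.
Proof.
rewrite /nstep; under eq_bigr do rewrite mulrBr.
by rewrite sumrB -nmassE -mulr_suml cmass_sum1 mul1r subrr.
Qed.

Lemma nstep_var F : \sum_t cmass t * nstep t F ^+ 2 <= nmass F.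
Proof.
have -> : \sum_t cmass t * nstep t F ^+ 2 =
   \sum_t (cmass t * (cell F.1 t == F.2)%:R * (1 - 2 * nmass F) + cmass t * nmass F ^+ 2).
  apply: eq_bigr => t _; rewrite /nstep.
  by case: eqP => _; rewrite /=; ring.
rewrite big_split /= -!mulr_suml -nmassE cmass_sum1 mul1r.
have := nmass_ge0 F; nra.
Qed.

Lemma walk_norm n (xs : 'I_n -> E) : (0 < n)%N ->
  wnorm nweight (foldl (wstep nstep) (fun=> 0) [seq lab (xs i) | i <- enum 'I_n]) =
  n%:R * \sum_(0 <= l < L.+1) \sum_F wt l F *
      `|fiber_sum (fun i => cell l (lab (xs i))) (fun=> n%:R^-1) F
        - fiber_sum (cell l) cmass F|.
Proof.
move=> n0; have nn0 : n%:R != 0 :> R by rewrite pnatr_eq0 -lt0n.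
rewrite /wnorm big_mkord mulr_sumr.
rewrite sum_node.
apply: eq_bigr => l _; rewrite mulr_sumr; apply: eq_bigr => F _.
rewrite /nweight /= mulrCA; congr (_ * _).
rewrite foldl_wstep add0r big_map big_enum /= -[X in X * _]ger0_norm // -normrM.
congr (`|_|); rewrite /nstep sumrB sumr_const card_ord -[_ *+ n]mulr_natl mulrBr.
congr (_ - _); rewrite /fiber_sum mulr_sumr [LHS]big_mkcond [RHS]big_mkcond /=.
by apply: eq_bigr => i _; rewrite ?inE divff //; case: eqP.
Qed.

Lemma deviation_reduction {dO : measure_display} {O : measurableType dO}
    (P : probability O R) (n : nat) (X : 'I_n -> O -> E) (x y : R) :
  iid P mu X -> (0 < n)%N ->
  \sum_t cmass t * wbot t + outcost + y <= x ->
  (P [set w | x%:E < Wpp d p (empirical (fun i => X i w)) mu] <=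
   (n%:R * cmass None + endprob cmass nweight nstep n (n%:R * y) (fun=> 0))%:E)%E.
Proof.
move=> iidX n0 xy; have [mX _ _] := iidX.
pose Q (s : seq label) := has (pred1 None) s ||
  (n%:R * y < wnorm nweight (foldl (wstep nstep) (fun=> 0) s)).
have [mQ PQ] := iid_labels Q iidX measurable_lab.
apply: le_trans (_ : (P [set w | Q [seq lab (X i w) | i <- enum 'I_n]] <= _)%E).
  apply: le_measure; rewrite ?inE //.
    exact: (measurable_Wpp_gt polish_d _ p_gt0).
  move=> w /= xW; rewrite /Q.
  have [hin|/hasPn hn] := boolP (has _ _) => //=.
  have xin i : inside (X i w).
    apply: contraT; rewrite -labNone => iN.
    have : lab (X i w) \in [seq lab (X i w) | i <- enum 'I_n].
      by apply: map_f; rewrite mem_enum.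
    by move/hn; rewrite /= iN.
  rewrite walk_norm // ltr_pM2l ?ltr0n //.
  have := lt_le_trans xW (transport_bound n0 xin); rewrite lte_fin.
  lra.
rewrite PQ lee_fin; apply: le_trans (tuple_prob_or _ _ _ cmass_ge0) _; apply: lerD.
  by apply: tuple_prob_has; [exact: cmass_ge0|exact: cmass_sum1].
by rewrite endprob_tuple.
Qed.

Lemma sum_cmass (Q : pred label) : \sum_(t | Q t) cmass t = fine (mu [set y | Q (lab y)]).
Proof.
have mQ : measurable [set y | Q (lab y)].
  rewrite (_ : [set y | _] = \bigcup_(t in [set` [seq t <- enum label | Q t]]) (lab @^-1` [set t])).
    apply: fin_bigcup_measurable => // t _; exact: measurable_lab.
  apply/seteqP; split => y /=.
    by move=> Qy; exists (lab y) => //=; rewrite mem_filter mem_enum andbT.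
  by move=> [t /=]; rewrite mem_filter => /andP[Qt _] ->.
rewrite (measure_fintype_partition mu measurable_lab mQ).
apply: EFin_inj; rewrite fineK; last first.
  apply/sum_fin_numP => t _ _; rewrite fin_num_measure //.
  by apply: measurableI => //; exact: measurable_lab.
rewrite -sumEFin big_mkcond /=; apply: eq_bigr => t _; case: ifPn => Qt.
  rewrite -cmassE; congr (mu _); apply/seteqP; split => [y /= yt|y []//].
  by split => //=; rewrite yt.
rewrite (_ : _ `&` _ = set0) ?measure0 //; apply/seteqP; split => // y [/= Qy yt].
by move: Qt; rewrite -yt Qy.
Qed.

Lemma measurable_labpred (Q : pred label) : measurable [set y | Q (lab y)].
Proof.
rewrite (_ : [set y | _] = \bigcup_(t in [set` [seq t <- enum label | Q t]]) (lab @^-1` [set t])).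
  apply: fin_bigcup_measurable => // t _; exact: measurable_lab.
apply/seteqP; split => y /=.
  by move=> Qy; exists (lab y) => //=; rewrite mem_filter mem_enum andbT.
by move=> [t /=]; rewrite mem_filter => /andP[Qt _] ->.
Qed.

Lemma lab_Some y k j : lab y = Some (k, j) -> inside y /\ shell y = k :> nat.
Proof.
rewrite /lab; case: ifP => // yin [<- _]; split => //.
by rewrite inordK // ltnS shell_le.
Qed.

Definition smass (k : 'I_K.+1) : R := nmass (ord0, Some (k, ord0)).

Lemma smass_le (k : 'I_K.+1) : (k < K)%N -> smass k <= tailH d x0 mu (rad k.+1).
Proof.
move=> kK; rewrite /smass /nmass /fiber_sum /= sum_cmass; apply: le_tailH => //.
  exact: (measurable_labpred (fun t => cell 0 t == Some (k, ord0))).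
move=> y /=; case yE : (lab y) => [[k' j]|]; last by rewrite cell_None.
rewrite cell0 => /eqP[kk]; have [yin sy] := lab_Some yE.
by rewrite -kk -sy; apply: shell_gt; rewrite sy kk.
Qed.

Lemma wbot_sum_le : \sum_t cmass t * wbot t <= (8 * rho / 2 ^+ L) `^ p + (2 * rad K) `^ p.
Proof.
set r := (X in _ <= X).
apply: le_trans (_ : \sum_t cmass t * r <= _); last by rewrite -mulr_suml cmass_sum1 mul1r.
apply: ler_sum => t _; rewrite /r ler_wpM2l ?cmass_ge0 // /wbot; case: t => [[k j]|]; last by rewrite addr_ge0 ?powR_ge0.
case: ifP => kK; last by rewrite lerDr powR_ge0.
apply: le_trans (_ : (8 * rho / 2 ^+ L) `^ p <= _); last by rewrite lerDl powR_ge0.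
have rk : rad k <= rho.
  by rewrite /rad ler_pdivrMr ?exprn_gt0 // ler_peMr ?(ltW rho_gt0) // exprn_ege1 // ler1n.
apply: le_powRl; first by rewrite divr_ge0 ?exprn_ge0 // mulr_ge0 // ltW // rad_gt0.
by rewrite ler_wpM2r ?invr_ge0 ?exprn_ge0 // ler_wpM2l.
Qed.

(** A point of shell [k < K] is farther than [rad k / 2] from [x0], so the diameter bound
    [8 * rad k] is at most 16 times its distance: whole shells used as leaves cost a multiple of the
    moment. *)
Lemma wbot_sum_le_moment : L = 0%N ->
  \sum_t cmass t * wbot t <= 16 `^ p * fine (pmoment d x0 mu p) + (2 * rad K) `^ p.
Proof.
move=> L0.
pose mt t : \bar R := (\int[mu]_(y in lab @^-1` [set t]) (d x0 y `^ p)%:E)%E.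
have mtf t : mt t \is a fin_num by apply: integral_dist_fin; exact: measurable_lab.
have mc : measurable_fun setT (fun y => (d x0 y `^ p)%:E) by exact: measurable_cost1.
have -> : fine (pmoment d x0 mu p) = \sum_t fine (mt t).
  apply: EFin_inj; rewrite fineK; last by apply: integral_dist_fin.
  rewrite -sumEFin /pmoment; under [RHS]eq_bigr do rewrite fineK //.
  have ET : [set` enum label] = [set: label].
    by apply/seteqP; split => t //= _; rewrite mem_enum.
  transitivity (\sum_(t <- enum label) mt t)%E; last by rewrite big_enum.
  rewrite /mt -ge0_integral_bigsetU ?enum_uniq //; last 4 first.
  - by move=> t; exact: measurable_lab.
  - by apply/trivIsetP => t u _ _ tu; apply/seteqP; split => // y [/= -> e]; move: tu; rewrite e eqxx.
  - exact: measurable_funTS.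
  - by move=> y _; rewrite lee_fin powR_ge0.
  congr (integral mu _ _); rewrite -bigcup_seq ET.
  by apply/seteqP; split => // y _; exists (lab y).
have -> : (2 * rad K) `^ p = \sum_t cmass t * (2 * rad K) `^ p.
  by rewrite -mulr_suml cmass_sum1 mul1r.
rewrite mulr_sumr -big_split /=.
apply: ler_sum => t _; rewrite /wbot; case: t => [[k j]|]; last first.
  rewrite mulr0 addr_ge0 // mulr_ge0 ?powR_ge0 ?cmass_ge0 // fine_ge0 // integral_ge0 // => y _.
  by rewrite lee_fin powR_ge0.
have mt0 t : 0 <= fine (mt t).
  by rewrite fine_ge0 // integral_ge0 // => y _; rewrite lee_fin powR_ge0.
case: ifP => kK; last by rewrite lerDr mulr_ge0 // powR_ge0.
rewrite -[leLHS]addr0; apply: lerD; last by rewrite mulr_ge0 ?powR_ge0 ?cmass_ge0.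
rewrite L0 expr0 divr1 -lee_fin EFinM -cmassE EFinM fineK //.
rewrite muleC -integral_cst; last exact: measurable_lab.
rewrite -ge0_integralZl_EFin ?powR_ge0 //; last 3 first.
- exact: measurable_lab.
- by move=> y _; rewrite lee_fin powR_ge0.
- exact: measurable_funTS.
apply: ge0_le_integral => //.
- exact: measurable_lab.
- by move=> y _; rewrite lee_fin powR_ge0.
- by apply: measurable_funeM; exact: measurable_funTS.
move=> y /= yE; have [yin sy] := lab_Some yE.
rewrite -EFinM lee_fin -powRM ?(polish_ge0 polish_d) //; apply: le_powRl.
  by rewrite mulr_ge0 // ltW // rad_gt0.
have h : rad (shell y).+1 < d x0 y by apply: shell_gt; rewrite sy.
by rewrite -sy radS; lra.
Qed.

Lemma cmass_None_le : mu S = 1%E -> cmass None <= tailH d x0 mu rho.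
Proof.
move=> S1.
have mO : measurable (~` cball d x0 rho) by apply: measurableC; exact: measurable_cball.
have SC0 : mu (~` S) = 0%E by rewrite probability_setC // S1 subee.
rewrite -lee_fin -cmassE -tailHE //.
apply: le_trans (_ : (mu (~` S `|` ~` cball d x0 rho) <= _)%E).
  apply: le_measure; rewrite ?inE.
  - exact: measurable_lab.
  - by apply: measurableU => //; exact: measurableC.
  move=> y /= /eqP; rewrite labNone /inside negb_and => /orP[/asboolPn|]; first by left.
  by right; rewrite /cball /=; exact/negP.
have mSC : measurable (~` S) by exact: measurableC.
apply: le_trans (measureU2 mu mSC mO) _.
by rewrite [X in (X + _)%E](_ : _ = 0%E) ?add0e //; exact: SC0.
Qed.

Lemma outcost_le s : p < s -> (weak_moment d x0 mu s < +oo)%E -> mu S = 1%E ->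
  outcost <= 2 `^ p * (2 `^ p / (1 - 2 `^ (p - s)) *
     fine (weak_moment d x0 mu s) * rho `^ (p - s)).
Proof.
move=> ps wf S1; rewrite ler_wpM2l ?powR_ge0 //.
have mC := measurable_lab None.
have mSC : measurable (~` S) by exact: measurableC.
have SC0 : mu (~` S) = 0%E by rewrite probability_setC // S1 subee.
rewrite -lee_fin fineK; last exact: integral_dist_fin.
rewrite (ge0_negligible_integral mSC mC _ _ SC0) //; last 2 first.
- by apply: measurable_funTS; exact: measurable_cost1.
- by move=> y _; rewrite lee_fin powR_ge0.
apply: integral_tail_le => //; first exact: measurableD.
move=> y [/= /eqP]; rewrite labNone /inside negb_and => /orP[/asboolPn nS /(_ nS)//|].
by rewrite -ltNge.
Qed.

Lemma sum_shell_indicator l (k : 'I_K.+1) t :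
  \sum_j (cell l t == Some (k, j))%:R <= (cell 0 t == Some (k, ord0))%:R :> R.
Proof.
case: t => [[k' j']|]; last by rewrite cell_None big1 // cell_None.
have := cell_shell l (Some (k', j')).
case: (cell l _) => [[k2 j2]|] //= [->]; rewrite cell0.
have [->|nk] := eqVneq k' k.
  rewrite eqxx (bigD1 j2) //= eqxx big1 ?addr0 // => j jj.
  by case: eqP => // -[e]; move: jj; rewrite e eqxx.
rewrite big1 ?ler0n // => j _; case: eqP => // -[e].
by move: nk; rewrite e eqxx.
Qed.

Lemma sum_shell_nmass (l : 'I_L.+1) (k : 'I_K.+1) :
  \sum_j nmass (l, Some (k, j)) <= smass k.
Proof.
rewrite /smass nmassE; under eq_bigr do rewrite nmassE.
rewrite exchange_big /=; apply: ler_sum => t _; rewrite -mulr_sumr.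
by rewrite ler_wpM2l ?cmass_ge0 // sum_shell_indicator.
Qed.

Lemma nmass_out (l : 'I_L.+1) (k : 'I_K.+1) (j : 'I_N.+1) : (0 < l)%N -> (k < K)%N ->
  (size (ctr k l) <= j)%N -> nmass (l, Some (k, j)) = 0.
Proof.
move=> l0 kK sj; rewrite /nmass /fiber_sum sum_cmass /=.
rewrite (_ : [set y | _] = set0) ?measure0 //; apply/seteqP; split => // y /= /eqP e.
have := cell_shell l (lab y); rewrite e; case yE : (lab y) => [[k' j']|] //= [kk].
have [yin sy] := lab_Some yE; rewrite -kk in sy.
have lL : (l <= L)%N by rewrite -ltnS.
have sK : (shell y < K)%N by rewrite sy.
have [i ie [i_s _]] := cell_center l0 lL yin sK.
move: e; rewrite ie => -[_ ij]; move: sj; rewrite -ij inordK; last first.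
  by rewrite ltnS; apply: leq_trans (ltnW i_s) _; exact: ctr_size.
by rewrite -sy leqNgt i_s.
Qed.

(** Cauchy-Schwarz over at most [size (ctr k l)] nonempty cells whose masses add up to at most that
    of the shell; [w] switches off the indices that name no centre. *)
Lemma sum_sqrt_nmass (l : 'I_L.+1) (k : 'I_K.+1) : (0 < l)%N -> (k < K)%N ->
  \sum_j Num.sqrt (nmass (l, Some (k, j))) <=
  Num.sqrt (size (ctr k l))%:R * Num.sqrt (smass k).
Proof.
move=> l0 kK; set m := size _.
have mN : (m <= N.+1)%N by apply: leqW; apply: ctr_size => //; rewrite -ltnS.
pose w (j : 'I_N.+1) : R := (j < m)%N%:R.
have w0 j : 0 <= w j by rewrite ler0n.
have one0 (j : 'I_N.+1) : 0 < 1 :> R by [].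
pose u (j : 'I_N.+1) := Num.sqrt (nmass (l, Some (k, j))).
pose A := \sum_j w j * `|u j|; pose B := \sum_j w j * 1; pose C := \sum_j w j * (u j ^+ 2 / 1).
have h : A ^+ 2 <= B * C by exact: (sqr_weighted_cauchy w0 u one0).
have -> : \sum_j Num.sqrt (nmass (l, Some (k, j))) = A.
  apply: eq_bigr => j _; rewrite /w /u ger0_norm ?sqrtr_ge0 //.
  by case: ltnP => jm; rewrite ?mul1r // nmass_out // sqrtr0 mulr0.
have Bm : B = m%:R.
  transitivity (\sum_(j < m) (1 : R)); last by rewrite sumr_const card_ord.
  rewrite (big_ord_widen N.+1 (fun=> 1) mN) [RHS]big_mkcond /=.
  by apply: eq_bigr => j _; rewrite /w mulr1; case: ltnP.
have Cs : C <= smass k.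
  apply: le_trans (sum_shell_nmass l k); apply: ler_sum => j _.
  rewrite /w /u invr1 mulr1 sqr_sqrtr ?nmass_ge0 //.
  by case: ltnP => _; rewrite ?mul1r ?mul0r ?nmass_ge0.
have A0 : 0 <= A by apply: sumr_ge0 => j _; rewrite mulr_ge0.
rewrite -sqrtrM ?ler0n // -(ger0_norm A0) -sqrtr_sqr ler_wsqrtr //.
by apply: le_trans h _; rewrite Bm ler_wpM2l.
Qed.

Section Kappa.
Variables (alpha B : R).
Hypotheses (alpha_lt : alpha < 2 * p) (B_ge0 : 0 <= B).
Hypothesis ctr_size_le : forall k l, (k < K)%N -> (l <= L)%N ->
  (size (ctr k l))%:R <= B * (2 ^+ l) `^ alpha.

Let z : R := 2 `^ (alpha / 2 - p).

Definition kappa_cst : R := 2 `^ p + (if L == 0%N then 0 else 16 `^ p * Num.sqrt B / (1 - z)).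

Lemma chain_ratio_lt1 : z < 1.
Proof.
have := @gt0_ltr_powR R (p - alpha / 2) _ 1 2; rewrite powR1.
have sp : 0 < p - alpha / 2 by rewrite subr_gt0 ltr_pdivrMr // mulrC.
rewrite !nnegrE => /(_ sp ler01 (ler0n _ _) (ltr1n _ _)) h.
by rewrite /z -opprB powRN invf_lt1 // powR_gt0.
Qed.

(** At level [l.+1] the weight [(8 * rad k / 2 ^ l) ^ p] meets the square root of the number of
    cells, of order [2 ^ (alpha * (l + 1) / 2)]. The product decays like [z ^ l], and
    [alpha < 2 * p] says [z < 1]. Realigning [l] with [l + 1] turns 8 into 16. The core is charged
    at level 0 only, with mass at most 1. *)
Lemma kappa_le : kappa <= kappa_cst *
   (\sum_(k < K.+1 | (k < K)%N) rad k `^ p * Num.sqrt (smass k)) + 2 `^ p * rad K `^ p.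
Proof.
set SS := \sum_(k < K.+1 | _) _.
have SS0 : 0 <= SS by apply: sumr_ge0 => k _; rewrite mulr_ge0 ?powR_ge0 ?sqrtr_ge0.
have z0 : 0 <= z by exact: powR_ge0.
rewrite /kappa sum_node big_ord_recl /=.
have l0 : \sum_(F : label) nweight (ord0, F) * Num.sqrt (nmass (ord0, F)) <=
    2 `^ p * SS + 2 `^ p * rad K `^ p.
  rewrite sum_label /nweight /= mul0r add0r.
  apply: le_trans (_ : \sum_(k < K.+1) 2 `^ p * rad k `^ p * Num.sqrt (smass k) <= _).
    apply: ler_sum => k _; rewrite (bigD1 ord0) //= big1 ?addr0 // => j j0.
    rewrite [nmass _](_ : _ = 0) ?sqrtr0 ?mulr0 // /nmass /fiber_sum big1 // => t /=.
    case: t => [[k' j']|]; last by rewrite cell_None.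
    by rewrite cell0 => /eqP[_ e]; move: j0; rewrite e eqxx.
  rewrite (bigID (fun k : 'I_K.+1 => (k < K)%N)) /=; apply: lerD.
    rewrite mulr_sumr; apply: ler_sum => k _; by rewrite mulrA.
  rewrite (big_pred1 ord_max) /= => [|k]; last first.
    have kK : (k <= K)%N by rewrite -ltnS.
    by rewrite -leqNgt /= -val_eqE /= eqn_leq kK.
  rewrite ler_piMr ?mulr_ge0 ?powR_ge0 // -sqrtr1 ler_wsqrtr //.
  exact: nmass_le1.
have lS (l : 'I_L) : \sum_(F : label) nweight (lift ord0 l, F) * Num.sqrt (nmass (lift ord0 l, F)) <=
    16 `^ p * Num.sqrt B * z ^+ l * SS.
  rewrite sum_label /nweight /= mul0r add0r.
  rewrite [leRHS]mulrC mulr_suml (bigID (fun k : 'I_K.+1 => (k < K)%N)) /= addrC big1; last first.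
    by move=> k /negbTE ->; rewrite big1 // => j _; rewrite mul0r.
  rewrite add0r; apply: ler_sum => k kK; rewrite kK -mulr_sumr.
  have rk := ltW (rad_gt0 k).
  apply: le_trans (_ : (8 * rad k / 2 ^+ l) `^ p *
     (Num.sqrt (B * (2 ^+ l.+1) `^ alpha) * Num.sqrt (smass k)) <= _).
    rewrite ler_wpM2l ?powR_ge0 //.
    apply: le_trans (sum_sqrt_nmass _ kK) _; first by [].
    rewrite ler_wpM2r ?sqrtr_ge0 // ler_wsqrtr // ctr_size_le //.
    exact: ltn_ord.
  rewrite sqrtrM //.
  have tl : 0 < 2 ^+ l :> R by rewrite exprn_gt0.
  have tl1 : 0 < 2 ^+ l.+1 :> R by rewrite exprn_gt0.
  have -> : Num.sqrt ((2 ^+ l.+1) `^ alpha) = (2 ^+ l.+1) `^ (alpha / 2).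
    by rewrite -powR12_sqrt ?powR_ge0 // -powRrM.
  have -> : (8 * rad k / 2 ^+ l) `^ p = 16 `^ p * rad k `^ p * (2 ^+ l.+1) `^ (- p).
    have -> : 8 * rad k / 2 ^+ l = 16 * rad k * (2 ^+ l.+1)^-1.
      by rewrite exprS; field; rewrite gt_eqF.
    have a0 : 0 <= 16 * rad k by rewrite mulr_ge0.
    have i0 : 0 <= (2 ^+ l.+1)^-1 :> R by rewrite invr_ge0 ltW.
    rewrite (powRM p a0 i0) (powRM p (ler0n _ 16) rk); congr (_ * _).
    by rewrite -powR_inv1 ?(ltW tl1) // -powRrM mulN1r.
  have -> : 16 `^ p * rad k `^ p * (2 ^+ l.+1) `^ (- p) *
      (Num.sqrt B * (2 ^+ l.+1) `^ (alpha / 2) * Num.sqrt (smass k)) =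
    rad k `^ p * Num.sqrt (smass k) * (16 `^ p * Num.sqrt B *
      ((2 ^+ l.+1) `^ (alpha / 2) * (2 ^+ l.+1) `^ (- p))) by ring.
  rewrite -powRD; last by rewrite (gt_eqF tl1) implybT.
  rewrite powR_exprn // -/z ler_wpM2l ?mulr_ge0 ?powR_ge0 ?sqrtr_ge0 //.
  rewrite ler_wpM2l ?mulr_ge0 ?powR_ge0 ?sqrtr_ge0 // exprS ler_piMl ?exprn_ge0 //.
  exact: (ltW chain_ratio_lt1).
rewrite /kappa_cst mulrDl addrAC; apply: lerD => //.
have [L0|L0] := eqVneq L 0%N.
  by rewrite mul0r big1 // => l _; move: (ltn_ord l); rewrite {2}L0.
apply: le_trans (ler_sum _ (fun l _ => lS l)) _.
rewrite -mulr_suml ler_wpM2r // -mulr_sumr ler_wpM2l ?mulr_ge0 ?powR_ge0 ?sqrtr_ge0 //.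
exact: (geometric_sum_le _ z0 chain_ratio_lt1).
Qed.

End Kappa.

(** A step adds 1 to one cell per level and subtracts all the means. The means cost at most [kappa],
    since [m <= sqrt m] on [0, 1]. Along the branch, level 0 costs at most [8 ^ p * rad k ^ p] and
    the finer levels at most twice that, whence the 3. *)
Lemma jump_size t : wnorm nweight (nstep t) <=
  (if t is Some (k, _) then
     if (k < K)%N then 3 * 8 `^ p * rad k `^ p else 2 `^ p * rad K `^ p
   else 0) + kappa.
Proof.
apply: le_trans (_ : \sum_F nweight F * ((cell F.1 t == F.2)%:R + nmass F) <= _).
  apply: ler_sum => F _; rewrite ler_wpM2l ?nweight_ge0 // /nstep.
  apply: le_trans (ler_normB _ _) _.
  by rewrite !ger0_norm ?nmass_ge0.
under eq_bigr do rewrite mulrDr.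
rewrite big_split /=; apply: lerD; last first.
  apply: ler_sum => F _; rewrite ler_wpM2l ?nweight_ge0 //.
  have n0 := nmass_ge0 F; rewrite -{1}(sqr_sqrtr n0) expr2 ler_piMl ?sqrtr_ge0 //.
  by rewrite -sqrtr1 ler_wsqrtr // nmass_le1.
rewrite sum_node /=.
have -> : \sum_(l < L.+1) \sum_(F : label) nweight (l, F) * (cell l t == F)%:R =
   \sum_(l < L.+1) wt l (cell l t).
  apply: eq_bigr => l _; rewrite (bigD1 (cell l t)) //= eqxx mulr1 big1 ?addr0 // => F Ft.
  by rewrite eq_sym (negbTE Ft) mulr0.
case: t => [[k j]|]; last by rewrite big1 // => l _; rewrite cell_None.
have wE l : wt l (cell l (Some (k, j))) = wt l (Some (k, j)).
  have := cell_shell l (Some (k, j)).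
  by case: (cell l _) => [[k2 j2]|] //= [->]; case: l.
under eq_bigr do rewrite wE.
rewrite big_ord_recl /=; case: ifPn => kK; last first.
  have -> : nat_of_ord k = K by apply/eqP; rewrite eqn_leq -ltnS ltn_ord leqNgt.
  by rewrite big1 ?addr0.
have rk := ltW (rad_gt0 k).
pose zz : R := 2 `^ (- p).
have zz0 : 0 <= zz by exact: powR_ge0.
have zz1 : zz <= 2^-1.
  rewrite /zz powRN lef_pV2 ?posrE ?powR_gt0 //.
  by rewrite le1r_powR // ler1n.
have -> : \sum_(i < L) (8 * rad k / 2 ^+ i) `^ p = 8 `^ p * rad k `^ p * \sum_(i < L) zz ^+ i.
  rewrite mulr_sumr; apply: eq_bigr => i _.
  have ti : 0 < 2 ^+ i :> R by rewrite exprn_gt0.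
  have a0 : 0 <= 8 * rad k by rewrite mulr_ge0.
  have i0 : 0 <= (2 ^+ i)^-1 :> R by rewrite invr_ge0 ltW.
  rewrite (powRM p a0 i0) (powRM p (ler0n _ 8) rk); congr (_ * _).
  by rewrite -powR_inv1 ?(ltW ti) // -powRrM mulN1r powR_exprn.
have zzl : zz < 1 by apply: le_lt_trans zz1 _; rewrite invf_lt1 // ltr1n.
have g : \sum_(i < L) zz ^+ i <= 2.
  apply: le_trans (geometric_sum_le _ zz0 zzl) _.
  by rewrite -[leRHS]invrK lef_pV2 ?posrE ?invr_gt0 //; lra.
have h28 : 2 `^ p <= 8 `^ p :> R by apply: le_powRl => //; rewrite ler_nat.
have rp : 0 <= rad k `^ p by exact: powR_ge0.
apply: le_trans (_ : 8 `^ p * rad k `^ p + 8 `^ p * rad k `^ p * 2 <= _).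
  by apply: lerD; [rewrite ler_wpM2r|rewrite ler_wpM2l // mulr_ge0 // powR_ge0].
by rewrite le_eqVlt; apply/orP; left; apply/eqP; ring.
Qed.

(** Half of [u] absorbs [kappa]. The other half is at least the core jump and at least
    [3 * 8 ^ p * (2 * v) ^ p], so a jump above [u] forces [rad k > 2 * v], hence a point farther
    than [v]. *)
Lemma jumpprob_le_tail u v : 0 <= v -> 2 * kappa <= u -> 2 * (2 `^ p * rad K `^ p) <= u ->
  6 * 16 `^ p * v `^ p <= u ->
  jumpprob cmass nweight nstep u <= tailH d x0 mu v.
Proof.
move=> v0 hk hK hv; rewrite /jumpprob sum_cmass; apply: le_tailH => //.
  exact: (measurable_labpred (fun t => u < wnorm nweight (nstep t))).
move=> y /= uy; have := lt_le_trans uy (jump_size (lab y)).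
case yE : (lab y) => [[k j]|]; last first.
  have : 0 <= kappa by apply: sumr_ge0 => F _; rewrite mulr_ge0 ?nweight_ge0 ?sqrtr_ge0.
  lra.
case: ifPn => kK; last by lra.
move=> h; have [yin sy] := lab_Some yE.
apply: lt_trans (shell_gt _); last by rewrite sy.
rewrite sy ltNge; apply/negP => rv.
have : rad k `^ p <= 2 `^ p * v `^ p.
  by rewrite -powRM // le_powRl ?(ltW (rad_gt0 k)) // radS; lra.
have E8 : 16 `^ p = 8 `^ p * 2 `^ p :> R by rewrite -powRM // -natrM.
move=> hr; have : 3 * 8 `^ p * rad k `^ p <= 3 * 8 `^ p * (2 `^ p * v `^ p).
  by rewrite ler_wpM2l // mulr_ge0 // powR_ge0.
move: hv; rewrite E8; lra.
Qed.

End Deterministic.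
End Labels.

(** * Deviation bounds *)

(** The [+ 1] turns the bound on the infimum into a strict one, so that some actual cover can be
    extracted. *)
Lemma covering_centers (R : realType) (E : choiceType) (d : E -> E -> R) (Y : set E)
    (delta c : R) : (covering_number d Y delta <= c%:E)%E ->
  exists s : seq E, [/\ forall z, z \in s -> Y z,
    forall y, Y y -> has (fun z => d z y <= delta) s & (size s)%:R <= c + 1].
Proof.
move=> h; have : (covering_number d Y delta < (c + 1)%:E)%E.
  by apply: le_lt_trans h _; rewrite lte_fin ltrDl.
move=> /ereal_inf_lt[_ [m [y [yY Ycov]] <-]]; rewrite lte_fin => mc.
exists [seq y j | j <- enum 'I_m]; split.
- by move=> z /mapP[j _ ->].
- move=> z /Ycov[j yz]; apply/hasP; exists (y j) => //.
  by apply: map_f; rewrite mem_enum.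
- by rewrite size_map size_enum_ord ltW.
Qed.

Definition chain_cst (R : realType) (L : nat) (p alpha beta : R) : R :=
  2 `^ p + (if L == 0%N then 0
            else 16 `^ p * Num.sqrt (beta + 1) / (1 - 2 `^ (alpha / 2 - p))).

Lemma small_dyadic (R : realType) (c e p : R) : 0 <= c -> 0 < e -> 0 < p ->
  exists K : nat, (c / 2 ^+ K) `^ p <= e.
Proof.
move=> c0 e0 p0; pose e' := e `^ p^-1.
have e'0 : 0 < e' by rewrite powR_gt0.
exists (Num.bound (c / e')).
have : c / e' < 2 ^+ Num.bound (c / e') by apply: upper_nthrootP.
set K := Num.bound _ => h.
have tK : 0 < 2 ^+ K :> R by rewrite exprn_gt0.
have -> : e = e' `^ p by rewrite /e' -powRrM mulVf ?gt_eqF // powRr1 // ltW.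
apply: ge0_ler_powR; rewrite ?nnegrE ?(ltW p0) ?(ltW e'0) //.
  by rewrite divr_ge0 // ltW.
by rewrite ler_pdivrMr // mulrC -ler_pdivrMr // ltW.
Qed.

Lemma small_power (R : realType) (D a e : R) : 0 <= D -> 0 < a -> 0 < e ->
  exists2 rho : R, 1 <= rho & D * rho `^ (- a) <= e.
Proof.
move=> D0 a0 e0; pose rho := Num.max 1 ((D / e) `^ a^-1).
have r1 : 1 <= rho by rewrite le_max lexx.
have r0 : 0 < rho := lt_le_trans ltr01 r1.
exists rho => //; rewrite powRN ler_pdivrMr ?powR_gt0 // mulrC -ler_pdivrMr //.
have De : 0 <= D / e by rewrite divr_ge0 // ltW.
have {1}-> : D / e = ((D / e) `^ a^-1) `^ a by rewrite -powRrM mulVf ?gt_eqF // powRr1.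
apply: ge0_ler_powR; rewrite ?nnegrE ?powR_ge0 ?(ltW a0) ?(ltW r0) //.
by rewrite le_max lexx orbT.
Qed.

Section Core.
Context {R : realType} {dE : measure_display} {E : measurableType dE} (d : E -> E -> R).
Context {dO : measure_display} {O : measurableType dO}.
Variables (x0 : E) (mu : probability E R) (P : probability O R) (n : nat)
  (X : 'I_n -> O -> E) (S : set E) (p alpha beta : R).
Hypothesis polish_d : polish d.
Hypothesis n_gt0 : (0 < n)%N.
Hypothesis iidX : iid P mu X.
Hypothesis mS : measurable S.
Hypothesis muS : mu S = 1%E.
Hypothesis p_ge1 : 1 <= p.
Hypothesis alpha_gt0 : 0 < alpha.
Hypothesis alpha_lt : alpha < 2 * p.
Hypothesis beta_gt0 : 0 < beta.
Hypothesis cover : forall r delta, 0 < r -> 0 < delta -> delta <= 2 * r ->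
  (covering_number d (S `&` cball d x0 r) delta <= (beta * (2 * r / delta) `^ alpha)%:E)%E.
Hypothesis moment_fin : (pmoment d x0 mu p < +oo)%E.

Local Notation H := (tailH d x0 mu).

(** This seals off the geometry: from here on only a finite walk, its [kappa], the tail of its jumps
    and a deterministic [rest] are visible. *)
Lemma walk_reduction (rho : R) (K L : nat) : 0 < rho ->
  exists (T J : finType) (b : T -> R) (W : J -> R) (Y : T -> J -> R) (s : J -> R) (rest : R),
  let kappa := \sum_F W F * Num.sqrt (s F) in
  [/\ (forall t, 0 <= b t) /\ \sum_t b t = 1,
      (forall F, 0 <= W F) /\ (forall F, 0 <= s F),
      (forall F, \sum_t b t * Y t F = 0) /\ (forall F, \sum_t b t * Y t F ^+ 2 <= s F) &
  [/\ kappa <= chain_cst L p alpha beta *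
        (\sum_(k < K) (rho / 2 ^+ k) `^ p * Num.sqrt (H (rho / 2 ^+ k.+1)))
        + (2 * (rho / 2 ^+ K)) `^ p,
      forall u v, 0 <= v -> 2 * kappa <= u -> 2 * (2 * (rho / 2 ^+ K)) `^ p <= u ->
        6 * 16 `^ p * v `^ p <= u -> jumpprob b W Y u <= H v,
      forall x y, rest + y <= x ->
        (P [set w | x%:E < Wpp d p (empirical (fun i => X i w)) mu] <=
        (n%:R * H rho + endprob b W Y n (n%:R * y) (fun=> 0))%:E)%E &
      forall sg, p < sg -> (weak_moment d x0 mu sg < +oo)%E ->
        rest <= (if L == 0%N then 16 `^ p * fine (pmoment d x0 mu p)
                 else (8 * rho / 2 ^+ L) `^ p) + (2 * (rho / 2 ^+ K)) `^ p +
          2 `^ p * (2 `^ p / (1 - 2 `^ (p - sg)) *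
            fine (weak_moment d x0 mu sg) * rho `^ (p - sg))]].
Proof.
move=> rho0.
have p0 : 0 < p by exact: lt_le_trans p_ge1.
have rad0 k : 0 < rad rho k by exact: rad_gt0.
have mesh0 k l : 0 < mesh rho k l by exact: mesh_gt0.
have ex k l : exists s : seq E, [/\ forall z, z \in s -> (S `&` cball d x0 (rad rho k)) z,
    forall y, (S `&` cball d x0 (rad rho k)) y -> has (fun z => d z y <= mesh rho k l) s &
    (size s)%:R <= (beta + 1) * (2 ^+ l) `^ alpha].
  have t1 : 1 <= 2 ^+ l :> R by rewrite exprn_ege1 // ler1n.
  have t0 : 0 < 2 ^+ l :> R by rewrite exprn_gt0.
  have md : mesh rho k l <= 2 * rad rho k.
    by rewrite /mesh ler_pdivrMr // mulrC ler_peMr // mulr_ge0 // ltW.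
  have [s [s1 s2 s3]] := covering_centers (cover (rad0 k) (mesh0 k l) md).
  exists s; split => //; apply: le_trans s3 _.
  have -> : 2 * rad rho k / mesh rho k l = 2 ^+ l.
    by rewrite /mesh; field; rewrite !gt_eqF // rad0.
  rewrite mulrDl mul1r lerD2l.
  have : 1 `^ alpha <= (2 ^+ l) `^ alpha.
    by apply: ge0_ler_powR; rewrite ?nnegrE ?(ltW alpha_gt0) ?(ltW t0).
  by rewrite powR1.
have [ctr ctrP] := choice (fun kl : nat * nat => ex kl.1 kl.2).
pose c k l := ctr (k, l).
pose N := (\max_(k < K) \max_(l < L.+1) size (c k l))%N.
have c_in k l z : z \in c k l -> S z /\ d x0 z <= rad rho k.
  by move=> zc; have [h _ _] := ctrP (k, l); exact: h.
have c_cov k l y : S y -> d x0 y <= rad rho k -> has (fun z => d z y <= mesh rho k l) (c k l).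
  by move=> Sy yr; have [_ h _] := ctrP (k, l); exact: h.
have c_size k l : (k < K)%N -> (l <= L)%N -> (size (c k l) <= N)%N.
  move=> kK lL; rewrite /N.
  apply: leq_trans (@leq_bigmax _ (fun k : 'I_K => \max_(l < L.+1) size (c k l))%N (Ordinal kK)).
  exact: (@leq_bigmax _ (fun l : 'I_L.+1 => size (c k l)) (Ordinal (lL : (l < L.+1)%N))).
have c_size_le k l : (k < K)%N -> (l <= L)%N ->
    (size (c k l))%:R <= (beta + 1) * (2 ^+ l) `^ alpha.
  by move=> _ _; have [_ _ h] := ctrP (k, l).
have B0 : 0 <= beta + 1 by rewrite addr_ge0 // ltW.
pose b := cmass d x0 S rho L c mu : label K N -> R.
exists (label K N), (node K L N), b,
  (nweight rho p : node K L N -> R), (nstep d x0 S rho c mu : label K N -> node K L N -> R),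
  (nmass d x0 S rho c mu : node K L N -> R),
  (\sum_t b t * wbot rho L p t + outcost d x0 S rho K L N c mu p).
have radE k : rad rho k = rho / 2 ^+ k by [].
have KE : (2 * (rho / 2 ^+ K)) `^ p = 2 `^ p * rad rho K `^ p.
  by rewrite powRM // ltW // rad0.
have z1 := chain_ratio_lt1 alpha_lt.
split.
- by split => [t|]; [exact: cmass_ge0|exact: cmass_sum1].
- by split; [exact: nweight_ge0|exact: nmass_ge0].
- by split; [exact: nstep_mean0|exact: nstep_var].
split.
- apply: le_trans (kappa_le polish_d mS rho0 c_in c_cov c_size mu alpha_lt B0 c_size_le) _.
  rewrite KE lerD2r; apply: ler_wpM2l.
    rewrite addr_ge0 ?powR_ge0 //; case: ifP => // _.
    by rewrite divr_ge0 ?mulr_ge0 ?powR_ge0 ?sqrtr_ge0 // subr_ge0 ltW.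
  rewrite [leRHS](big_ord_widen K.+1 (fun k => (rho / 2 ^+ k) `^ p *
    Num.sqrt (H (rho / 2 ^+ k.+1)))) //.
  apply: ler_sum => k kK; rewrite ler_wpM2l ?powR_ge0 // ler_wsqrtr //.
  exact: smass_le.
- move=> u v v0 hk hK hv; apply: (jumpprob_le_tail polish_d mS rho0 p_ge1) => //.
  by rewrite -KE.
- move=> x y hxy.
  apply: le_trans (deviation_reduction polish_d mS rho0 c_in c_cov c_size p_ge1 moment_fin iidX n_gt0 hxy) _.
  rewrite lee_fin lerD2r ler_wpM2l //; exact: cmass_None_le.
- move=> sg psg wf; apply: lerD; last exact: outcost_le.
  case: eqP => L0; last exact: wbot_sum_le.
  exact: wbot_sum_le_moment.
Qed.

Lemma fine_I2pp_ge0 : 0 <= fine (I2pp d x0 mu p).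
Proof. by apply: fine_ge0; apply: integral_ge0 => t _; exact: I2pp_integrand_ge0. Qed.

Lemma dyadic_sum_le_I2pp rho K : 0 < rho -> (I2pp d x0 mu p < +oo)%E ->
  \sum_(k < K) (rho / 2 ^+ k) `^ p * Num.sqrt (H (rho / 2 ^+ k.+1)) <=
  4 `^ p * fine (I2pp d x0 mu p).
Proof.
move=> rho0 If; have := I2pp_ge_dyadic polish_d x0 mu p_ge1 K rho0.
have I0 : (0 <= I2pp d x0 mu p)%E by apply: integral_ge0 => t _; exact: I2pp_integrand_ge0.
rewrite -[X in (_ <= X)%E]fineK ?ge0_fin_numE // lee_fin.
have p4 : 0 < 4 `^ p :> R by rewrite powR_gt0.
move=> h; rewrite -ler_pdivrMl // mulr_sumr; apply: le_trans h.
by apply: ler_sum => k _; rewrite mulrA.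
Qed.

(* The boolean [b] selects the trivial partition into shells ([L = 0]), whose
   constants do not involve the covering numbers. *)
Lemma walk_reduction_small (b : bool) (sg e : R) : p < sg ->
  (weak_moment d x0 mu sg < +oo)%E -> (I2pp d x0 mu p < +oo)%E -> 0 < e ->
  exists (T J : finType) (m : T -> R) (W : J -> R) (Y : T -> J -> R) (s : J -> R),
  let kappa := \sum_F W F * Num.sqrt (s F) in
  [/\ (forall t, 0 <= m t) /\ \sum_t m t = 1,
      (forall F, 0 <= W F) /\ (forall F, 0 <= s F),
      (forall F, \sum_t m t * Y t F = 0) /\ (forall F, \sum_t m t * Y t F ^+ 2 <= s F) &
  [/\ kappa <= chain_cst (~~ b) p alpha beta * 4 `^ p * fine (I2pp d x0 mu p) + e,
      forall u v, 0 <= v -> 2 * kappa <= u -> 2 * e <= u ->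
        6 * 16 `^ p * v `^ p <= u -> jumpprob m W Y u <= H v &
      forall x, (if b then 16 `^ p * fine (pmoment d x0 mu p) else 0) + 3 * e <= x / 2 ->
        (P [set w | x%:E < Wpp d p (empirical (fun i => X i w)) mu] <=
        (e + endprob m W Y n (n%:R * (x / 2)) (fun=> 0))%:E)%E]].
Proof.
move=> psg wf If e0.
have p0 : 0 < p by exact: lt_le_trans p_ge1.
have sg0 : 0 < sg by exact: lt_trans psg.
have wm0 := weak_moment_ge0 wf.
pose wm := fine (weak_moment d x0 mu sg).
have z1 : 2 `^ (p - sg) < 1 :> R.
  have := @gt0_ltr_powR R (sg - p) _ 1 2; rewrite powR1 subr_gt0 !nnegrE.
  move=> /(_ psg ler01 (ler0n _ _) (ltr1n _ _)) h.
  by rewrite -opprB powRN invf_lt1 // powR_gt0.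
pose Co : R := 2 `^ p * (2 `^ p / (1 - 2 `^ (p - sg)) * wm).
have Co0 : 0 <= Co.
  by rewrite mulr_ge0 ?powR_ge0 // mulr_ge0 // divr_ge0 ?powR_ge0 // subr_ge0 ltW.
have D0 : 0 <= n%:R * wm + Co by rewrite addr_ge0 // mulr_ge0.
have spp : 0 < sg - p by rewrite subr_gt0.
(* One radius makes both [n * H rho] and the outside cost small; [rho >= 1] allows [rho ^ (- sg)] to
   be replaced by the larger [rho ^ (p - sg)]. *)
have [rho r1 hr] := small_power D0 spp e0.
have rho0 : 0 < rho := lt_le_trans ltr01 r1.
move: hr; rewrite opprB mulrDl => hr.
have rp0 : 0 <= rho `^ (p - sg) by exact: powR_ge0.
have rho2 : 0 <= 2 * rho by rewrite mulr_ge0 // ltW.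
have rho4 : 0 <= 4 * rho by rewrite mulr_ge0 // ltW.
have [K hK] := small_dyadic rho2 e0 p0.
have [L0 hL] := small_dyadic rho4 e0 p0.
(* The successor keeps [L] nonzero: [chain_cst] only tests [L = 0], so the depth does not enter the
   constant. *)
pose L := if b then 0%N else L0.+1.
have [T [J [m [W [Y [s [rest [h1 h2 h3 [hk hj hP hrest]]]]]]]]] := walk_reduction K L rho0.
exists T, J, m, W, Y, s; split => //.
rewrite -mulrA in hK.
have chainE : chain_cst L p alpha beta = chain_cst (~~ b) p alpha beta.
  by rewrite /chain_cst /L; case: (b).
have chain0 : 0 <= chain_cst L p alpha beta.
  rewrite addr_ge0 ?powR_ge0 //; case: ifP => // _.
  rewrite divr_ge0 ?mulr_ge0 ?powR_ge0 ?sqrtr_ge0 // subr_ge0 ltW //.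
  exact: (chain_ratio_lt1 alpha_lt).
split.
- apply: le_trans hk _; rewrite -chainE; apply: lerD => //.
  by rewrite -mulrA ler_wpM2l // dyadic_sum_le_I2pp.
- move=> u v v0 k2 e2 v6; apply: hj => //; apply: le_trans e2.
  by rewrite ler_wpM2l.
- move=> x hx; have hr2 := hrest sg psg wf.
  apply: le_trans (hP x (x / 2) _) _.
    have : (if L == 0%N then 16 `^ p * fine (pmoment d x0 mu p) else (8 * rho / 2 ^+ L) `^ p) <=
       (if b then 16 `^ p * fine (pmoment d x0 mu p) else 0) + e.
      rewrite /L; case: (b); first by rewrite lerDl ltW.
      rewrite add0r /= exprS; have -> : 8 * rho / (2 * 2 ^+ L0) = 4 * rho / 2 ^+ L0; last by [].
      by field; rewrite expf_neq0.
    have out_le : 2 `^ p * (2 `^ p / (1 - 2 `^ (p - sg)) * wm * rho `^ (p - sg)) <= e.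
      apply: le_trans hr; rewrite mulrA -/Co lerDr.
      by rewrite !mulr_ge0.
    move: hr2; rewrite -/wm; lra.
  rewrite lee_fin lerD2r; apply: le_trans (_ : n%:R * wm * rho `^ (p - sg) <= _).
    rewrite -mulrA ler_wpM2l //; apply: le_trans (tailH_le_weak wf rho0) _.
    rewrite ler_wpM2l // ler_powR //; lra.
  by apply: le_trans hr; rewrite lerDl mulr_ge0.
Qed.

(** * Quadratic deviation bounds *)

Lemma endprob_le_kappa (T J : finType) (m : T -> R) (W : J -> R) (Y : T -> J -> R)
    (s : J -> R) x : 0 < x ->
  (forall t, 0 <= m t) -> \sum_t m t = 1 -> (forall F, 0 <= W F) -> (forall F, 0 <= s F) ->
  (forall F, \sum_t m t * Y t F = 0) -> (forall F, \sum_t m t * Y t F ^+ 2 <= s F) ->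
  endprob m W Y n (n%:R * (x / 2)) (fun=> 0) <=
  4 * (\sum_F W F * Num.sqrt (s F)) ^+ 2 / (n%:R * x ^+ 2).
Proof.
move=> xp m0 m1 W0 s0 Y0 Yv; have nn : 0 < n%:R :> R by rewrite ltr0n.
have t0 : 0 < n%:R * (x / 2) by rewrite mulr_gt0 // divr_gt0.
apply: le_trans (endprob_le_second_moment m0 m1 W0 Y0 Yv s0 n t0) _.
rewrite le_eqVlt; apply/orP; left; apply/eqP.
by field; rewrite !gt_eqF.
Qed.

(** Constants must be positive for all real parameters, and [1 - 2 ^ (alpha / 2 - p)] may be
    negative outside the admissible range; hence the absolute value and the 1. *)
Definition chain_bound : R := 1 + `|chain_cst 1 p alpha beta| * 4 `^ p.

(** Chebyshev at [x / 2] gives the factor 4, and [(a + e) ^ 2 <= 2 * a ^ 2 + 2 * e ^ 2], which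
    separates the error in [kappa], makes it 8. *)
Lemma second_moment_bound x : (I2pp d x0 mu p < +oo)%E -> 0 < x ->
  (P [set w | x%:E < Wpp d p (empirical (fun i => X i w)) mu] <=
   (8 * chain_bound ^+ 2 * fine (I2pp d x0 mu p) ^+ 2 / (x ^+ 2 * n%:R))%:E)%E.
Proof.
move=> If xp; have wf := weak_moment_le_I2pp polish_d p_ge1 If.
have nn : 0 < n%:R :> R by rewrite ltr0n.
have p0 : 0 < p by exact: lt_le_trans p_ge1.
have p2 : p < 2 * p by lra.
set I := fine _; have I0 : 0 <= I by exact: fine_I2pp_ge0.
apply/lee_addgt0Pr => e e0.
have x2n : 0 < n%:R * x ^+ 2 by rewrite mulr_gt0 // exprn_gt0.
pose c := 1 + 8 / (n%:R * x ^+ 2).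
have c0 : 0 < c by rewrite addr_gt0 // divr_gt0.
pose e1 := Num.min 1 (Num.min (x / 8) (e / c)).
have e10 : 0 < e1 by rewrite !lt_min ltr01 !divr_gt0.
have e11 : e1 <= 1 by rewrite ge_min lexx.
have e1x : e1 <= x / 8 by rewrite !ge_min lexx orbT.
have e1c : e1 * c <= e by rewrite -ler_pdivlMr // !ge_min lexx !orbT.
have [T [J [m [W [Y [s [[m0 m1] [W0 s0] [Y0 Yv] [hk _ hP]]]]]]]] :=
  walk_reduction_small false p2 wf If e10.
have hx : 0 + 3 * e1 <= x / 2 by lra.
apply: le_trans (hP x hx) _; rewrite -EFinD lee_fin.
have := endprob_le_kappa xp m0 m1 W0 s0 Y0 Yv.
set k := \sum_F _ in hk *; set pr := endprob _ _ _ _ _ _ => hpr.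
have k0 : 0 <= k by apply: sumr_ge0 => F _; rewrite mulr_ge0 ?sqrtr_ge0.
have hk2 : k <= chain_bound * I + e1.
  apply: le_trans hk _; rewrite lerD2r -/I ler_wpM2r // /chain_bound.
  apply: le_trans (_ : `|chain_cst 1 p alpha beta| * 4 `^ p <= _); last by rewrite lerDr.
  by rewrite ler_wpM2r ?powR_ge0 // ler_norm.
have CI : 0 <= chain_bound * I.
  by rewrite mulr_ge0 // addr_ge0 // mulr_ge0 // powR_ge0.
have hk3 : k ^+ 2 <= 2 * (chain_bound * I) ^+ 2 + 2 * e1 ^+ 2.
  apply: le_trans (_ : (chain_bound * I + e1) ^+ 2 <= _).
    by rewrite lerXn2r ?nnegrE // addr_ge0 // ltW.
  have := sqr_ge0 (chain_bound * I - e1); nra.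
have e12 : e1 ^+ 2 <= e1 by rewrite expr2 ler_piMr // ltW.
have hpr2 : pr <= (8 * (chain_bound * I) ^+ 2 + 8 * e1) / (n%:R * x ^+ 2).
  apply: le_trans hpr _; rewrite ler_wpM2r ?invr_ge0 ?(ltW x2n) //; lra.
apply: le_trans (_ : e1 + (8 * (chain_bound * I) ^+ 2 + 8 * e1) / (n%:R * x ^+ 2) <= _).
  by rewrite lerD2l.
have -> : e1 + (8 * (chain_bound * I) ^+ 2 + 8 * e1) / (n%:R * x ^+ 2) =
  8 * chain_bound ^+ 2 * I ^+ 2 / (x ^+ 2 * n%:R) + e1 * c.
  by rewrite /c; field; rewrite !gt_eqF.
by rewrite lerD2l.
Qed.

Lemma deviation_le1 x : (P [set w | x%:E < Wpp d p (empirical (fun i => X i w)) mu] <= 1)%E.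
Proof.
apply: probability_le1; apply: (measurable_Wpp_gt polish_d) => //.
  exact: lt_le_trans p_ge1.
by case: iidX.
Qed.

(** For orders below [2 * p] the terms decrease geometrically towards [x0], so the outermost shell
    dominates and the sum grows like [rho ^ (p - sg / 2)]. *)
Lemma dyadic_sum_le_weak sg rho K : sg < 2 * p -> 0 < rho ->
  (weak_moment d x0 mu sg < +oo)%E ->
  \sum_(k < K) (rho / 2 ^+ k) `^ p * Num.sqrt (H (rho / 2 ^+ k.+1)) <=
  2 `^ (sg / 2) / (1 - 2 `^ (sg / 2 - p)) *
    (Num.sqrt (fine (weak_moment d x0 mu sg)) * rho `^ (p - sg / 2)).
Proof.
move=> sgp rho0 wf; have wm0 := weak_moment_ge0 wf.
set w := Num.sqrt _; have w0 : 0 <= w by exact: sqrtr_ge0.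
have := chain_ratio_lt1 sgp; set z := 2 `^ (sg / 2 - p) => z1.
have z0 : 0 <= z by exact: powR_ge0.
have t2 : 0 <= 2 :> R by [].
have term k : (rho / 2 ^+ k) `^ p * Num.sqrt (H (rho / 2 ^+ k.+1)) <=
    2 `^ (sg / 2) * (w * rho `^ (p - sg / 2)) * z ^+ k.
  set a := rho / 2 ^+ k.
  have a0 : 0 < a by rewrite divr_gt0 // exprn_gt0.
  have -> : rho / 2 ^+ k.+1 = a / 2 by rewrite /a exprS; field; rewrite expf_neq0.
  have a20 : 0 < a / 2 by rewrite divr_gt0.
  have h : Num.sqrt (H (a / 2)) <= w * (2 `^ (sg / 2) * a `^ (- (sg / 2))).
    apply: le_trans (ler_wsqrtr (tailH_le_weak wf a20)) _; rewrite sqrtrM //.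
    have -> : (a / 2) `^ (- sg) = (2 `^ (sg / 2) * a `^ (- (sg / 2))) ^+ 2.
      rewrite exprMn -!powR_mulrn ?powR_ge0 // -!powRrM mulNr divfK // powRM ?invr_ge0 ?(ltW a0) //.
      by rewrite -powR_inv1 // -powRrM mulN1r opprK mulrC.
    by rewrite sqrtr_sqr ger0_norm // mulr_ge0 ?powR_ge0.
  apply: le_trans (ler_wpM2l (powR_ge0 _ _) h) _.
  have -> : z ^+ k = ((2 ^+ k)^-1) `^ (p - sg / 2).
    by rewrite -powR_inv1 ?exprn_ge0 // -powRrM mulN1r opprB powR_exprn.
  have -> : 2 `^ (sg / 2) * (w * rho `^ (p - sg / 2)) * (2 ^+ k)^-1 `^ (p - sg / 2) =
     2 `^ (sg / 2) * w * a `^ (p - sg / 2).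
    by rewrite /a (@powRM _ rho) ?(ltW rho0) ?invr_ge0 ?exprn_ge0 // !mulrA.
  rewrite (@powRD _ a p (- (sg / 2))); last by apply/implyP => _; rewrite gt_eqF.
  by rewrite le_eqVlt; apply/orP; left; apply/eqP; ring.
apply: (@le_trans _ _ (\sum_(k < K) 2 `^ (sg / 2) * (w * rho `^ (p - sg / 2)) * z ^+ k)).
  by apply: ler_sum => k _; exact: term.
rewrite -mulr_sumr.
rewrite [leRHS]mulrAC; apply: ler_wpM2l; last exact: geometric_sum_le.
by rewrite !mulr_ge0 ?powR_ge0.
Qed.

Definition heavy_tail_cst (r : R) : R := 2 `^ p * (2 `^ p / (1 - 2 `^ (p - r * p))).

Definition heavy_chain_cst (r : R) : R :=
  chain_cst 1 p alpha beta * (2 `^ (r * p / 2) / (1 - 2 `^ (r * p / 2 - p))).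

(** The 1 pays for samples outside the ball, the 8 for Chebyshev on the walk, and the 4 makes the
    bound exceed 1 whenever the outside cost is not below [x / 4]. *)
Definition heavy_cst (r : R) : R :=
  1 + 4 * `|heavy_tail_cst r| + 8 * heavy_chain_cst r ^+ 2.

(* Truncation at the radius [rho] with [rho ^ p = n x] balances the mass outside
   the ball against the second moment of the truncated walk. *)
Lemma heavy_tail_bound r x : 1 < r -> r < 2 -> (weak_moment d x0 mu (r * p) < +oo)%E -> 0 < x ->
  (P [set w | x%:E < Wpp d p (empirical (fun i => X i w)) mu] <=
   (heavy_cst r * fine (weak_moment d x0 mu (r * p)) / (x `^ r * n%:R `^ (r - 1)))%:E)%E.
Proof.
move=> r1 r2 wf xp; have wm0 := weak_moment_ge0 wf.
set wm := fine _ in wm0 *.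
have nn : 0 < n%:R :> R by rewrite ltr0n.
have p0 : 0 < p by exact: lt_le_trans p_ge1.
have psg : p < r * p by rewrite ltr_pMl.
have sg2p : r * p < 2 * p by rewrite ltr_pM2r.
pose N := n%:R * x; have N0 : 0 < N by rewrite mulr_gt0.
pose D := (x `^ r * n%:R `^ (r - 1))^-1.
have D0 : 0 < D by rewrite invr_gt0 mulr_gt0 // powR_gt0.
pose rho := N `^ p^-1; have rho0 : 0 < rho by rewrite powR_gt0.
have DE : D = n%:R * N `^ (- r).
  rewrite /D /N powRN powRM ?(ltW nn) ?(ltW xp) // powRB; last by rewrite gt_eqF // implybT.
  by rewrite powRr1 ?(ltW nn) //; field; rewrite !gt_eqF // powR_gt0.
have rhoE a : rho `^ (a * p) = N `^ a.
  by rewrite /rho -powRrM; congr (_ `^ _); field; rewrite gt_eqF.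
have rho_out : rho `^ (p - r * p) = x * D.
  rewrite -{1}[p]mul1r -mulrBl rhoE powRD; last by rewrite (gt_eqF N0) implybT.
  by rewrite powRr1 ?(ltW N0) // DE /N; ring.
have rho_mass : n%:R * rho `^ (- (r * p)) = D by rewrite -mulNr rhoE DE.
have rho_kappa : (rho `^ (p - r * p / 2)) ^+ 2 = n%:R * x ^+ 2 * D.
  rewrite -powR_mulrn ?powR_ge0 // -powRrM.
  have -> : (p - r * p / 2) * 2 = (2 - r) * p by field.
  rewrite rhoE powRD; last by rewrite (gt_eqF N0) implybT.
  by rewrite powR_mulrn ?(ltW N0) // DE /N; ring.
have -> : heavy_cst r * wm / (x `^ r * n%:R `^ (r - 1)) = heavy_cst r * (wm * D) by rewrite mulrA.
have wD0 : 0 <= wm * D by rewrite mulr_ge0 // ltW.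
(* In the second case the outside cost is at most [x / 4]; half of [x] goes to the walk and the last
   quarter to the two discretization errors. *)
have [big|small] := lerP 1 (4 * `|heavy_tail_cst r| * (wm * D)).
  apply: le_trans (deviation_le1 x) _; rewrite lee_fin; apply: le_trans big _.
  by rewrite ler_wpM2r // /heavy_cst -addrA addrCA lerDl addr_ge0 // mulr_ge0 // sqr_ge0.
apply/lee_addgt0Pr => e e0.
have x2n : 0 < n%:R * x ^+ 2 by rewrite mulr_gt0 // exprn_gt0.
pose c := 8 / (n%:R * x ^+ 2).
have c0 : 0 < c by rewrite divr_gt0.
pose e1 := Num.min 1 (Num.min (x / 8) (e / c)).
have e10 : 0 < e1 by rewrite !lt_min ltr01 !divr_gt0.
have e11 : e1 <= 1 by rewrite ge_min lexx.
have e1x : e1 <= x / 8 by rewrite !ge_min lexx orbT.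
have e1c : e1 * c <= e by rewrite -ler_pdivlMr // !ge_min lexx !orbT.
have rho2 : 0 <= 2 * rho by rewrite mulr_ge0 // ltW.
have rho4 : 0 <= 4 * rho by rewrite mulr_ge0 // ltW.
have [K] := small_dyadic rho2 e10 p0; rewrite -mulrA => hK.
have [L hL] := small_dyadic rho4 e10 p0.
have [T [J [m [W [Y [s [rest [[m0 m1] [W0 s0] [Y0 Yv] [hk _ hP hrest]]]]]]]]] :=
  walk_reduction K L.+1 rho0.
have hx : rest + x / 2 <= x.
  have := hrest _ psg wf; rewrite /= -/wm rho_out.
  have -> : 8 * rho / 2 ^+ L.+1 = 4 * rho / 2 ^+ L.
    by rewrite exprS; field; rewrite expf_neq0.
  have -> : 2 `^ p * (2 `^ p / (1 - 2 `^ (p - r * p)) * wm * (x * D)) =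
     heavy_tail_cst r * (wm * D) * x by rewrite /heavy_tail_cst; ring.
  have : heavy_tail_cst r * (wm * D) * x <= x / 4.
    apply: le_trans (_ : `|heavy_tail_cst r| * (wm * D) * x <= _).
      by rewrite ler_wpM2r ?(ltW xp) // ler_wpM2r // ler_norm.
    by rewrite mulrC ler_pM2l //; lra.
  lra.
apply: le_trans (hP x (x / 2) hx) _; rewrite -EFinD lee_fin.
have := endprob_le_kappa xp m0 m1 W0 s0 Y0 Yv.
set k := \sum_F _ in hk *; set pr := endprob _ _ _ _ _ _ => hpr.
have k0 : 0 <= k by apply: sumr_ge0 => F _; rewrite mulr_ge0 ?sqrtr_ge0.
pose a := heavy_chain_cst r * (Num.sqrt wm * rho `^ (p - r * p / 2)).
have ch0 : 0 <= chain_cst L.+1 p alpha beta.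
  rewrite addr_ge0 ?powR_ge0 // divr_ge0 ?mulr_ge0 ?powR_ge0 ?sqrtr_ge0 // subr_ge0 ltW //.
  exact: (chain_ratio_lt1 alpha_lt).
have hk2 : k <= a + e1.
  apply: le_trans hk _; apply: lerD => //.
  rewrite /a /heavy_chain_cst -mulrA; apply: ler_wpM2l => //.
  exact: dyadic_sum_le_weak.
have a2 : a ^+ 2 = heavy_chain_cst r ^+ 2 * (wm * D) * (n%:R * x ^+ 2).
  by rewrite /a !exprMn sqr_sqrtr // rho_kappa; ring.
have hk3 : k ^+ 2 <= 2 * a ^+ 2 + 2 * e1 ^+ 2.
  apply: le_trans (_ : (a + e1) ^+ 2 <= _).
    by rewrite lerXn2r ?nnegrE // (le_trans k0).
  by have := sqr_ge0 (a - e1); nra.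
have e12 : e1 ^+ 2 <= e1 by rewrite expr2 ler_piMr // ltW.
have hpr2 : pr <= (8 * a ^+ 2 + 8 * e1) / (n%:R * x ^+ 2).
  apply: le_trans hpr _; rewrite ler_wpM2r ?invr_ge0 ?(ltW x2n) //; lra.
have hH : n%:R * H rho <= wm * D.
  rewrite -rho_mass mulrCA ler_wpM2l ?(ltW nn) //; exact: tailH_le_weak.
have tot : (8 * a ^+ 2 + 8 * e1) / (n%:R * x ^+ 2) =
   8 * heavy_chain_cst r ^+ 2 * (wm * D) + e1 * c.
  by rewrite a2 /c; field; rewrite !gt_eqF.
rewrite tot in hpr2.
have t0 : 0 <= 4 * `|heavy_tail_cst r| * (wm * D) by rewrite mulr_ge0 // mulr_ge0.
rewrite /heavy_cst !mulrDl mul1r; lra.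
Qed.

(** * Deviations under weak moments of order above [2 * p] *)

Lemma normalized_powR (a x q : R) : 0 <= a -> 0 < x ->
  a `^ q / (x `^ q * n%:R `^ (q / 2)) = (a / (x * Num.sqrt n%:R)) `^ q.
Proof.
move=> a0 x_gt0; have s0 : 0 <= Num.sqrt n%:R :> R by exact: sqrtr_ge0.
have xs0 : 0 <= x * Num.sqrt n%:R by rewrite mulr_ge0 // ltW.
rewrite powRM ?invr_ge0 //; congr (_ * _).
rewrite -[in RHS]powR_inv1 // -powRrM mulN1r powRN; congr (_^-1).
rewrite powRM ?(ltW x_gt0) //; congr (_ * _).
by rewrite -powR12_sqrt // -powRrM; congr (_ `^ _); rewrite mulrC.
Qed.

Definition hj_order (q : R) : nat := Num.bound q.

(** With [j = hj_order q] and [t0 = n * x / (2 * 4 ^ j)], the second-moment bound at [t0] carries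
    [8 * 4 * 16 ^ j], and solving [6 * 16 ^ p * w ^ p = t0] for [w] gives the base
    [12 * 4 ^ j * 16 ^ p] in the tail term. *)
Definition moderate_cst (q r : R) : R :=
  (hj_cst R (hj_order q)).1 * (32 * 16 ^+ hj_order q) `^ q +
  (hj_cst R (hj_order q)).2 * (12 * 4 ^+ hj_order q * 16 `^ p) `^ r.

Lemma moderate_cst_ge0 q r : 0 <= moderate_cst q r.
Proof.
have [A1 B1] := hj_cst_ge1 R (hj_order q).
by rewrite addr_ge0 // mulr_ge0 ?powR_ge0 // (le_trans ler01).
Qed.

(* The Hoffmann-Jorgensen inequality is iterated until the exponent [2 ^ j] of the
   quadratic bound exceeds [q]; the hypothesis [K1 ^ 2 * u <= 1], with
   [u = I1 / (x sqrt n)], trades half of the resulting decay for a constant free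
   of [K1]. *)
Lemma endprob_le_moderate (T J : finType) (m : T -> R) (W : J -> R) (Y : T -> J -> R)
    (s : J -> R) (K1 I1 e q r x : R) (kappa := \sum_F W F * Num.sqrt (s F)) :
  (forall t, 0 <= m t) -> \sum_t m t = 1 -> (forall F, 0 <= W F) -> (forall F, 0 <= s F) ->
  (forall F, \sum_t m t * Y t F = 0) -> (forall F, \sum_t m t * Y t F ^+ 2 <= s F) ->
  (forall u v, 0 <= v -> 2 * kappa <= u -> 2 * e <= u ->
     6 * 16 `^ p * v `^ p <= u -> jumpprob m W Y u <= H v) ->
  0 < x -> 0 <= I1 -> 0 <= K1 -> kappa <= K1 * I1 -> e <= K1 * I1 ->
  K1 ^+ 2 * (I1 / (x * Num.sqrt n%:R)) <= 1 -> 0 < q ->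
  (weak_moment d x0 mu (r * p) < +oo)%E ->
  endprob m W Y n (n%:R * (x / 2)) (fun=> 0) <=
  moderate_cst q r * (I1 `^ q / (x `^ q * n%:R `^ (q / 2)) +
    fine (weak_moment d x0 mu (r * p)) / (x `^ r * n%:R `^ (r - 1))).
Proof.
move=> m0 m1 W0 s0 Y0 Yv jump xp I10 K10 hk he hu q0 wf.
have wm0 := weak_moment_ge0 wf; set wm := fine _ in wm0 *.
have nn : 0 < n%:R :> R by rewrite ltr0n.
have n1 : 1 <= n%:R :> R by rewrite ler1n.
have p0 : 0 < p by exact: lt_le_trans p_ge1.
have k0 : 0 <= kappa by apply: sumr_ge0 => F _; rewrite mulr_ge0 ?sqrtr_ge0.
have sn0 : 0 < Num.sqrt n%:R :> R by rewrite sqrtr_gt0.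
rewrite normalized_powR //.
set u := I1 / (x * Num.sqrt n%:R) in hu *.
have u0 : 0 <= u by rewrite divr_ge0 // mulr_ge0 // ltW.
have u2 : u ^+ 2 * (n%:R * x ^+ 2) = I1 ^+ 2.
  rewrite -[in n%:R * _](@sqr_sqrtr _ n%:R) ?(ltW nn) // /u.
  by field; rewrite !gt_eqF.
rewrite /moderate_cst; set j := hj_order q.
have [A1 B1] := hj_cst_ge1 R j.
set A := (hj_cst R j).1 in A1 *; set B := (hj_cst R j).2 in B1 *.
have A0 : 0 <= A by exact: le_trans A1.
have B0 : 0 <= B by exact: le_trans B1.
have qj : q <= (2 ^ j)%:R.
  by rewrite natrX ltW // /j /hj_order; exact: upper_nthrootP.
set G := wm / _.
have G0 : 0 <= G by rewrite divr_ge0 // mulr_ge0 // powR_ge0.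
have M16 : 0 < 16 ^+ j :> R by rewrite exprn_gt0.
have M4 : 0 < 4 ^+ j :> R by rewrite exprn_gt0.
have M164 : 16 ^+ j = 4 ^+ j ^+ 2 :> R by rewrite -exprM mulnC exprM; congr (_ ^+ _); ring.
pose v := 32 * 16 ^+ j * u.
have v0 : 0 <= v by rewrite mulr_ge0 // mulr_ge0 // ltW.
have vE : v `^ q = (32 * 16 ^+ j) `^ q * u `^ q 
  by rewrite /v (@powRM _ (32 * 16 ^+ j) u q) //; apply: mulr_ge0 => //; exact: ltW.
set Mr := (12 * _ * _) `^ r.
have Mr0 : 0 <= Mr by exact: powR_ge0.
have vq0 : 0 <= v `^ q by exact: powR_ge0.
suff main : endprob m W Y n (n%:R * (x / 2)) (fun=> 0) <= A * v `^ q + B * Mr * G.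
  apply: le_trans main _; rewrite vE; set c32 := (32 * _) `^ q; set uq := u `^ q.
  have c320 : 0 <= c32 by exact: powR_ge0.
  have uq0 : 0 <= uq by exact: powR_ge0.
  have -> : (A * c32 + B * Mr) * (uq + G) =
    A * (c32 * uq) + B * Mr * G + (A * c32 * G + B * Mr * uq) by ring.
  by rewrite lerDl; apply: addr_ge0; apply: mulr_ge0 => //; apply: mulr_ge0.
have BMG : 0 <= B * Mr * G by apply: mulr_ge0 => //; apply: mulr_ge0.
have [v1|v1] := lerP 1 v.
  apply: le_trans (endprob_le_maxprob W Y m0 m1 _ _ _) _.
  apply: le_trans (maxprob_le1 W Y m0 m1 _ _ _) _.
  have : 1 `^ q <= v `^ q by apply: ge0_ler_powR; rewrite ?nnegrE ?(ltW q0).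
  rewrite powR1 => h; apply: le_trans (_ : A * v `^ q <= _); last by rewrite lerDl.
  exact: mulr_ege1.
pose t0 := n%:R * x / (2 * 4 ^+ j).
have t00 : 0 < t0 by rewrite divr_gt0 // mulr_gt0.
have -> : n%:R * (x / 2) = 4 ^+ j * t0 by rewrite /t0; field; rewrite gt_eqF.
apply: le_trans (endprob_le_maxprob W Y m0 m1 _ _ _) _.
apply: le_trans (maxprob_iter Y m0 m1 W0 n j (ltW t00)) _.
have x2n : 0 < n%:R * x ^+ 2 by rewrite mulr_gt0 // exprn_gt0.
have K1u : (K1 * u) ^+ 2 <= u.
  by rewrite exprMn [u ^+ 2]expr2 mulrA ler_piMl.
have KI2 : (K1 * I1) ^+ 2 <= u * (n%:R * x ^+ 2).
  have -> : (K1 * I1) ^+ 2 = (K1 * u) ^+ 2 * (n%:R * x ^+ 2) by rewrite exprMn -u2; ring.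
  by rewrite ler_wpM2r // ltW.
have t02 : t0 ^+ 2 = n%:R * (n%:R * x ^+ 2) / (4 * 16 ^+ j).
  by rewrite M164 /t0; field; rewrite gt_eqF.
have KI : 2 * (K1 * I1) <= t0.
  rewrite -(@ler_pXn2r _ 2) ?nnegrE ?(ltW t00) ?mulr_ge0 //.
  rewrite exprMn t02 ler_pdivlMr ?mulr_gt0 //.
  apply: le_trans (_ : 2 ^+ 2 * (u * (n%:R * x ^+ 2)) * (4 * 16 ^+ j) <= _).
    by rewrite ler_wpM2r ?mulr_ge0 ?(ltW M16) // ler_wpM2l.
  apply: le_trans (_ : 1 * (n%:R * x ^+ 2) <= _); last by rewrite ler_wpM2r // ltW.
  have -> : 2 ^+ 2 * (u * (n%:R * x ^+ 2)) * (4 * 16 ^+ j) = (v / 2) * (n%:R * x ^+ 2).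
    by rewrite /v; field.
  by rewrite ler_wpM2r ?(ltW x2n) //; lra.
apply: lerD.
  rewrite ler_wpM2l //.
  have Qv : maxprob m W Y n t0 (fun=> 0) <= v.
    apply: le_trans (maxprob_le_second_moment m0 m1 W0 Y0 Yv s0 n t00) _.
    rewrite t02 -/kappa.
    apply: le_trans (_ : 32 * 16 ^+ j * ((K1 * I1) ^+ 2 / (n%:R * x ^+ 2)) <= _); last first.
      by rewrite /v ler_wpM2l ?mulr_ge0 ?(ltW M16) // ler_pdivrMr.
    have -> : 8 * (n%:R * kappa ^+ 2 / (n%:R * (n%:R * x ^+ 2) / (4 * 16 ^+ j))) =
       32 * 16 ^+ j * (kappa ^+ 2 / (n%:R * x ^+ 2)).
      by field; rewrite !gt_eqF.
    rewrite ler_wpM2l ?mulr_ge0 ?(ltW M16) // ler_wpM2r ?invr_ge0 ?(ltW x2n) //.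
    by rewrite lerXn2r ?nnegrE // (le_trans k0).
  have Q0 := maxprob_ge0 W Y m0 n t0 (fun=> 0).
  (* Here [v < 1], so lowering the exponent from [2 ^ j] to [q] only enlarges the bound. *)
  apply: le_trans (_ : v ^+ (2 ^ j) <= _); first by rewrite lerXn2r ?nnegrE.
  rewrite -powR_mulrn //; move: v0; rewrite le_eqVlt => /predU1P[<-|vp].
    by rewrite !powR0 ?gt_eqF // (lt_le_trans q0).
  rewrite -[(2 ^ j)%:R](subrK q) addrC powRD; last by rewrite (gt_eqF vp) implybT.
  by rewrite ler_piMr // powR_le1 ?subr_ge0 // ltW.
rewrite -[B * Mr * G]mulrA ler_wpM2l //.
have c0 : 0 < 6 * 16 `^ p :> R by rewrite mulr_gt0 // powR_gt0.
pose w := (t0 / (6 * 16 `^ p)) `^ p^-1.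
have tc0 : 0 < t0 / (6 * 16 `^ p) by rewrite divr_gt0.
have w0 : 0 < w by rewrite powR_gt0.
have wp : w `^ p = t0 / (6 * 16 `^ p) by rewrite /w -powRrM mulVf ?gt_eqF // powRr1 // ltW.
have hJ : jumpprob m W Y t0 <= H w.
  apply: jump; first exact: ltW.
  - by apply: le_trans KI; rewrite ler_wpM2l.
  - by apply: le_trans KI; rewrite ler_wpM2l.
  - by rewrite wp mulrC divfK // gt_eqF.
apply: le_trans (ler_wpM2l (ltW nn) (le_trans hJ (tailH_le_weak wf w0))) _.
rewrite -/wm le_eqVlt; apply/orP; left; apply/eqP.
have -> : w `^ (- (r * p)) = (12 * 4 ^+ j * 16 `^ p) `^ r / (n%:R * x) `^ r.
  rewrite mulrC -mulrN powRrM wp.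
  have -> : t0 / (6 * 16 `^ p) = (12 * 4 ^+ j * 16 `^ p / (n%:R * x))^-1.
    by rewrite /t0; field; rewrite !gt_eqF // powR_gt0.
  have h0 : 0 <= 12 * 4 ^+ j * 16 `^ p / (n%:R * x).
    by rewrite divr_ge0 ?mulr_ge0 ?powR_ge0 // ltW.
  rewrite -powR_inv1 // -powRrM mulN1r opprK powRM ?invr_ge0 ?mulr_ge0 ?powR_ge0 ?(ltW nn) ?(ltW M4) ?(ltW xp) //.
  by rewrite -[((n%:R * x)^-1)]powR_inv1 ?mulr_ge0 ?(ltW nn) ?(ltW xp) // -powRrM mulN1r powRN.
rewrite -/Mr /G powRM ?(ltW nn) ?(ltW xp) // powRB; last by rewrite (gt_eqF nn) implybT.
by rewrite powRr1 ?(ltW nn) //; field; rewrite !gt_eqF // powR_gt0.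
Qed.

Definition shell_bound : R := 1 + 2 `^ p * 4 `^ p.

Definition step_bound (b : bool) : R := if b then shell_bound else chain_bound.

Lemma step_bound_ge1 b : 1 <= step_bound b.
Proof.
by case: b; rewrite /= /shell_bound /chain_bound lerDl mulr_ge0 ?powR_ge0.
Qed.

(** The strict inequality between the integral and [I1] leaves a gap that absorbs the error in
    [kappa], and it keeps the case of a vanishing integral available. *)
Lemma moderate_bound (b : bool) (I1 q r x : R) : 1 < r -> 0 < q ->
  (weak_moment d x0 mu (r * p) < +oo)%E -> (I2pp d x0 mu p < +oo)%E -> 0 < x ->
  (b -> 16 `^ p * fine (pmoment d x0 mu p) <= x / 4) -> fine (I2pp d x0 mu p) < I1 ->
  step_bound b ^+ 2 * (I1 / (x * Num.sqrt n%:R)) <= 1 ->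
  (P [set w | x%:E < Wpp d p (empirical (fun i => X i w)) mu] <=
   (moderate_cst q r * (I1 `^ q / (x `^ q * n%:R `^ (q / 2)) +
    fine (weak_moment d x0 mu (r * p)) / (x `^ r * n%:R `^ (r - 1))))%:E)%E.
Proof.
move=> r1 q0 wf If xp hb II1 hu.
have p0 : 0 < p by exact: lt_le_trans p_ge1.
have psg : p < r * p by rewrite ltr_pMl.
have I0 := fine_I2pp_ge0; set I := fine (I2pp _ _ _ _) in I0 II1.
have I10 : 0 <= I1 by rewrite (le_trans I0) // ltW.
have K1 := step_bound_ge1 b; have K0 : 0 <= step_bound b by exact: le_trans K1.
apply/lee_addgt0Pr => e e0.
pose e1 := Num.min e (Num.min (x / 12) (I1 - I)).
have e10 : 0 < e1 by rewrite !lt_min e0 subr_gt0 II1 divr_gt0.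
have e1e : e1 <= e by rewrite ge_min lexx.
have e1x : e1 <= x / 12 by rewrite !ge_min lexx orbT.
have e1I : e1 <= I1 - I by rewrite !ge_min lexx !orbT.
have [T [J [m [W [Y [s [[m0 m1] [W0 s0] [Y0 Yv] [hk hj hP]]]]]]]] :=
  walk_reduction_small b psg wf If e10.
have hx : (if b then 16 `^ p * fine (pmoment d x0 mu p) else 0) + 3 * e1 <= x / 2.
  by move: hb; case: (b) => hb; [have := hb isT|]; lra.
apply: le_trans (hP x hx) _; rewrite -EFinD lee_fin [leRHS]addrC; apply: lerD => //.
have chain_le : chain_cst (~~ b) p alpha beta * 4 `^ p <= step_bound b.
  case: (b) => /=; rewrite /shell_bound /chain_bound.
    by rewrite /chain_cst eqxx addr0 lerDr.
  apply: le_trans (_ : `|chain_cst 1 p alpha beta| * 4 `^ p <= _); last by rewrite lerDr.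
  by rewrite ler_wpM2r ?powR_ge0 // ler_norm.
apply: (@endprob_le_moderate _ _ _ _ _ s (step_bound b) I1 e1) => //.
- apply: le_trans hk _; rewrite -/I.
  apply: le_trans (_ : step_bound b * I + step_bound b * (I1 - I) <= _); last first.
    by rewrite -mulrDr addrCA subrr addr0.
  apply: lerD; first by rewrite ler_wpM2r.
  by apply: le_trans e1I _; rewrite ler_peMl // subr_ge0 ltW.
- apply: le_trans e1I _; apply: le_trans (_ : I1 <= _); first by rewrite gerBl.
  by rewrite ler_peMl.
Qed.

(** In the range [x * sqrt n < 2 * chain_bound ^ 2 * I] the exponent [n * C * (x / I) ^ 2] is at
    most 2, which the factor [e ^ 2] compensates. *)
Definition subgaussian_cst : R := (2 * chain_bound ^+ 4)^-1.

(** [2 ^ q] comes from [I1 = 2 * I]; the last term makes the bound at least 1 when [x] exceeds the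
    moment threshold but [x * sqrt n < 2 * shell_bound ^ 2 * I], where no exponential term helps. *)
Definition tail_cst (q r : R) : R :=
  1 + 2 `^ q * moderate_cst q r + (2 * shell_bound ^+ 2) `^ q.

Lemma tail_cst_gt0 q r : 0 < tail_cst q r.
Proof.
by rewrite ltr_wpDr ?powR_ge0 // ltr_wpDr // mulr_ge0 ?powR_ge0 ?moderate_cst_ge0.
Qed.

Lemma moderate_deviation_bound r q x : 2 < r -> r < q -> (weak_moment d x0 mu (r * p) < +oo)%E -> 0 < x ->
  (P [set w | (x%:E < Wpp d p (empirical (fun i => X i w)) mu)%E] <=
    (expR 2 * expR (- (n%:R * subgaussian_cst * (x / fine (I2pp d x0 mu p)) ^+ 2))
        * (if (x%:E <= (4 * 16 `^ p)%:E * pmoment d x0 mu p)%E then 1 else 0)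
     + tail_cst q r * ((fine (I2pp d x0 mu p)) `^ q / (x `^ q * n%:R `^ (q / 2))
                   + fine (weak_moment d x0 mu (r * p)) / (x `^ r * n%:R `^ (r - 1))))%:E)%E.
Proof.
move=> r2 rq wf xp; have wm0 := weak_moment_ge0 wf.
have nn : 0 < n%:R :> R by rewrite ltr0n.
have p0 : 0 < p by exact: lt_le_trans p_ge1.
have r1 : 1 < r by lra.
have q0 : 0 < q by lra.
have If : (I2pp d x0 mu p < +oo)%E.
  by apply: (I2pp_fin polish_d p_ge1 wf); rewrite ltr_pM2r.
have I0 := fine_I2pp_ge0; set I := fine (I2pp _ _ _ _) in I0 *.
have sn0 : 0 < Num.sqrt n%:R :> R by rewrite sqrtr_gt0.
set sn := Num.sqrt n%:R in sn0.
have xs0 : 0 < x * sn by rewrite mulr_gt0.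
set G := fine _ / _; have G0 : 0 <= G by rewrite divr_ge0 // mulr_ge0 // powR_ge0.
set F := I `^ q / _; have FE : F = (I / (x * sn)) `^ q by exact: normalized_powR.
have F0 : 0 <= F by rewrite FE powR_ge0.
have C0 := moderate_cst_ge0 q r.
have t1 : 1 <= 2 `^ q :> R.
  by have := @ge0_ler_powR R q (ltW q0) 1 2; rewrite powR1 !nnegrE; apply; rewrite ?ler1n.
have double (b : bool) : 0 < I -> (b -> 16 `^ p * fine (pmoment d x0 mu p) <= x / 4) ->
    step_bound b ^+ 2 * (2 * I) <= x * sn ->
    (P [set w | (x%:E < Wpp d p (empirical (fun i => X i w)) mu)%E] <=
     (tail_cst q r * (F + G))%:E)%E.
  move=> Ip hb hs.
  have II : I < 2 * I by lra.
  apply: le_trans (@moderate_bound b (2 * I) q r x r1 q0 wf If xp hb II _) _.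
    by rewrite mulrA ler_pdivrMr // mul1r.
  rewrite lee_fin -/G powRM // -mulrA -/F.
  apply: le_trans (_ : moderate_cst q r * (2 `^ q * (F + G)) <= _).
    by rewrite ler_wpM2l // mulrDr lerD2l ler_peMl.
  rewrite mulrA [_ * 2 `^ q]mulrC ler_wpM2r ?addr_ge0 // /tail_cst.
  have := powR_ge0 (2 * shell_bound ^+ 2) q; lra.
have tc0 := tail_cst_gt0 q r.
have FG : 0 <= tail_cst q r * (F + G) by apply: mulr_ge0; [exact: ltW|exact: addr_ge0].
case: ifPn => [_|hpm].
  rewrite mulr1 -expRD.
  have K1 := step_bound_ge1 false; rewrite /= in K1.
  have K0 : 0 < chain_bound by exact: lt_le_trans K1.
  have trivial : n%:R * subgaussian_cst * (x / I) ^+ 2 <= 2 ->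
     (P [set w | (x%:E < Wpp d p (empirical (fun i => X i w)) mu)%E] <=
      (expR (2 - n%:R * subgaussian_cst * (x / I) ^+ 2) + tail_cst q r * (F + G))%:E)%E.
    move=> h; apply: le_trans (deviation_le1 x) _; rewrite lee_fin.
    apply: le_trans (_ : expR 0 <= _); first by rewrite expR0.
    by apply: le_trans (_ : expR (2 - n%:R * subgaussian_cst * (x / I) ^+ 2) <= _);
      [rewrite ler_expR subr_ge0|rewrite lerDl].
  (* For [I = 0] the quotient [x / I] is 0 by convention, so the exponential term is [e ^ 2] and the
     bound is trivial. *)
  have [I00|In0] := eqVneq I 0; first by apply: trivial; rewrite I00 invr0 mulr0 expr0n mulr0.
  have Ip : 0 < I by rewrite lt_neqAle eq_sym In0.
  have [small|big] := lerP (chain_bound ^+ 2 * (2 * I)) (x * sn).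
    by apply: le_trans (double false Ip _ small) _ => //; rewrite lee_fin lerDr expR_ge0.
  apply: trivial.
  have -> : n%:R * subgaussian_cst * (x / I) ^+ 2 =
     (x * sn) ^+ 2 / (2 * (chain_bound ^+ 2 * I) ^+ 2).
    have -> : n%:R = sn ^+ 2 by rewrite sqr_sqrtr // ltW.
    by rewrite /subgaussian_cst; field; rewrite !gt_eqF.
  have KI : 0 < chain_bound ^+ 2 * I by rewrite mulr_gt0 // exprn_gt0.
  rewrite ler_pdivrMr ?mulr_gt0 ?exprn_gt0 //.
  have -> : 2 * (2 * (chain_bound ^+ 2 * I) ^+ 2) = (chain_bound ^+ 2 * (2 * I)) ^+ 2 by ring.
  by rewrite lerXn2r ?nnegrE ?(ltW xs0) ?(ltW big) // mulrCA mulr_ge0 // ltW.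
rewrite mulr0 add0r.
(* The threshold [4 * 16 ^ p] is exactly what leaves the cost of the unrefined shells below a
   quarter of [x]. *)
have hb : 16 `^ p * fine (pmoment d x0 mu p) <= x / 4.
  move: hpm; rewrite -ltNge.
  have pmE : pmoment d x0 mu p = (fine (pmoment d x0 mu p))%:E.
    rewrite fineK // ge0_fin_numE //; apply: integral_ge0 => y _.
    by rewrite lee_fin powR_ge0.
  by rewrite pmE /= -EFinM lte_fin; lra.
have K1 := step_bound_ge1 true; rewrite /= in K1.
have K0 : 0 < shell_bound by exact: lt_le_trans K1.
have K20 : 0 < shell_bound ^+ 2 by rewrite exprn_gt0.
have [I00|In0] := eqVneq I 0; last first.
  have Ip : 0 < I by rewrite lt_neqAle eq_sym In0.
  have [small|big] := lerP (shell_bound ^+ 2 * (2 * I)) (x * sn); first exact: (double true).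
  apply: le_trans (deviation_le1 x) _; rewrite lee_fin.
  apply: le_trans (_ : (2 * shell_bound ^+ 2) `^ q * F <= _); last first.
    apply: le_trans (_ : tail_cst q r * F <= _); last first.
      by rewrite ler_wpM2l ?lerDl ?(ltW tc0).
    rewrite ler_wpM2r // /tail_cst lerDr addr_ge0 // mulr_ge0 //; lra.
  have a1 : 0 <= 2 * shell_bound ^+ 2 by apply: mulr_ge0 => //; exact: ltW.
  have a2 : 0 <= I / (x * sn) by apply: divr_ge0 => //; exact: ltW.
  rewrite FE -powRM //.
  have h : 1 <= 2 * shell_bound ^+ 2 * (I / (x * sn)).
    by rewrite mulrA ler_pdivlMr // mul1r -mulrA mulrCA ltW.
  have := @ge0_ler_powR R q (ltW q0) 1 _; rewrite powR1 !nnegrE; apply => //.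
  exact: le_trans h.
apply: le_trans (_ : (moderate_cst q r * G)%:E <= _)%E; last first.
  rewrite lee_fin; apply: le_trans (_ : tail_cst q r * G <= _); last first.
    by rewrite ler_wpM2l ?lerDr ?(ltW tc0).
  rewrite ler_wpM2r // /tail_cst.
  have : moderate_cst q r <= 2 `^ q * moderate_cst q r by rewrite ler_peMl.
  have := powR_ge0 (2 * shell_bound ^+ 2) q; lra.
apply/lee_addgt0Pr => e e0.
pose c := moderate_cst q r + 1; have c0 : 0 < c by rewrite ltr_wpDl.
(* With [I = 0] and no exponential term, a positive [I1] must be made negligible: the first entry of
   the minimum ensures the smallness condition, the second brings the [q]-th power term below
   [e]. *)
pose I1 := x * sn * Num.min (shell_bound ^+ 2)^-1 ((e / c) `^ q^-1).
have mn0 : 0 < Num.min (shell_bound ^+ 2)^-1 ((e / c) `^ q^-1).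
  by rewrite lt_min invr_gt0 K20 powR_gt0 // divr_gt0.
have I10 : 0 < I1 by rewrite mulr_gt0.
have IE : I1 / (x * sn) = Num.min (shell_bound ^+ 2)^-1 ((e / c) `^ q^-1).
  by rewrite /I1 mulrC mulrA mulVf ?mul1r // gt_eqF.
have II1 : I < I1 by rewrite I00.
apply: le_trans (@moderate_bound true I1 q r x r1 q0 wf If xp (fun=> hb) II1 _) _.
  by rewrite IE -ler_pdivlMl // mulr1 ge_min lexx.
rewrite -/G normalized_powR ?(ltW I10) // -/sn IE -EFinD lee_fin mulrDr addrC lerD2l.
apply: le_trans (_ : c * (e / c) <= _); last by rewrite mulrC divfK // gt_eqF.
apply: ler_pM => //; first exact: powR_ge0.
  by rewrite lerDl.
have ec : 0 <= e / c by rewrite divr_ge0 // ltW.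
have {2}-> : e / c = ((e / c) `^ q^-1) `^ q by rewrite -powRrM mulVf ?gt_eqF // powRr1.
apply: ge0_ler_powR; rewrite ?nnegrE ?powR_ge0 ?(ltW q0) ?(ltW mn0) //.
by rewrite ge_min lexx orbT.
Qed.

End Core.

Theorem theorem2 (R : realType) :
  (* ---------------- part (1) ---------------- *)
  (exists (C1 : R -> R -> R -> R) (Cp : R -> R) (C3 : R -> R -> R -> R),
    [/\ (forall a b c, 0 < C1 a b c), (forall a, 0 < Cp a), (forall a b c, 0 < C3 a b c) &
    forall (dE : measure_display) (E : measurableType dE) (d : E -> E -> R) (x0 : E)
      (mu : probability E R) (dO : measure_display) (O : measurableType dO)
      (P : probability O R) (n : nat) (X : 'I_n -> O -> E) (S : set E) (p alpha beta : R),
      polish d -> (0 < n)%N -> iid P mu X -> measurable S -> mu S = 1%E ->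
      1 <= p -> 0 < alpha -> alpha < 2 * p -> 0 < beta ->
      (forall r delta, 0 < r -> 0 < delta -> delta <= 2 * r ->
         (covering_number d (S `&` cball d x0 r) delta <= (beta * (2 * r / delta) `^ alpha)%:E)%E) ->
      forall r, 2 < r -> (weak_moment d x0 mu (r * p) < +oo)%E ->
      forall q, r < q -> forall x, 0 < x ->
      (P [set w | (x%:E < Wpp d p (empirical (fun i => X i w)) mu)%E] <=
        (expR 2 * expR (- (n%:R * C1 p alpha beta * (x / fine (I2pp d x0 mu p)) ^+ 2))
            * (if (x%:E <= (Cp p)%:E * pmoment d x0 mu p)%E then 1 else 0)
         + C3 p q r * ((fine (I2pp d x0 mu p)) `^ q / (x `^ q * n%:R `^ (q / 2))
                       + fine (weak_moment d x0 mu (r * p)) / (x `^ r * n%:R `^ (r - 1))))%:E)%E])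
  /\
  (* ---------------- part (2) ---------------- *)
  (exists C : R -> R -> R -> R,
    (forall a b c, 0 < C a b c) /\
    forall (dE : measure_display) (E : measurableType dE) (d : E -> E -> R) (x0 : E)
      (mu : probability E R) (dO : measure_display) (O : measurableType dO)
      (P : probability O R) (n : nat) (X : 'I_n -> O -> E) (S : set E) (p alpha beta : R),
      polish d -> (0 < n)%N -> iid P mu X -> measurable S -> mu S = 1%E ->
      1 <= p -> 0 < alpha -> alpha < 2 * p -> 0 < beta ->
      (forall r delta, 0 < r -> 0 < delta -> delta <= 2 * r ->
         (covering_number d (S `&` cball d x0 r) delta <= (beta * (2 * r / delta) `^ alpha)%:E)%E) ->
      (I2pp d x0 mu p < +oo)%E ->
      forall x, 0 < x ->
      (P [set w | (x%:E < Wpp d p mu (empirical (fun i => X i w)))%E] <=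
        (C p alpha beta * (fine (I2pp d x0 mu p)) ^+ 2 / (x ^+ 2 * n%:R))%:E)%E)
  /\
  (* ---------------- part (3) ---------------- *)
  (exists C : R -> R -> R -> R -> R,
    (forall a b c e, 0 < C a b c e) /\
    forall (dE : measure_display) (E : measurableType dE) (d : E -> E -> R) (x0 : E)
      (mu : probability E R) (dO : measure_display) (O : measurableType dO)
      (P : probability O R) (n : nat) (X : 'I_n -> O -> E) (S : set E) (p alpha beta : R),
      polish d -> (0 < n)%N -> iid P mu X -> measurable S -> mu S = 1%E ->
      1 <= p -> 0 < alpha -> alpha < 2 * p -> 0 < beta ->
      (forall r delta, 0 < r -> 0 < delta -> delta <= 2 * r ->
         (covering_number d (S `&` cball d x0 r) delta <= (beta * (2 * r / delta) `^ alpha)%:E)%E) ->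
      forall r, 1 < r -> r < 2 -> (weak_moment d x0 mu (r * p) < +oo)%E ->
      forall x, 0 < x ->
      (P [set w | (x%:E < Wpp d p mu (empirical (fun i => X i w)))%E] <=
        (C p alpha beta r * fine (weak_moment d x0 mu (r * p)) / (x `^ r * n%:R `^ (r - 1)))%:E)%E).
Proof.
have chain_gt0 p a b : 0 < chain_bound p a b :> R.
  exact: lt_le_trans ltr01 (step_bound_ge1 p a b false).
split; [|split].
- exists (@subgaussian_cst R), (fun p => 4 * 16 `^ p), (fun p q r => tail_cst p q r); split.
  + by move=> p a b; rewrite invr_gt0 mulr_gt0 // exprn_gt0.
  + by move=> p; rewrite mulr_gt0 // powR_gt0.
  + by move=> p q r; exact: tail_cst_gt0.
  move=> dE E d x0 mu dO O P n X S p alpha beta polish_d n_gt0 iidX mS muS p1 a0 a2p b0 cov.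
  move=> r r2 wf q rq x xp.
  have pr : p < r * p by rewrite ltr_pMl; lra.
  exact: (moderate_deviation_bound polish_d n_gt0 iidX mS muS p1 a0 a2p b0 cov
    (pmoment_fin polish_d p1 wf pr) r2 rq wf xp).
- exists (fun p a b => 8 * chain_bound p a b ^+ 2); split.
    by move=> p a b; rewrite mulr_gt0 // exprn_gt0.
  move=> dE E d x0 mu dO O P n X S p alpha beta polish_d n_gt0 iidX mS muS p1 a0 a2p b0 cov.
  (* The bounds are proved with the empirical measure as first marginal, so the transport cost is
     first symmetrized. *)
  move=> If x xp; under eq_set do rewrite (Wpp_sym polish_d).
  have pr : p < 2 * p by rewrite ltr_pMl; lra.
  have wf := weak_moment_le_I2pp polish_d p1 If.
  exact: (second_moment_bound polish_d n_gt0 iidX mS muS p1 a0 a2p b0 cov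
    (pmoment_fin polish_d p1 wf pr) If xp).
- exists (@heavy_cst R); split.
    move=> p a b r; apply: ltr_wpDr; first by rewrite mulr_ge0 // sqr_ge0.
    by apply: ltr_wpDr => //; rewrite mulr_ge0.
  move=> dE E d x0 mu dO O P n X S p alpha beta polish_d n_gt0 iidX mS muS p1 a0 a2p b0 cov.
  move=> r r1 r2 wf x xp; under eq_set do rewrite (Wpp_sym polish_d).
  have pr : p < r * p by rewrite ltr_pMl; lra.
  exact: (heavy_tail_bound polish_d n_gt0 iidX mS muS p1 a0 a2p b0 cov
    (pmoment_fin polish_d p1 wf pr) r1 r2 wf xp).
Qed.
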